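(* Let $X_i$, $i\in\mathbb{N}$, be i.i.d. non-negative random variables which are regularly varying with index $-1$. Assume that $\alpha_i,\beta_i\ge 0$, $i\in\mathbb{N}$, are such that neither all $\alpha_i$ nor all $\beta_i$ are equal to $0$, and $\sum_{i=1}^\infty\alpha_i<\infty$, $\sum_{i=1}^\infty\beta_i<\infty$. Then the limits $$Y_0:=\lim_{n\to\infty}\prod_{i=1}^nX_i^{\alpha_i},\qquad Y_1:=\lim_{n\to\infty}\prod_{i=1}^nX_i^{\beta_i}$$ exist almost surely. Assume that $P(Y_i>0)>0$ for $i=0,1$. Then the optimization problem $$\sum_{i=1}^\infty\kappa_i\to\min!\quad\text{under the constraints}\quad\sum_{i=1}^\infty\alpha_i\kappa_i\ge1,\ \sum_{i=1}^\infty\beta_i\kappa_i\ge1,\ \kappa_i\ge0\ \ \forall i\in\mathbb{N}\qquad( * )$$ has a solution $(\kappa_i)_{i\in\mathbb{N}}$. (i) For all $\varepsilon>0$, as $x\to\infty$, $$P(Y_0>x,Y_1>x)=o\bigl(x^{\varepsilon-\sum_{i=1}^\infty\kappa_i}\bigr),\qquad x^{-\varepsilon-\sum_{i=1}^\infty\kappa_i}=o\bigl(P(Y_0>x,Y_1>x)\bigr).$$ If the solution to $( * )$ is unique, then at most two of the $\kappa_i$ are strictly positive. (ii) If the solution is unique with $\kappa_i,\kappa_j>0$ for some $i\ne j$, then for all $s_0,s_1>0$ $$\lim_{x\to\infty}\frac{P(Y_0>s_0x,\,Y_1>s_1x)}{P(X_i>x^{\kappa_i})P(X_j>x^{\kappa_j})}=D\bigl(s_0^{\beta_i-\beta_j}s_1^{\alpha_j-\alpha_i}\bigr)^{1/(\alpha_i\beta_j-\alpha_j\beta_i)}$$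 with $$D:=\frac{|\alpha_i\beta_j-\alpha_j\beta_i|}{(\alpha_i-\alpha_j)(\beta_j-\beta_i)}\,E\Bigl(\prod_{m\in\mathbb{N}\setminus\{i,j\}}X_m^{(\alpha_m(\beta_j-\beta_i)+\beta_m(\alpha_i-\alpha_j))/(\alpha_i\beta_j-\alpha_j\beta_i)}\Bigr)<\infty.$$ (iii) If the solution is unique with $\kappa_i>0$ for exactly one $i\in\mathbb{N}$ and $\kappa_j=0$ for all other $j$, then for all $s_0,s_1>0$ the limit $$\lim_{x\to\infty}\frac{P(Y_0>s_0x,\,Y_1>s_1x)}{P(X_i>x^{\kappa_i})}$$ exists, is finite, and equals - $E\Bigl(\min\bigl(s_0^{-1}\prod_{j\in\mathbb{N}\setminus\{i\}}X_j^{\alpha_j},\ s_1^{-1}\prod_{j\in\mathbb{N}\setminus\{i\}}X_j^{\beta_j}\bigr)^{1/\beta_i}\Bigr)$ if $\alpha_i=\beta_i$; - $E\Bigl(\prod_{j\in\mathbb{N}\setminus\{i\}}X_j^{\beta_j/\beta_i}\mathbf{1}_{\{X_j^{\alpha_j}>0\}}\Bigr)s_1^{-1/\beta_i}$ if $\alpha_i>\beta_i$; - $E\Bigl(\prod_{j\in\mathbb{N}\setminus\{i\}}X_j^{\alpha_j/\alpha_i}\mathbf{1}_{\{X_j^{\beta_j}>0\}}\Bigr)s_0^{-1/\alpha_i}$ if $\alpha_i<\beta_i$.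
   Context: A non-negative random variable $X$ is regularly varying with index $-1$ if $P(X>x)>0$ for all $x$ and $P(X>sx)/P(X>x)\to s^{-1}$ as $x\to\infty$ for every $s>0$. Convention: $0^0:=1$ (so $X_j^{0}=1$ always). Infinite products are understood as almost sure limits of partial products. *)

(* Defs.v *)
From HB Require Import structures.
From mathcomp Require Export all_boot all_order all_algebra finmap.
From mathcomp Require Export all_classical all_reals all_analysis.
Export Order.TTheory GRing.Theory Num.Theory.
Export numFieldNormedType.Exports.

Set Implicit Arguments.
Unset Strict Implicit.
Unset Printing Implicit Defensive.

Local Open Scope classical_set_scope.
Local Open Scope ring_scope.

(* Lets the Landau notations be used at +oo. *)
Canonical pinfty_filter_on (R : numFieldType) :=
  FilterType (pinfty_nbhs R) (@proper_pinfty_nbhs R).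

Section RandomVariables.
Context {R : realType} {d : measure_display} {T : measurableType d}.
Variable P : probability T R.

Definition prob (A : set T) : R := fine (P A).

Definition mutually_independent (X : nat -> {RV P >-> R}) : Prop :=
  forall (J : {fset nat}) (B : nat -> set R),
    (forall i, i \in J -> measurable (B i)) ->
    P (\bigcap_(i in [set` J]) (X i @^-1` B i)) =
    (\prod_(i <- J) P (X i @^-1` B i))%E.

(* Restricted to measurable sets: a measure is unspecified on the others. *)
Definition identically_distributed (X : nat -> {RV P >-> R}) : Prop :=
  forall (i j : nat) (B : set R), measurable B ->
    distribution P (X i) B = distribution P (X j) B.

Definition regularly_varying_m1 (X : {RV P >-> R}) : Prop :=
  (forall x : R, 0 < prob [set t | X t > x]) /\
  (forall s : R, 0 < s ->
    prob [set t | X t > s * x] / prob [set t | X t > x] @[x --> +oo] --> s^-1).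

(* Product of the f m over the indices m with A m, as a pointwise limit in R.
   limn takes the default value 0 at points where the partial products diverge;
   this only matters on a null set when the limit exists almost surely. *)
Definition infprod (A : pred nat) (f : nat -> T -> R) (t : T) : R :=
  limn (fun n => \prod_(0 <= m < n | A m) f m t).

End RandomVariables.

Section LinearProgram.
Context {R : realType}.
Variables alpha beta : nat -> R.

(* The sums of nonnegative terms take values in [0, +oo]. *)
Definition feasible (kappa : nat -> R) : Prop :=
  [/\ forall i, 0 <= kappa i,
      (1 <= \sum_(0 <= i <oo) (alpha i * kappa i)%:E)%E &
      (1 <= \sum_(0 <= i <oo) (beta i * kappa i)%:E)%E].

Definition objective (kappa : nat -> R) : \bar R :=
  (\sum_(0 <= i <oo) (kappa i)%:E)%E.

Definition optimal (kappa : nat -> R) : Prop :=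
  feasible kappa /\
  forall kappa', feasible kappa' -> (objective kappa <= objective kappa')%E.

Definition unique_optimal (kappa : nat -> R) : Prop :=
  optimal kappa /\ forall kappa', optimal kappa' -> kappa' = kappa.

End LinearProgram.

(* Main.v *)
(* Let [m] be the optimal value of the dual of the linear program, i.e. the minimum over [lam]
   in [0, 1] of the supremum of [lam alpha_k + (1 - lam) beta_k]; the optimal value of the program
   is [1 / m].  Markov's inequality for the product of the [max (X_k, 1)] to powers slightly below
   [(lam alpha_k + (1 - lam) beta_k) / m] gives the upper bound of (i); making one or two factors
   as large as the optimal [kappa] prescribes, the others staying bounded below, gives the lower
   bound.

   If the optimal [kappa] has one positive entry [i], the event is [X_i N_x > y_x] with [N_x]
   independent of [X_i], and Breiman's argument (Potter bounds and dominated convergence)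
   applies; uniqueness provides the moment of order [1 + eta] of [N_x] that it needs.

   If [kappa_i, kappa_j > 0], uniqueness forces both constraints to be tight and
   [(alpha_i - alpha_j) (beta_j - beta_i) > 0].  The event is then
   [X_j / x^kappa_j * Phi (X_i / x^kappa_i, U, V) > 1], with [U, V] the products of the other
   factors and [Phi] an explicit function.  Writing the law of [X_i / x^kappa_i] as the image of
   Lebesgue measure on ]0, +oo[ by a quantile function that converges to [w |-> 1 / w], dominated
   convergence, first in [w] and then in [(U, V)], gives the limit
   [E (\int Phi (1 / w, U, V) dw)]. *)
From HB Require Import structures.
Require Import Defs.
From mathcomp Require Import ring lra measurable_realfun.

Set Implicit Arguments.
Unset Strict Implicit.
Unset Printing Implicit Defensive.

Local Open Scope classical_set_scope.
Local Open Scope ring_scope.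

(** * Minimax for two sequences *)

(** Both limit theorems use dominated convergence, so the search for integrable bounds shapes the
    proof. A tail of index -1 has finite moments of every order below 1, and the product of the
    [max (X_k, 1)] to summable exponents has finite expectation once these are at most some
    [th < 1]. Uniqueness of the optimum yields strict inequalities, one per index; as the exponents
    tend to 0 they hold with a uniform margin, which leaves room for the exponents [1 + eta] and
    [1 - eta] of Potter's bounds.

    A second obstacle is at 0: the [X_k] may vanish with positive probability, and positivity is
    given for [Y_0] and [Y_1] separately only. The lower bound needs it jointly, with factors
    removed; it follows from a zero-one argument on the products of the [min (X_k, 1)] powers over
    [k >= N].

    With two large factors, the law of [X_i / x^kappa_i] divided by the tail at [x^kappa_i] has
    total mass tending to infinity. The quantile function replaces it by pointwise convergence of
    functions under one fixed measure. *)

Section LinearProgramDuality.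
Context {R : realType}.
Implicit Types a b : nat -> R.

(** At a minimizer of the maximum [g] of finitely many affine functions of [l], some active function
    has slope [<= 0] and some active one has slope [>= 0]. The convex combination of the two with
    slope zero is constant in [l], so both its coordinates equal the minimum. At an endpoint of
    [0, 1] one active index is enough. *)
Lemma minimax_finite (N : nat) a b (i0 j0 : nat) :
  (forall k, 0 <= a k) -> (forall k, 0 <= b k) ->
  (i0 < N)%N -> (j0 < N)%N -> 0 < a i0 -> 0 < b j0 ->
  exists lam m : R, [/\ 0 <= lam <= 1, 0 < m,
    forall k, (k < N)%N -> lam * a k + (1 - lam) * b k <= m &
    exists (i j : nat) (p q : R), [/\ 0 <= p, 0 <= q, p + q = 1,
      m <= p * a i + q * a j & m <= p * b i + q * b j]].
Proof.
move=> a0 b0 iN jN ai bj.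
pose f (k : nat) (l : R) := l * a k + (1 - l) * b k.
pose g (l : R) := \big[Num.max/0]_(k <- iota 0 N) f k l.
have fcont k : continuous (f k).
  move=> x; apply: cvgD; first by apply: cvgMl; exact: cvg_id.
  apply: cvgMl; apply: cvgB; [exact: cvg_cst|exact: cvg_id].
have gcont : continuous g.
  rewrite /g; elim: (iota 0 N) => [|k s IH] x.
    rewrite [X in continuous_at _ X](_ : _ = cst 0); first exact: cvg_cst.
    by apply/funext => y; rewrite big_nil.
  rewrite [X in continuous_at _ X](_ : _ =
      fun l => Num.max (f k l) (\big[Num.max/0]_(j <- s) f j l)); last first.
    by apply/funext => y; rewrite big_cons.
  by apply: continuous_max; [exact: fcont|exact: IH].
have fg k l : (k < N)%N -> f k l <= g l.
  move=> kN; apply: (@le_bigmax_seq _ _ _ (iota 0 N) 0 k xpredT (f^~ l)) => //.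
  by rewrite mem_iota.
have glt l c : 0 < c -> (forall k, (k < N)%N -> f k l < c) -> g l < c.
  move=> c0 H; rewrite /g big_seq; apply: bigmax_lt => // k.
  by rewrite mem_iota add0n => /= kN; exact: H.
have [l l01 lmin] := @EVT_min R g 0 1 ler01 (continuous_subspaceT gcont).
move: l01; rewrite in_itv /= => /andP[l0 l1].
have g0 : 0 < g l.
  have [l0'|l0'] := eqVneq l 0.
    apply: lt_le_trans (fg _ l jN).
    by rewrite /f l0' mul0r add0r subr0 mul1r.
  apply: lt_le_trans (fg _ l iN); rewrite /f.
  have h1 : 0 < l * a i0 by rewrite mulr_gt0// lt0r l0' l0.
  have h2 : 0 <= (1 - l) * b i0 by rewrite mulr_ge0// subr_ge0.
  lra.
(* Otherwise every index attaining [g l] has positive slope, and [g] would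
   decrease to the left of [l]. *)
have active_le : 0 < l -> exists k, [/\ (k < N)%N, f k l = g l & a k <= b k].
  move=> lgt0; apply: contrapT => H.
  have near_lt : \forall x \near l^'-, forall k : 'I_N, f k x < g l.
    apply: filter_forall => k.
    have [fk|fk] := eqVneq (f k l) (g l).
      have abk : b k < a k.
        by rewrite ltNge; apply/negP => abk; apply: H; exists k; split.
      near=> x; have xl : x < l by near: x; exact: nbhs_left_lt.
      rewrite -fk /f; have : 0 < (l - x) * (a k - b k) by rewrite mulr_gt0// subr_gt0.
      lra.
    have fkl : f k l < g l by rewrite lt_neqAle fk fg.
    have : f k x @[x --> l^'-] --> f k l.
      by apply: cvg_at_left_filter; exact: fcont.
    by move/cvgr_lt; apply.
  have : \forall x \near l^'-, g l < g l.
    near=> x.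
    have x0 : 0 < x by near: x; exact: nbhs_left_gt.
    have xl : x < l by near: x; exact: nbhs_left_lt.
    apply: (@le_lt_trans _ _ (g x)).
      by apply: lmin; rewrite in_itv /= ltW// (le_trans (ltW xl)).
    apply: glt => // k kN.
    have : forall k : 'I_N, f k x < g l by near: x.
    by move=> /(_ (Ordinal kN)).
  by move=> /filter_ex[x]; rewrite ltxx.
have active_ge : l < 1 -> exists k, [/\ (k < N)%N, f k l = g l & b k <= a k].
  move=> lgt0; apply: contrapT => H.
  have near_lt : \forall x \near l^'+, forall k : 'I_N, f k x < g l.
    apply: filter_forall => k.
    have [fk|fk] := eqVneq (f k l) (g l).
      have abk : a k < b k.
        by rewrite ltNge; apply/negP => abk; apply: H; exists k; split.
      near=> x; have xl : l < x by near: x; exact: nbhs_right_gt.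
      rewrite -fk /f; have : 0 < (x - l) * (b k - a k) by rewrite mulr_gt0// subr_gt0.
      lra.
    have fkl : f k l < g l by rewrite lt_neqAle fk fg.
    have : f k x @[x --> l^'+] --> f k l.
      by apply: cvg_at_right_filter; exact: fcont.
    by move/cvgr_lt; apply.
  have : \forall x \near l^'+, g l < g l.
    near=> x.
    have x0 : x < 1 by near: x; exact: nbhs_right_lt.
    have xl : l < x by near: x; exact: nbhs_right_gt.
    apply: (@le_lt_trans _ _ (g x)).
      by apply: lmin; rewrite in_itv /= (ltW x0) (le_trans l0 (ltW xl)).
    apply: glt => // k kN.
    have : forall k : 'I_N, f k x < g l by near: x.
    by move=> /(_ (Ordinal kN)).
  by move=> /filter_ex[x]; rewrite ltxx.
exists l, (g l); split; [by rewrite l0 l1|by []|by move=> k kN; exact: fg|].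
have [l0'|l0'] := eqVneq l 0.
  have [|k [kN fk bak]] := active_ge; first by rewrite l0'.
  exists k, k, 1, 0; split => //; first lra.
  - by rewrite -fk /f l0'; lra.
  - by rewrite -fk /f l0'; lra.
have [l1'|l1'] := eqVneq l 1.
  have [|k [kN fk bak]] := active_le; first by rewrite l1'.
  exists k, k, 1, 0; split => //; first lra.
  - by rewrite -fk /f l1'; lra.
  - by rewrite -fk /f l1'; lra.
have [|k [kN fk bak]] := active_le; first by rewrite lt0r l0'.
have [|h [hN fh bah]] := active_ge; first by rewrite lt_neqAle l1'.
(* Both summands are nonnegative, so if the sum vanishes then [a h = b h] and [h] alone does the
   work. *)
have [e|e] := eqVneq (a h - b h + (b k - a k)) 0.
  have abh : a h = b h by lra.
  exists h, h, 1, 0; split => //; first lra.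
  - by rewrite -fh /f abh; lra.
  - by rewrite -fh /f abh; lra.
set D := a h - b h + (b k - a k) in e.
have D0 : 0 < D by rewrite lt0r e /= /D; lra.
(* The weights cancel the slopes: [p (a k - b k) + q (a h - b h) = 0]. *)
exists k, h, ((a h - b h) / D), ((b k - a k) / D); split.
- by apply: divr_ge0; [rewrite subr_ge0|exact: ltW].
- by apply: divr_ge0; [rewrite subr_ge0|exact: ltW].
- by rewrite -mulrDl divff.
- rewrite le_eqVlt; apply/orP; left; apply/eqP.
  transitivity (((a h - b h) / D) * f k l + ((b k - a k) / D) * f h l).
    by rewrite fk fh -mulrDl -mulrDl divff ?mul1r.
  by rewrite /f /D; field.
- rewrite le_eqVlt; apply/orP; left; apply/eqP.
  transitivity (((a h - b h) / D) * f k l + ((b k - a k) / D) * f h l).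
    by rewrite fk fh -mulrDl -mulrDl divff ?mul1r.
  by rewrite /f /D; field.
Unshelve. all: by end_near. Qed.

(** Reduction to finitely many indices: far out both sequences lie below a lower bound of the
    minimax value, so these indices never matter. The value [m = 0] is allowed because the lemma is
    also applied to sequences in which one index has been erased, and these may vanish
    identically. *)
Lemma minimax a b : (forall k, 0 <= a k) -> (forall k, 0 <= b k) ->
  a @ \oo --> (0 : R) -> b @ \oo --> (0 : R) ->
  exists lam m : R, [/\ 0 <= lam <= 1, 0 <= m,
    forall k, lam * a k + (1 - lam) * b k <= m &
    0 < m -> exists (i j : nat) (p q : R), [/\ 0 <= p, 0 <= q, p + q = m^-1,
      1 <= p * a i + q * a j & 1 <= p * b i + q * b j]].
Proof.
move=> a0 b0 acv bcv.
have [az|/existsNP[i0 /eqP ai0]] := pselect (forall k, a k = 0).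
  exists 1, 0; split => //; rewrite ?ler01 ?lexx//.
    by move=> k; rewrite az; lra.
  by rewrite ltxx.
have [bz|/existsNP[j0 /eqP bj0]] := pselect (forall k, b k = 0).
  exists 0, 0; split => //; rewrite ?ler01 ?lexx//.
    by move=> k; rewrite bz; lra.
  by rewrite ltxx.
have {ai0} ai : 0 < a i0 by rewrite lt0r ai0 a0.
have {bj0} bj : 0 < b j0 by rewrite lt0r bj0 b0.
(* The minimum over [l] of [max (l a_i0, (1 - l) b_j0)], attained at [l = b_j0 / (a_i0 + b_j0)];
   hence a positive lower bound of [m] whatever the truncation. *)
pose eta := (a i0 * b j0) / (a i0 + b j0).
have eta0 : 0 < eta by rewrite divr_gt0 ?mulr_gt0// addr_gt0.
have : \forall k \near \oo, a k <= eta /\ b k <= eta.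
  by near=> k; split; near: k; [move/cvgr_le : acv|move/cvgr_le : bcv]; apply.
move=> [N0 _ HN].
pose N := maxn N0 (maxn i0.+1 j0.+1).
have iN : (i0 < N)%N by rewrite /N !leq_max ltnSn orbT.
have jN : (j0 < N)%N by rewrite /N !leq_max ltnSn !orbT.
have [l [m [l01 m0 Hm [i [j [p [q [p0 q0 pq H1 H2]]]]]]]] :=
  minimax_finite a0 b0 iN jN ai bj.
have [l0 l1] := andP l01.
have etam : eta <= m.
  have [la|la] := leP (eta) (l * a i0).
    apply: (le_trans la); apply: le_trans (Hm _ iN).
    by rewrite lerDl mulr_ge0// subr_ge0.
  apply: le_trans (Hm _ jN).
  apply: (@le_trans _ _ ((1 - l) * b j0)); last by rewrite lerDr mulr_ge0.
  have lb : l < b j0 / (a i0 + b j0).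
    by rewrite -(ltr_pM2r ai) (lt_le_trans la)// /eta mulrC mulrA mulrAC [b j0 * _]mulrC.
  have : a i0 / (a i0 + b j0) <= 1 - l.
    have : a i0 / (a i0 + b j0) + b j0 / (a i0 + b j0) = 1.
      by rewrite -mulrDl divff// gt_eqF// addr_gt0.
    lra.
  by move=> h; rewrite /eta mulrAC ler_wpM2r.
exists l, m; split => //; first exact: ltW.
  move=> k; have [kN|kN] := ltnP k N; first exact: Hm.
  have /= [ak bk] := HN k (leq_trans (leq_maxl _ _) kN).
  apply: le_trans etam.
  have h1 : l * a k <= l * eta by rewrite ler_wpM2l.
  have h2 : (1 - l) * b k <= (1 - l) * eta by rewrite ler_wpM2l// subr_ge0.
  lra.
move=> _; exists i, j, (p / m), (q / m); split.
- by apply: divr_ge0 => //; exact: ltW.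
- by apply: divr_ge0 => //; exact: ltW.
- by rewrite -mulrDl pq mul1r.
- by rewrite mulrAC [q / m * _]mulrAC -mulrDl ler_pdivlMr// mul1r.
- by rewrite mulrAC [q / m * _]mulrAC -mulrDl ler_pdivlMr// mul1r.
Unshelve. all: by end_near. Qed.

End LinearProgramDuality.

(** * Real powers and their integrals *)

Section RealPowers.
Context {R : realType}.
Implicit Types x y r s : R.

Lemma le_powR r x y : 0 <= r -> 0 <= x -> x <= y -> x `^ r <= y `^ r.
Proof.
move=> r0 x0 xy; apply: ge0_ler_powR => //; rewrite nnegrE//.
exact: le_trans xy.
Qed.

Lemma lt_powR r x y : 0 < r -> 0 <= x -> x < y -> x `^ r < y `^ r.
Proof.
move=> r0 x0 xy; apply: gt0_ltr_powR => //; rewrite nnegrE//.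
exact: le_trans (ltW xy).
Qed.

Lemma ge_powR_le0 r x y : r <= 0 -> 0 < x -> x <= y -> y `^ r <= x `^ r.
Proof.
move=> r0 x0 xy; rewrite -[r]opprK !(powRN _ (- r)).
rewrite lef_pV2 ?posrE ?powR_gt0//; last exact: lt_le_trans xy.
by apply: le_powR => //; [rewrite oppr_ge0|exact: ltW].
Qed.

Lemma powR_ge1 x r : 0 <= r -> 1 <= x -> 1 <= x `^ r.
Proof. by move=> r0 x1; rewrite -(powRr0 x); exact: ler_powR. Qed.

Lemma powR_le1 x r : 0 <= r -> 0 <= x <= 1 -> x `^ r <= 1.
Proof.
move=> r0 /andP[x0 x1]; have <- : 1 `^ r = 1 :> R by rewrite powR1.
exact: le_powR.
Qed.

Lemma powR_gt1 x r : 0 < r -> 1 < x -> 1 < x `^ r.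
Proof.
move=> r0 x1; have {1}<- : 1 `^ r = 1 :> R by rewrite powR1.
exact: lt_powR.
Qed.

(** The signs matter at [x = 0]: for [s = - r <> 0] the left side would be [0^0 = 1] and the right
    side 0. Factors that vanish are the reason why exponents are kept nonnegative throughout. *)
Lemma powRDge0 x r s : 0 <= r -> 0 <= s -> x `^ (r + s) = x `^ r * x `^ s.
Proof.
move=> r0 s0; have [->|x0] := eqVneq x 0; last by rewrite powRD// x0 implybT.
have [->|r0'] := eqVneq r 0; first by rewrite add0r powRr0 mul1r.
have rs : r + s != 0 by rewrite paddr_eq0// negb_and r0'.
by rewrite [LHS]powR0// [X in X * _]powR0// mul0r.
Qed.

Lemma powRDgt0 x r s : 0 < x -> x `^ (r + s) = x `^ r * x `^ s.
Proof. by move=> x0; rewrite powRD// (gt_eqF x0) implybT. Qed.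

Lemma powRV x r : 0 <= x -> (x^-1) `^ r = x `^ (- r).
Proof. by move=> x0; rewrite -powR_inv1// -powRrM mulN1r. Qed.

Lemma powRK x r : r != 0 -> 0 <= x -> (x `^ r) `^ r^-1 = x.
Proof. by move=> r0 x0; rewrite -powRrM divff// powRr1. Qed.

Lemma powRVK x r : r != 0 -> 0 <= x -> (x `^ r^-1) `^ r = x.
Proof. by move=> r0 x0; rewrite -powRrM mulVf// powRr1. Qed.

Lemma pow2_bracket x : 1 <= x -> exists k : nat, 2 ^+ k <= x < 2 ^+ k.+1.
Proof.
move=> x1.
have ex : exists k, x < 2 ^+ k.
  exists (Num.bound x); apply: (lt_le_trans (archi_boundP (le_trans ler01 x1))).
  by rewrite -natrX ler_nat ltnW// ltn_expl.
have [k xk kmin] := ex_minnP ex.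
case: k xk kmin => [|k] xk kmin; first by rewrite expr0 ltNge x1 in xk.
exists k; rewrite xk andbT leNgt; apply/negP => /kmin.
by rewrite ltnn.
Qed.

Lemma cvg_powR_at r x : 0 < x -> y `^ r @[y --> x] --> x `^ r.
Proof.
move=> x0.
have /derivable1_diffP/differentiable_continuous : derivable (fun y : R => y `^ r) x 1.
  by apply: derivable_powR; rewrite in_itv /= x0.
exact.
Qed.

(** Differentiability gives continuity only at [x > 0]; infinite products can have limit 0, so the
    one-sided statement at 0 is needed too. *)
Lemma continuous_powR r x : 0 <= r -> 0 <= x ->
  forall u : nat -> R, (forall n, 0 <= u n) -> u n @[n --> \oo] --> x ->
  u n `^ r @[n --> \oo] --> x `^ r.
Proof.
rewrite le_eqVlt => /predU1P[<-|r0] x0 u u0 ux.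
  by under eq_cvg do rewrite powRr0; rewrite powRr0; exact: cvg_cst.
move: x0; rewrite le_eqVlt => /predU1P[x0|x0]; last first.
  by apply: (cvg_comp u (fun y => y `^ r) ux); exact: cvg_powR_at.
rewrite -x0 powR0 ?gt_eqF//; apply/cvgr0Pnorm_le => /= e e0.
have e1 : 0 < e `^ r^-1 by rewrite powR_gt0.
move: ux; rewrite -x0 => /cvgr0Pnorm_le /(_ _ e1); apply: filterS => n.
rewrite !ger0_norm ?powR_ge0// => h.
rewrite -(@powRVK e r) ?gt_eqF//; last exact: ltW.
by apply: le_powR => //; exact: ltW.
Qed.

Lemma cvg_powR_pinfty r : 0 < r -> x `^ r @[x --> +oo] --> +oo.
Proof.
move=> r0; apply/cvgryPge => A; near=> x.
have A0 : 0 <= Num.max A 0 by rewrite le_max lexx orbT.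
apply: (@le_trans _ _ (Num.max A 0)); first by rewrite le_max lexx.
rewrite -[leLHS](@powRVK _ r) ?gt_eqF//.
apply: le_powR; [exact: ltW|exact: powR_ge0|].
by near: x; apply: nbhs_pinfty_ge; rewrite num_real.
Unshelve. all: by end_near. Qed.

Lemma cvg_powRN_pinfty r : 0 < r -> x `^ (- r) @[x --> +oo] --> 0.
Proof.
move=> r0; under eq_cvg do rewrite powRN.
by apply/gtr0_cvgV0; [near=> x; rewrite powR_gt0//; near: x; exact: nbhs_pinfty_gt|exact: cvg_powR_pinfty].
Unshelve. all: by end_near. Qed.

End RealPowers.

Section PowerIntegrals.
Context {R : realType}.
Local Notation mu := (@lebesgue_measure R).

Lemma is_derive_powR (r x : R) : 0 < x ->
  is_derive x 1 (fun y => y `^ r) (r * x `^ (r - 1)).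
Proof.
move=> x0; have xin : x \in `]0, +oo[ by rewrite in_itv /= x0.
split; first exact: derivable_powR.
by rewrite -derive1E powR_derive1.
Qed.

Lemma integral_powR_pinfty (c r : R) : 0 < c -> 1 < r ->
  (\int[mu]_(x in `[c, +oo[) (x `^ (- r))%:E = (c `^ (1 - r) / (r - 1))%:E)%E.
Proof.
move=> c0 r1.
pose F (x : R) := - (r - 1)^-1 * x `^ (1 - r).
have Fd (x : R) : 0 < x -> is_derive x 1 F (x `^ (- r)).
  move=> x0; have := is_derive_powR (1 - r) x0 => dF.
  rewrite /F; apply: is_derive_eq.
  rewrite /GRing.scale /= -[1 - r - 1]/(1 - r - 1) addrAC subrr add0r mulrA.
  rewrite -[X in X * _](_ : 1 = _) ?mul1r//.
  by field; rewrite gt_eqF// subr_gt0.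
rewrite (@ge0_continuous_FTC2y _ _ F c 0).
- by rewrite /F -EFinB sub0r mulNr opprK mulrC.
- by move=> x _; exact: powR_ge0.
- apply: continuous_in_subspaceT => x; rewrite inE /= in_itv /= andbT => cx.
  by apply: cvg_powR_at; exact: lt_le_trans cx.
- rewrite /F -[X in _ --> X](mulr0 (- (r - 1)^-1)); apply: cvgMr.
  by rewrite -opprB; apply: cvg_powRN_pinfty; rewrite subr_gt0.
- by move=> x cx; have := Fd x (lt_trans c0 cx); case.
- apply: cvg_at_right_filter; apply: cvgMr; exact: cvg_powR_at.
- move=> x; rewrite in_itv /= andbT => cx.
  by rewrite derive1E; have := Fd x (lt_trans c0 cx); case.
Qed.

(** The integrand may blow up at 0: the fundamental theorem is applied on compact intervals away
    from 0, which then increase to []0, c]]. *)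
Lemma integral_powR_0 (c r : R) : 0 < c -> 0 <= r < 1 ->
  (\int[mu]_(x in `]0%R, c]) (x `^ (- r))%:E = (c `^ (1 - r) / (1 - r))%:E)%E.
Proof.
move=> c0 /andP[r0 r1].
have r10 : 0 < 1 - r by rewrite subr_gt0.
pose F (x : R) := (1 - r)^-1 * x `^ (1 - r).
have Fd (x : R) : 0 < x -> is_derive x 1 F (x `^ (- r)).
  move=> x0; have := is_derive_powR (1 - r) x0 => dF.
  rewrite /F; apply: is_derive_eq.
  rewrite /GRing.scale /= addrAC subrr add0r mulrA mulVf ?mul1r// gt_eqF//.
(* With [n.+2] the left end is strictly below [c] already for [n = 0]. *)
pose S n : set R := `[c / n.+2%:R, c]%classic.
have SU : `]0, c]%classic = \bigcup_n S n.
  apply/seteqP; split => x /=.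
    rewrite in_itv /= => /andP[x0 xc].
    have [n hn] : exists n : nat, c / x < n%:R.
      exists (Num.bound (c / x)).
      by apply: archi_boundP; rewrite divr_ge0// ltW.
    exists n => //=; rewrite /S /= in_itv /= xc andbT ler_pdivrMr// mulrC.
    rewrite -ler_pdivrMr//; apply: (le_trans (ltW hn)).
    by rewrite ler_nat -addn2 leq_addr.
  move=> [n _]; rewrite /S /= !in_itv /= => /andP[h ->]; rewrite andbT.
  by apply: lt_le_trans h; rewrite divr_gt0.
have mS n : measurable (S n) by exact: measurable_itv.
have fcont (n : nat) : {within S n, continuous (fun x : R => x `^ (- r))}.
  apply: continuous_in_subspaceT => x; rewrite inE /S /= in_itv /= => /andP[cx _].
  by apply: cvg_powR_at; apply: lt_le_trans cx; rewrite divr_gt0.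
have IS n : (\int[mu]_(x in S n) (x `^ (- r))%:E = (F c)%:E - (F (c / n.+2%:R))%:E)%E.
  have cn : c / n.+2%:R < c by rewrite ltr_pdivrMr// ltr_pMr// ltr1n.
  have cn0 : 0 < c / n.+2%:R by rewrite divr_gt0.
  rewrite /S (@continuous_FTC2 _ _ F _ _ cn)//.
  - exact: fcont.
  - split => /=.
    + move=> x; rewrite in_itv /= => /andP[cx _].
      by have := Fd x (lt_trans cn0 cx); case.
    + by apply: cvg_at_right_filter; apply: cvgMr; exact: cvg_powR_at.
    + by apply: cvg_at_left_filter; apply: cvgMr; exact: cvg_powR_at.
  - move=> x; rewrite in_itv /= => /andP[cx _].
    by rewrite derive1E; have := Fd x (lt_trans cn0 cx); case.
have lim1 : (\int[mu]_(x in S n) (x `^ (- r))%:E @[n --> \oo] -->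
    \int[mu]_(x in \bigcup_n S n) (x `^ (- r))%:E)%E.
  apply: ge0_nondecreasing_set_cvg_integral => //.
  - move=> m n mn; apply/subsetPset => x; rewrite /S /= !in_itv /= => /andP[h ->].
    rewrite andbT; apply: le_trans h.
    by rewrite ler_pM2l// lef_pV2 ?posrE// ler_nat ltnS ltnS.
  - by move=> n; apply/measurable_EFinP; apply: subspace_continuous_measurable_fun => //.
  - by move=> n x _; rewrite lee_fin powR_ge0.
have lim2 : ((F c)%:E - (F (c / n.+2%:R))%:E @[n --> \oo] --> (F c)%:E)%E.
  rewrite -[X in _ --> X]sube0; apply: cvgeB => //; first exact: cvg_cst.
  apply: cvg_EFin; first exact: nearW.
  rewrite /comp /F -[X in _ --> X](mulr0 (1 - r)^-1); apply: cvgMr.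
  rewrite -(@powR0 _ (1 - r)) ?gt_eqF//.
  apply: continuous_powR => //; first exact: ltW.
    by move=> n; rewrite divr_ge0 // ltW.
  rewrite -[X in _ --> X](mulr0 c); apply: cvgMr.
  apply/gtr0_cvgV0; first exact: nearW.
  apply/cvgryPge => A; near=> n; apply: (@le_trans _ _ n%:R).
    by near: n; exact: nbhs_infty_ger.
  by rewrite ler_nat -addn2 leq_addr.
rewrite SU; transitivity (F c)%:E; last by rewrite /F mulrC.
rewrite -(cvg_lim _ lim1)//.
have -> : (fun n => \int[mu]_(x in S n) (x `^ (- r))%:E)%E =
    (fun n => (F c)%:E - (F (c / n.+2%:R))%:E)%E by apply/funext => n; exact: IS.
exact: (cvg_lim _ lim2).
Unshelve. all: by end_near. Qed.

End PowerIntegrals.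

(** * Regularly varying tails *)

Section RegularlyVaryingTail.
Context {R : realType}.
Variable F : R -> R.
Hypothesis F_gt0 : forall x, 0 < F x.
Hypothesis F_le1 : forall x, F x <= 1.
Hypothesis F_ni : forall x y, x <= y -> F y <= F x.
Hypothesis F_rv : forall s, 0 < s -> F (s * x) / F x @[x --> +oo] --> s^-1.

(** The ratio [F (2 y) / F y] tends to 1/2, strictly between [2^(-1-d)] and [2^(-1+d)]; beyond some
    [y0] it stays there, and the bounds are iterated along [y, 2 y, 4 y, ...]. *)
Lemma tail_doubling (d : R) : 0 < d < 1 -> exists y0 : R, 0 < y0 /\
  forall (k : nat) y, y0 <= y ->
  (2 ^+ k) `^ (- 1 - d) * F y <= F (2 ^+ k * y) <= (2 ^+ k) `^ (- 1 + d) * F y.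
Proof.
move=> /andP[d0 d1].
have p2 : (2 : R) `^ (- 1) = 2^-1 by rewrite powR_inv1.
have h1 : (2 : R) `^ (- 1 - d) < 2^-1.
  by rewrite -p2 /powR gt_eqF//= ltr_expR ltr_pM2r ?ln_gt0 ?ltr1n//; lra.
have h2 : (2 : R)^-1 < 2 `^ (- 1 + d).
  by rewrite -p2 /powR gt_eqF//= ltr_expR ltr_pM2r ?ln_gt0 ?ltr1n//; lra.
have F2 := F_rv (ltr0n _ 2).
have : \forall y \near +oo, (2 `^ (- 1 - d) * F y <= F (2 * y) <= 2 `^ (- 1 + d) * F y).
  have A1 := cvgr_ge _ F2 _ h1.
  have A2 := cvgr_le _ F2 _ h2.
  near=> y; apply/andP; split.
    by rewrite -ler_pdivlMr//; near: y; exact: A1.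
  by rewrite -ler_pdivrMr//; near: y; exact: A2.
move=> [M [_ HM]].
exists (Num.max M 0 + 1); split.
  by rewrite ltr_wpDl// le_max lexx orbT.
have {}HM y : Num.max M 0 + 1 <= y ->
    2 `^ (- 1 - d) * F y <= F (2 * y) <= 2 `^ (- 1 + d) * F y.
  move=> hy; apply: HM; apply: lt_le_trans hy.
  by rewrite ltr_pwDr// le_max lexx.
elim => [|k IH] y hy.
  by rewrite !expr0 !mul1r powR1 !mul1r !lexx.
have hy0 : 0 <= y by apply: le_trans hy; rewrite addr_ge0// le_max lexx orbT.
have /andP[IH1 IH2] := IH y hy.
have /andP[G1 G2] : 2 `^ (- 1 - d) * F (2 ^+ k * y) <= F (2 * (2 ^+ k * y)) <= 2 `^ (- 1 + d) * F (2 ^+ k * y).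
  by apply: HM; apply: (le_trans hy); rewrite ler_peMl// exprn_ege1// ler1n.
rewrite exprS -mulrA !powRM// ?exprn_ge0// -!mulrA; apply/andP; split.
  by apply: le_trans G1; rewrite ler_pM2l// powR_gt0.
by apply: (le_trans G2); rewrite ler_pM2l// powR_gt0.
Unshelve. all: by end_near. Qed.

(** Potter's bounds, by monotone interpolation between powers of 2. The 4 in the constant absorbs
    the loss of one doubling, [2^(1-d)] or [2^(1+d)]. The factor [1 / F y0] serves for [y * a < y0],
    where the only bound at hand is [F <= 1]; this makes the last estimate valid for all
    [0 < a <= 1]. *)
Lemma potter (d : R) : 0 < d < 1 -> exists C y0 : R, [/\ 1 <= C, 0 < y0,
  forall y a, y0 <= y -> 1 <= a -> F (y * a) <= C * a `^ (- 1 + d) * F y &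
  forall y a, y0 <= y -> 0 < a <= 1 -> F (y * a) <= C * a `^ (- 1 - d) * F y].
Proof.
move=> d01; have /andP[d0 d1] := d01.
have [y0 [y00 H]] := tail_doubling d01.
have C4 : 4 <= 4 / F y0.
  by rewrite ler_pdivlMr// ler_piMr.
have step y a : 0 < a <= 1 -> y0 <= y * a -> F (y * a) <= 4 * a `^ (- 1 - d) * F y.
  move=> /andP[a0 a1] hy.
  have b1 : 1 <= a^-1 by rewrite invf_ge1.
  have [k /andP[k1 k2]] := pow2_bracket b1.
  have /andP[G _] := H k.+1 _ hy.
  have p0 : 0 < (2 ^+ k.+1 : R) by rewrite exprn_gt0.
  have yle : y <= 2 ^+ k.+1 * (y * a).
    rewrite [leLHS](_ : y = a^-1 * (y * a)); last first.
      by rewrite mulrCA mulVf ?mulr1// gt_eqF.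
    by apply: ler_wpM2r; [apply: le_trans hy; exact: ltW|exact: ltW].
  have {G} G := le_trans G (F_ni yle).
  apply: (@le_trans _ _ ((2 ^+ k.+1) `^ (1 + d) * F y)).
    by rewrite -ler_pdivrMl ?powR_gt0// -powRN opprD.
  rewrite ler_pM2r//.
  apply: (@le_trans _ _ ((2 * a^-1) `^ (1 + d))).
    apply: le_powR; [by lra|exact: ltW|].
    by rewrite exprS ler_pM2l.
  have a0' := ltW a0.
  rewrite powRM ?invr_ge0// powRV// opprD ler_pM2r ?powR_gt0//.
  have -> : (4 : R) = 2 `^ 2%:R by rewrite powR_mulrn// -natrX.
  by apply: ler_powR; [rewrite ler1n|lra].
exists (4 / F y0), y0; split => //.
- by apply: le_trans C4; rewrite ler1n.
- move=> y a hy a1.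
  have [k /andP[k1 k2]] := pow2_bracket a1.
  have /andP[_ G] := H k _ hy.
  have y_gt0 : 0 < y by exact: lt_le_trans hy.
  apply: (@le_trans _ _ (F (2 ^+ k * y))); first by apply: F_ni; rewrite mulrC ler_pM2l.
  apply: (le_trans G); rewrite ler_pM2r//.
  apply: (@le_trans _ _ (4 * a `^ (- 1 + d))); last by rewrite ler_pM2r// powR_gt0// (lt_le_trans ltr01).
  have a0 : 0 < a by exact: lt_le_trans ltr01 a1.
  have -> : (2 ^+ k : R) = 2^-1 * 2 ^+ k.+1 by rewrite exprS mulrA mulVf ?mul1r.
  rewrite powRM ?invr_ge0 ?exprn_ge0//; apply: ler_pM; rewrite ?powR_ge0//.
    rewrite powRV// opprD opprK.
    have -> : (4 : R) = 2 `^ 2%:R by rewrite powR_mulrn// -natrX.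
    by apply: ler_powR; [rewrite ler1n|lra].
  by apply: ge_powR_le0 => //; [lra|exact: ltW].
- move=> y a hy a01; have /andP[a0 a1] := a01.
  have y_gt0 : 0 < y by exact: lt_le_trans hy.
  have [ya|ya] := leP y0 (y * a).
    apply: (le_trans (step _ _ a01 ya)).
    by rewrite ler_pM2r// ler_pM2r// powR_gt0.
  (* Here [a < y0 / y]: the estimate at [y0 / y], whose argument is exactly [y0], bounds [F y0] from
     above, and [a^(-1-d)] is only larger. *)
  have c01 : 0 < y0 / y <= 1 by rewrite divr_gt0//= ler_pdivrMr// mul1r.
  have /andP[c0 _] := c01.
  have yc : y * (y0 / y) = y0 by rewrite mulrCA divff ?mulr1// gt_eqF.
  have := step y _ c01; rewrite yc => /(_ (lexx _)) G.
  apply: (le_trans (F_le1 _)).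
  rewrite -(ler_pM2r (F_gt0 y0)) mul1r; apply: (le_trans G).
  have -> : 4 / F y0 * a `^ (-1 - d) * F y * F y0 = 4 * a `^ (-1 - d) * F y.
    by field; rewrite gt_eqF.
  rewrite ler_pM2r// ler_pM2l//.
  apply: ge_powR_le0 => //; first lra.
  by rewrite ler_pdivlMr// mulrC ltW.
Qed.

Lemma tail_cvg0 : F x @[x --> +oo] --> 0.
Proof.
have d12 : 0 < (2^-1 : R) < 1 by rewrite invr_gt0 ltr0n invf_lt1 ?ltr1n.
have [C [y0 [C1 y00 H _]]] := potter d12.
have H0 : C * (x / y0) `^ (- (2^-1)) * F y0 @[x --> +oo] --> 0.
  rewrite -[X in _ --> X](mul0r (F y0)); apply: cvgMl.
  rewrite -[X in _ --> X](mulr0 C); apply: cvgMr.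
  rewrite -[X in _ --> X](mul0r (y0^-1 `^ (- 2^-1))).
  have : x `^ (- 2^-1) * y0^-1 `^ (- 2^-1) @[x --> +oo] --> 0 * y0^-1 `^ (- 2^-1).
    by apply: cvgMl; apply: cvg_powRN_pinfty; rewrite invr_gt0.
  apply: cvg_trans; apply: near_eq_cvg; near=> x.
  by rewrite powRM// invr_ge0 ltW.
have le0 : \forall x \near +oo, 0 <= F x <= C * (x / y0) `^ (- (2^-1)) * F y0.
  near=> x; rewrite ltW//=.
  have xy0 : 1 <= x / y0 by rewrite ler_pdivlMr// mul1r; near: x; exact: nbhs_pinfty_ge.
  have := H y0 _ (lexx _) xy0; rewrite mulrC divfK ?gt_eqF//.
  by rewrite (_ : - 1 + 2^-1 = - 2^-1) //; field.
exact: (squeeze_cvgr le0 (cvg_cst _) H0).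
Unshelve. all: by end_near. Qed.

(* [F] decreases no faster than [y^(-1-d)]; by Potter with [a = y0 / y]. *)
Lemma tail_lower (d : R) : 0 < d < 1 -> exists c y0 : R, [/\ 0 < c, 0 < y0 &
  forall y, y0 <= y -> c * y `^ (- 1 - d) <= F y].
Proof.
move=> d01; have /andP[d0 d1] := d01.
have [C [y0 [C1 y00 _ H]]] := potter d01.
have C0 : 0 < C by exact: lt_le_trans C1.
have D0 : 0 < C * y0 `^ (- 1 - d) by rewrite mulr_gt0// powR_gt0.
exists (F y0 / (C * y0 `^ (- 1 - d))), y0; split => //; first by rewrite divr_gt0.
move=> y hy; have y_gt0 : 0 < y by exact: lt_le_trans hy.
have c01 : 0 < y0 / y <= 1 by rewrite divr_gt0//= ler_pdivrMr// mul1r.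
have := H y _ hy c01; rewrite mulrCA divff ?mulr1 ?gt_eqF// => G.
rewrite mulrAC ler_pdivrMr// mulrC -ler_pdivlMl ?powR_gt0//.
apply: (le_trans G); have y0' := ltW y_gt0; have y00' := ltW y00.
rewrite powRM ?invr_ge0// powRV// -powRN.
by rewrite le_eqVlt; apply/orP; left; apply/eqP; ring.
Qed.

End RegularlyVaryingTail.

(** * Infinite products and independence *)

Section MeasurableLimits.
Context {R : realType} d (T : measurableType d).

Lemma cvgn_limn_einf_esup (u : (\bar R)^nat) :
  limn_einf u = limn_esup u -> u n @[n --> \oo] --> limn_esup u.
Proof.
move=> e; apply: (@squeeze_cvge _ _ _ _ (einfs u) _ (esups u)).
- apply: nearW => n; apply/andP; split.
    by apply: ereal_inf_lbound; exists n => /=.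
  by apply: ereal_sup_ubound; exists n => /=.
- by rewrite -e limn_einf_lim; exact: is_cvg_einfs.
- by rewrite limn_esup_lim; exact: is_cvg_esups.
Qed.

(** Products converge only almost surely, so measurability must not presuppose convergence. The
    limit exists exactly where upper and lower limits agree and are finite, a measurable set, and
    off it [limn] is the constant [point]. *)
Lemma measurable_limn (h : (T -> R)^nat) :
  (forall n, measurable_fun setT (h n)) ->
  measurable_fun setT (fun t => limn (h ^~ t)).
Proof.
move=> mh; pose u n t := (h n t)%:E.
have mu n : measurable_fun setT (u n) by exact/measurable_EFinP.
pose S t := limn_esup (u ^~ t); pose I t := limn_einf (u ^~ t).
have mS : measurable_fun setT S by exact: measurable_fun_limn_esup.
have mI : measurable_fun setT I.
  rewrite /I /limn_einf; apply: measurableT_comp => //.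
  apply: measurable_fun_limn_esup => n; exact: measurableT_comp.
pose C := [set t | I t = S t] `&` S @^-1` [set x | x \is a fin_num].
have mC : measurable C.
  apply: measurableI.
    by have := measurable_eqe measurableT mI mS; rewrite setTI.
  by have := emeasurable_fin_num measurableT mS; rewrite setTI.
have CE t : C t -> limn (h ^~ t) = fine (S t).
  move=> [/= IS fS]; apply/cvg_lim => //.
  have := cvgn_limn_einf_esup IS.
  rewrite (_ : limn_esup _ = (fine (S t))%:E); last by rewrite fineK.
  by move=> /fine_cvgP[_].
have CE' t : ~ C t -> limn (h ^~ t) = point.
  move=> nC; apply: dvgP => /cvg_ex[l hl]; apply: nC.
  have ul : u n t @[n --> \oo] --> l%:E by apply: cvg_EFin => //; exact: nearW.
  have [e1 e2] := cvg_limn_einf_sup ul.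
  by rewrite /C /= /I /S e1 e2.
rewrite (_ : (fun t => _) = fun t => if t \in C then fine (S t) else point).
  apply: measurable_fun_ifT => //.
  - apply: (measurable_fun_bool true) => //.
    rewrite setTI (_ : _ @^-1` _ = C)//.
    by apply/seteqP; split => t /= => [/set_mem|/mem_set].
  - exact: measurableT_comp.
apply/funext => t; case: ifPn => [/set_mem|/negP tC]; first exact: CE.
by apply: CE' => Ct; apply: tC; exact: mem_set.
Qed.

Lemma measurable_infprod (A : pred nat) (f : nat -> T -> R) :
  (forall m, A m -> measurable_fun setT (f m)) ->
  measurable_fun setT (infprod A f).
Proof.
move=> mf; apply: measurable_limn => n.
rewrite (_ : (fun t => _) = fun t => \prod_(0 <= m < n) (if A m then f m t else 1)).
  apply: measurable_prod => m _; have [Am|/negbTE Am] := boolP (A m).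
    exact: mf.
  exact: measurable_cst.
by apply/funext => t; rewrite big_mkcond.
Qed.

End MeasurableLimits.

Section IndependentIntegral.
Context {R : realType} d (T : measurableType d) (P : probability T R).
Context d1 d2 (T1 : measurableType d1) (T2 : measurableType d2).

(** Independence says that the joint law agrees with the product of the laws on rectangles, hence
    everywhere; the rest is Tonelli's theorem. *)
Lemma indep_integral (Y : T -> T1) (W : T -> T2) (f : T1 * T2 -> \bar R) :
  measurable_fun setT Y -> measurable_fun setT W ->
  (forall A B, measurable A -> measurable B ->
    P (Y @^-1` A `&` W @^-1` B) = (P (Y @^-1` A) * P (W @^-1` B))%E) ->
  measurable_fun setT f -> (forall z, 0 <= f z)%E ->
  (\int[P]_t f (Y t, W t) = \int[P]_t \int[P]_s f (Y s, W t))%E.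
Proof.
move=> mY mW ind mf f0.
pose Y' : {mfun T >-> T1} := HB.pack Y (isMeasurableFun.Build _ _ _ _ Y mY).
pose W' : {mfun T >-> T2} := HB.pack W (isMeasurableFun.Build _ _ _ _ W mW).
pose YW t := (Y t, W t).
have mYW : measurable_fun setT YW by exact: measurable_fun_pair.
pose YW' : {mfun T >-> (T1 * T2)%type} :=
  HB.pack YW (isMeasurableFun.Build _ _ _ _ YW mYW).
transitivity (\int[distribution P YW']_z f z)%E.
  by rewrite ge0_integral_distribution.
transitivity (\int[distribution P Y' \x distribution P W']_z f z)%E.
  apply: eq_measure_integral => A mA _.
  symmetry; exact: product_measure_unique.
rewrite fubini_tonelli2//.
rewrite ge0_integral_distribution//; last 2 first.
- exact: measurable_fun_fubini_tonelli_G.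
- by move=> y; exact: integral_ge0.
apply: eq_integral => t _ /=; rewrite /fubini_G ge0_integral_distribution//.
by apply: measurableT_comp => //; exact: measurable_fun_pair.
Qed.

End IndependentIntegral.

Section Independence.
Context {R : realType} {d : measure_display} {T : measurableType d}.
Variables (P : probability T R) (X : nat -> {RV P >-> R}).
Hypothesis X_indep : mutually_independent X.

(* [off i] is [T] with the sigma-algebra generated by the [X m], [m != i]. *)
Definition cylinders_off (i : nat) : set (set T) := [set A |
  exists (J : {fset nat}) (B : nat -> set R),
    [/\ forall k, k \in J -> measurable (B k), i \notin J &
        A = \bigcap_(k in [set` J]) (X k @^-1` B k)]].

Definition off (i : nat) := g_sigma_algebraType (cylinders_off i).

Lemma cylinders_off_measurable i : cylinders_off i `<=` measurable.
Proof.
move=> _ [J [B [mB _ ->]]]; apply: fin_bigcap_measurable => // k kJ.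
by rewrite -[X in measurable X]setTI; apply: measurable_funP => //; exact: mB.
Qed.

Lemma cylinders_offI i : setI_closed (cylinders_off i).
Proof.
move=> _ _ [J [B [mB iJ ->]]] [J' [B' [mB' iJ' ->]]].
pose ext (K : {fset nat}) (C : nat -> set R) k := if k \in K then C k else setT.
exists (J `|` J')%fset, (fun k => ext J B k `&` ext J' B' k); split.
- by move=> k _; apply: measurableI; rewrite /ext; case: ifPn => // kJ; [exact: mB|exact: mB'].
- by rewrite in_fsetU negb_or iJ.
apply/seteqP; split=> [t [h h'] k /=|t h].
  rewrite in_fsetU => _; split; rewrite /ext; case: ifPn => // kJ.
    exact: h.
  exact: h'.
split=> k /= kJ; have /(_ _)[] := h k; rewrite /= ?in_fsetU ?kJ ?orbT//.
  by rewrite /ext kJ.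
by move=> _; rewrite /ext kJ.
Qed.

Lemma off_measurable i : <<s cylinders_off i >> `<=` measurable.
Proof. by apply: smallest_sub; [exact: sigma_algebra_measurable|exact: cylinders_off_measurable]. Qed.

(** As functions of [G], both sides are finite measures that agree on the cylinders, which are
    closed under intersection; so they agree on the generated sigma-algebra. *)
Lemma indep_off i A G : measurable A -> <<s cylinders_off i >> G ->
  P (X i @^-1` A `&` G) = (P (X i @^-1` A) * P G)%E.
Proof.
move=> mA sG.
have mXA : measurable (X i @^-1` A).
  by rewrite -[X in measurable X]setTI; exact: measurable_funP.
have p0 : 0 <= fine (P (X i @^-1` A)) by rewrite fine_ge0.
have cT : cylinders_off i setT.
  exists fset0, (fun=> setT); split => //.
  by apply/seteqP; split.
suff : mrestr P mXA G = mscale (NngNum p0) P G.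
  by rewrite /mrestr /mscale /= fineK ?fin_num_measure// setIC.
apply: (@g_sigma_algebra_measure_unique _ _ _ (cylinders_off i)
  (@cylinders_off_measurable i) (fun=> setT) (fun=> cT) _
  (mrestr P mXA) (mscale (NngNum p0) P) (@cylinders_offI i) _ _ G sG).
- by apply/seteqP; split => // t _; exists 0%N.
- move=> _ [J [B [mB iJ ->]]].
  pose B' k := if k == i then A else B k.
  have mB' k : k \in (i |` J)%fset -> measurable (B' k).
    by rewrite in_fset1U /B' => /orP[/eqP->|kJ]; [rewrite eqxx|case: ifP => // _; exact: mB].
  have := X_indep mB'; rewrite big_fsetU1//= /B' eqxx => E.
  have E1 : \bigcap_(k in [set` J]) (X k @^-1` B k) `&` X i @^-1` A =
      \bigcap_(k in [set` (i |` J)%fset]) (X k @^-1` B' k).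
    apply/seteqP; split => [t [h h'] k /=|t h].
      rewrite in_fset1U /B' => /orP[/eqP->|kJ]; first by rewrite eqxx.
      by case: eqP => [->//|_]; exact: h.
    split => [k /= kJ|].
      have := h k; rewrite /= in_fset1U kJ orbT => /(_ isT).
      by rewrite /B'; case: eqP => // ki; move: iJ; rewrite -ki kJ.
    by have := h i; rewrite /= in_fset1U eqxx => /(_ isT); rewrite /B' eqxx.
  rewrite /mrestr /mscale /= fineK ?fin_num_measure// E1 E; congr (_ * _)%E; rewrite (X_indep mB).
  apply: eq_big_seq => k kJ; case: eqP => // ki; move: iJ; rewrite -ki.
  by rewrite kJ.
- move=> _; apply: (le_lt_trans (probability_le1 P _)); last exact: ltry.
  exact: measurableI.
Qed.

Lemma measurable_off i m : m != i -> measurable_fun [set: off i] (X m : off i -> R).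
Proof.
move=> mi _ A mA; apply: sub_sigma_algebra.
exists [fset m]%fset, (fun=> A); split => //.
  by rewrite in_fset1 eq_sym.
rewrite setTI; apply/seteqP; split => t /=.
  by move=> h k /=; rewrite in_fset1 => /eqP->.
by move=> h; apply: (h m); rewrite /= in_fset1.
Qed.

Lemma off_measurable_fun i d' (T' : measurableType d') (W : T -> T') :
  measurable_fun [set: off i] (W : off i -> T') -> measurable_fun [set: T] W.
Proof.
by move=> mW _ A mA; apply: (@off_measurable i); exact: mW.
Qed.

Lemma integral_off i d' (T' : measurableType d') (W : T -> T') (f : R * T' -> \bar R) :
  measurable_fun [set: off i] (W : off i -> T') ->
  measurable_fun setT f -> (forall z, 0 <= f z)%E ->
  (\int[P]_t f (X i t, W t) = \int[P]_t \int[P]_s f (X i s, W t))%E.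
Proof.
move=> mW mf f0; apply: indep_integral => //.
- exact: off_measurable_fun mW.
- move=> A B mA mB; apply: indep_off => //.
  by have := mW measurableT B mB; rewrite setTI.
Qed.

Lemma expectation_prod (f : nat -> R -> R) (n : nat) :
  (forall m, measurable_fun setT (f m)) -> (forall m x, 0 <= f m x) ->
  (\int[P]_t (\prod_(0 <= m < n) f m (X m t))%:E =
   \prod_(0 <= m < n) \int[P]_t (f m (X m t))%:E)%E.
Proof.
move=> mf f0; elim: n => [|n IH].
  under eq_integral do rewrite big_geq//.
  by rewrite integral_cst//= probability_setT mule1 big_geq.
under eq_integral do rewrite big_nat_recr//=.
rewrite big_nat_recr//= -IH.
pose W t := \prod_(0 <= m < n) f m (X m t).
have W0 t : 0 <= W t by apply: prodr_ge0.
have mW i : (n <= i)%N -> measurable_fun [set: off i] (W : off i -> R).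
  move=> ni; have -> : W = (fun t => \prod_(m <- iota 0 n) (if (m < n)%N then f m (X m t) else 1)).
    apply/funext => t; rewrite /W /index_iota subn0; apply: eq_big_seq => m.
    by rewrite mem_iota add0n /= => ->.
  apply: measurable_prod => m _; have [mn|mn] := ltnP m n; last exact: measurable_cst.
  apply: measurableT_comp => //; apply: measurable_off.
  by rewrite neq_ltn (leq_trans mn).
pose F (z : R * R) := (f n z.1 * z.2)%:E.
(* [integral_off] asks for a function that is nonnegative on the whole plane, while [F] is not where
   [z.2 < 0]; the values [W t] do not reach that region. *)
pose F' (z : R * R) := `|F z|%E.
transitivity (\int[P]_t F' (X n t, W t))%E.
  by apply: eq_integral => t _; rewrite /F' /F /= ger0_norm ?mulr_ge0// mulrC.
rewrite integral_off//; last 2 first.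
- apply: measurableT_comp => //; apply/measurable_EFinP; apply: measurable_funM => //.
  exact: measurableT_comp.
- by move=> z; exact: abse_ge0.
transitivity (\int[P]_t ((W t)%:E * \int[P]_s (f n (X n s))%:E))%E.
  apply: eq_integral => t _.
  rewrite -ge0_integralZl//; first last.
  - by rewrite lee_fin.
  - by move=> s _; rewrite lee_fin.
  - by apply/measurable_EFinP; apply: measurableT_comp.
  by apply: eq_integral => s _; rewrite /F' /F /= ger0_norm ?mulr_ge0// mulrC EFinM.
rewrite ge0_integralZr//.
- by apply/measurable_EFinP; apply: (off_measurable_fun (mW n (leqnn n))).
- by move=> t _; rewrite lee_fin.
- by apply: integral_ge0 => s _; rewrite lee_fin.
exact: mW.
Qed.

End Independence.

(** * Deterministic power products *)

Section PowerProducts.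
Context {R : realType}.
Implicit Types (x a b : nat -> R) (A : pred nat).

Definition pprod A a x (n : nat) : R := \prod_(0 <= m < n | A m) x m `^ a m.
(* [upprod] and [dnprod] bound the partial products above and below by monotone sequences. *)
Definition upprod a x (n : nat) : R := \prod_(0 <= m < n) Num.max (x m) 1 `^ a m.
(** The interface between probability and analysis: this holds almost surely for the paths of [X]
    ([ae_upbounded]), and convergence of the products along a path is then a deterministic
    matter. *)
Definition upbounded a x := exists M, forall n, upprod a x n <= M.
Definition pprodoo A a x : R := limn (pprod A a x).

Lemma powR_max_ge1 (y r : R) : 0 <= r -> 1 <= Num.max y 1 `^ r.
Proof.
by move=> r0; rewrite -[leLHS](powRr0 (Num.max y 1)) ler_powR// le_max lexx orbT.
Qed.

Lemma powR_max_min (y r : R) : Num.max y 1 `^ r * Num.min y 1 `^ r = y `^ r.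
Proof. by case: (leP y 1) => _; rewrite powR1 ?mul1r ?mulr1. Qed.

Lemma powR_min_le1 (y r : R) : 0 <= y -> 0 <= r -> Num.min y 1 `^ r <= 1.
Proof.
move=> y0 r0; apply: (@le_trans _ _ (1 `^ r)); last by rewrite powR1.
by apply: le_powR => //; [rewrite le_min y0 ler01|rewrite ge_min lexx orbT].
Qed.

Lemma powR_combM (p q y r s c1 c2 : R) : 0 <= p -> 0 <= q -> 0 <= y ->
  0 <= r -> 0 <= s -> 0 <= c1 -> 0 <= c2 ->
  p `^ c1 * q `^ c2 * y `^ (c1 * r + c2 * s) = (p * y `^ r) `^ c1 * (q * y `^ s) `^ c2.
Proof.
move=> p0 q0 y0 r0 s0 c10 c20; rewrite !powRM ?powR_ge0//.
by rewrite -!powRrM powRDge0 ?mulr_ge0// [c1 * _]mulrC [c2 * _]mulrC mulrACA.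
Qed.

Lemma upprod_ge1 a x n : (forall m, 0 <= a m) -> 1 <= upprod a x n.
Proof.
move=> a0; rewrite /upprod; elim: n => [|n IH]; first by rewrite big_geq.
by rewrite big_nat_recr//= mulr_ege1// powR_max_ge1.
Qed.

Lemma upprod_nd a x : (forall m, 0 <= a m) -> {homo upprod a x : m n / (m <= n)%N >-> m <= n}.
Proof.
move=> a0; apply/nondecreasing_seqP => n; rewrite /upprod big_nat_recr//=.
by rewrite ler_peMr ?powR_max_ge1// (le_trans ler01)// upprod_ge1.
Qed.

Lemma pprod_ge0 A a x n : 0 <= pprod A a x n.
Proof. by apply: prodr_ge0 => m _; exact: powR_ge0. Qed.

Lemma pprod_le_upprod A a x n : (forall m, 0 <= x m) -> (forall m, 0 <= a m) ->
  pprod A a x n <= upprod a x n.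
Proof.
move=> x0 a0; rewrite /pprod big_mkcond; apply: ler_prod => m _.
case: ifPn => _; last by rewrite ler01 powR_max_ge1.
by rewrite powR_ge0 le_powR// le_max lexx.
Qed.

(** Neither factors above 1 nor factors below 1 need be rare. Splitting
    [x = max (x, 1) * min (x, 1)] writes the product as a bounded nondecreasing sequence times a
    nonincreasing nonnegative one. *)
Lemma is_cvg_pprod A a x : (forall m, 0 <= x m) -> (forall m, 0 <= a m) ->
  upbounded a x -> cvgn (pprod A a x).
Proof.
move=> x0 a0 [M HM].
pose up n := \prod_(0 <= m < n | A m) Num.max (x m) 1 `^ a m.
pose dn n := \prod_(0 <= m < n | A m) Num.min (x m) 1 `^ a m.
have -> : pprod A a x = (fun n => up n * dn n).
  apply/funext => n; rewrite /up /dn -big_split /=.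
  by apply: eq_bigr => m _; rewrite powR_max_min.
have up0 n : 0 <= up n by apply: prodr_ge0 => m _; exact: powR_ge0.
have dn0 n : 0 <= dn n by apply: prodr_ge0 => m _; exact: powR_ge0.
apply: is_cvgM.
  apply: nondecreasing_is_cvgn.
    apply/nondecreasing_seqP => n; rewrite /up [leRHS]big_mkcond big_nat_recr//= -big_mkcond/=.
    by case: ifPn => _; rewrite ?mulr1// ler_peMr ?up0// powR_max_ge1.
  exists M => _ [n _ <-]; apply: le_trans (HM n).
  rewrite /up big_mkcond; apply: ler_prod => m _.
  by case: ifPn => _; rewrite ?ler01 ?powR_ge0 ?powR_max_ge1/=.
apply: nonincreasing_is_cvgn.
  apply/nonincreasing_seqP => n; rewrite /dn [leLHS]big_mkcond big_nat_recr//= -big_mkcond/=.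
  by case: ifPn => _; rewrite ?mulr1// ler_piMr ?dn0// powR_min_le1.
by exists 0 => _ [n _ <-].
Qed.

(* A diverging [limn] takes the default value [0] of [R], so no convergence is needed. *)
Lemma pprodoo_ge0 A a x : 0 <= pprodoo A a x.
Proof.
have [h|h] := pselect (cvgn (pprod A a x)).
  by apply: limr_ge => //; apply: nearW => n; exact: pprod_ge0.
by rewrite /pprodoo dvgP.
Qed.

Lemma upbounded_comb a b x (c1 c2 : R) : (forall m, 0 <= a m) -> (forall m, 0 <= b m) ->
  0 <= c1 -> 0 <= c2 -> upbounded a x -> upbounded b x ->
  upbounded (fun m => c1 * a m + c2 * b m) x.
Proof.
move=> a0 b0 c10 c20 [M HM] [N HN].
exists (M `^ c1 * N `^ c2) => n.
have -> : upprod (fun m => c1 * a m + c2 * b m) x n = upprod a x n `^ c1 * upprod b x n `^ c2.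
  rewrite /upprod; elim: n => [|n IH]; first by rewrite !big_geq// !powR1 mul1r.
  rewrite !big_nat_recr//= IH powR_combM// ?le_max ?ler01 ?orbT//.
  - by apply: prodr_ge0 => m _; exact: powR_ge0.
  - by apply: prodr_ge0 => m _; exact: powR_ge0.
by apply: ler_pM; rewrite ?powR_ge0// le_powR// (le_trans ler01)// upprod_ge1.
Qed.

Lemma upbounded_le a b x : (forall m, 0 <= a m <= b m) ->
  upbounded b x -> upbounded a x.
Proof.
move=> ab [M HM]; exists M => n; apply: le_trans (HM n); apply: ler_prod => m _.
by rewrite powR_ge0 /= ler_powR// ?le_max ?lexx ?orbT//; have /andP[] := ab m.
Qed.

Lemma pprod_comb A a b x (c1 c2 : R) n : (forall m, 0 <= a m) -> (forall m, 0 <= b m) ->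
  (forall m, 0 <= x m) -> 0 <= c1 -> 0 <= c2 ->
  pprod A (fun m => c1 * a m + c2 * b m) x n = pprod A a x n `^ c1 * pprod A b x n `^ c2.
Proof.
move=> a0 b0 x0 c10 c20; rewrite /pprod; elim: n => [|n IH].
  by rewrite !big_geq// !powR1 mul1r.
rewrite [LHS]big_mkcond [X in _ = X `^ _ * _]big_mkcond [X in _ = _ * X `^ _]big_mkcond /=.
rewrite !big_nat_recr//= -!big_mkcond /= IH.
case: ifPn => _; last by rewrite !mulr1.
rewrite powR_combM//.
- by apply: prodr_ge0 => m _; exact: powR_ge0.
- by apply: prodr_ge0 => m _; exact: powR_ge0.
Qed.

Lemma pprodoo_comb A a b x (c1 c2 : R) : (forall m, 0 <= a m) -> (forall m, 0 <= b m) ->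
  (forall m, 0 <= x m) -> 0 <= c1 -> 0 <= c2 -> upbounded a x -> upbounded b x ->
  pprodoo A (fun m => c1 * a m + c2 * b m) x = pprodoo A a x `^ c1 * pprodoo A b x `^ c2.
Proof.
move=> a0 b0 x0 c10 c20 ua ub; apply/cvg_lim => //.
have ca := is_cvg_pprod (A := A) x0 a0 ua.
have cb := is_cvg_pprod (A := A) x0 b0 ub.
have -> : pprod A (fun m => c1 * a m + c2 * b m) x =
    fun n => pprod A a x n `^ c1 * pprod A b x n `^ c2.
  by apply/funext => n; exact: pprod_comb.
apply: cvgM; apply: continuous_powR => //; try by move=> n; exact: pprod_ge0.
- by apply: limr_ge => //; apply: nearW => n; exact: pprod_ge0.
- by apply: limr_ge => //; apply: nearW => n; exact: pprod_ge0.
Qed.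

Lemma pprodoo_scale A a x (c : R) : (forall m, 0 <= a m) ->
  (forall m, 0 <= x m) -> 0 <= c -> upbounded a x ->
  pprodoo A (fun m => c * a m) x = pprodoo A a x `^ c.
Proof.
move=> a0 x0 c0 ua; have := @pprodoo_comb A a a x c 0 a0 a0 x0 c0 (lexx _) ua ua.
by rewrite powRr0 mulr1 => <-; congr pprodoo; apply/funext => m; rewrite mul0r addr0.
Qed.

Lemma pprod_D1 A a x i n : A i -> (i < n)%N ->
  pprod A a x n = x i `^ a i * pprod (fun m => A m && (m != i)) a x n.
Proof.
move=> Ai iN; rewrite /pprod [LHS]big_mkcond (bigD1_seq i) ?iota_uniq//=; last first.
  by rewrite mem_index_iota.
by rewrite Ai; congr (_ * _); rewrite [RHS]big_mkcondl.
Qed.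

Lemma pprodoo_D1 A a x i : (forall m, 0 <= a m) -> (forall m, 0 <= x m) ->
  upbounded a x -> A i ->
  pprodoo A a x = x i `^ a i * pprodoo (fun m => A m && (m != i)) a x.
Proof.
move=> a0 x0 ua Ai; apply/cvg_lim => //.
have : x i `^ a i * pprod (fun m => A m && (m != i)) a x n @[n --> \oo] -->
    x i `^ a i * pprodoo (fun m => A m && (m != i)) a x.
  by apply: cvgMr; exact: is_cvg_pprod.
apply: cvg_trans; apply: near_eq_cvg; near=> n.
by rewrite (pprod_D1 _ _ Ai)//; near: n; exact: nbhs_infty_gt.
Unshelve. all: by end_near. Qed.

Lemma pprodoo_le_upprod A a x M : (forall m, 0 <= a m) -> (forall m, 0 <= x m) ->
  (forall n, upprod a x n <= M) -> pprodoo A a x <= M.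
Proof.
move=> a0 x0 HM; apply: limr_le; first by apply: is_cvg_pprod => //; exists M.
by apply: nearW => n; apply: le_trans (HM n); exact: pprod_le_upprod.
Qed.

(** The product starts at [N] because finitely many early factors may vanish without affecting the
    positivity of a tail. *)
Definition dnprod (N : nat) a x (n : nat) : R :=
  \prod_(N <= m < N + n) Num.min (x m) 1 `^ a m.

Definition dnprodoo (N : nat) a x : R := limn (dnprod N a x).

Lemma dnprod_ge0 N a x n : 0 <= dnprod N a x n.
Proof. by apply: prodr_ge0 => m _; exact: powR_ge0. Qed.

Lemma dnprod_ni N a x : (forall m, 0 <= x m) -> (forall m, 0 <= a m) ->
  {homo dnprod N a x : m n / (m <= n)%N >-> n <= m}.
Proof.
move=> x0 a0; apply/nonincreasing_seqP => n; rewrite /dnprod addnS big_nat_recr ?leq_addr//=.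
by rewrite ler_piMr ?dnprod_ge0// powR_min_le1.
Qed.

Lemma is_cvg_dnprod N a x : (forall m, 0 <= x m) -> (forall m, 0 <= a m) ->
  cvgn (dnprod N a x).
Proof.
move=> x0 a0; apply: nonincreasing_is_cvgn; first exact: dnprod_ni.
by exists 0 => _ [n _ <-]; exact: dnprod_ge0.
Qed.

Lemma dnprodoo_ge0 N a x : (forall m, 0 <= x m) -> (forall m, 0 <= a m) ->
  0 <= dnprodoo N a x.
Proof.
move=> x0 a0; apply: limr_ge; first exact: is_cvg_dnprod.
by apply: nearW => n; exact: dnprod_ge0.
Qed.

Lemma dnprodoo_le1 N a x : (forall m, 0 <= x m) -> (forall m, 0 <= a m) ->
  dnprodoo N a x <= 1.
Proof.
move=> x0 a0; apply: limr_le; first exact: is_cvg_dnprod.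
apply: nearW => n; apply: (le_trans (dnprod_ni N x0 a0 (leq0n n))).
by rewrite /dnprod addn0 big_geq.
Qed.

(* Along a tail [m >= N] the product is bounded below by the product of the [min (x m) 1]. *)
Lemma pprodoo_gt0 A a x N : (forall m, 0 <= x m) -> (forall m, 0 <= a m) ->
  upbounded a x -> 0 < dnprodoo N a x -> (forall m, A m -> 0 < x m `^ a m) ->
  0 < pprodoo A a x.
Proof.
move=> x0 a0 ua dn xa.
pose c := \prod_(0 <= m < N | A m) x m `^ a m.
have c0 : 0 < c by apply: prodr_gt0 => m /xa.
apply: (@lt_le_trans _ _ (c * dnprodoo N a x)); first exact: mulr_gt0.
apply: limr_ge; first exact: is_cvg_pprod.
near=> n; have Nn : (N <= n)%N by near: n; exact: nbhs_infty_ge.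
rewrite /pprod (big_cat_nat (leq0n N) Nn)//= ler_pM2l//.
apply: (@le_trans _ _ (dnprod N a x (n - N))).
  apply: nonincreasing_cvgn_ge; [exact: dnprod_ni|exact: is_cvg_dnprod].
rewrite /dnprod subnKC// [leRHS]big_mkcond; apply: ler_prod => m _.
rewrite powR_ge0 /=; case: ifPn => _; last by rewrite powR_min_le1.
by rewrite le_powR// ?ge_min ?lexx// le_min x0 ler01.
Unshelve. all: by end_near. Qed.

Lemma pprodoo_eq0 A a x i : (forall m, 0 <= x m) -> (forall m, 0 <= a m) ->
  A i -> x i `^ a i = 0 -> pprodoo A a x = 0.
Proof.
move=> x0 a0 Ai xi; apply/cvg_lim => //.
apply: (@cvg_trans _ (cst (0 : R) @ \oo)); last exact: cvg_cst.
apply: near_eq_cvg; near=> n; rewrite (pprod_D1 _ _ Ai) ?xi ?mul0r//.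
by near: n; exact: nbhs_infty_gt.
Unshelve. all: by end_near. Qed.

(** The part coming from the [max (x m) 1] is at most [M], so the full product is at most [M] times
    the product of the [min (x m) 1] powers. *)
Lemma pprodoo_gt0_dnprod a x : (forall m, 0 <= x m) -> (forall m, 0 <= a m) ->
  upbounded a x -> 0 < pprodoo xpredT a x -> 0 < dnprodoo 0 a x.
Proof.
move=> x0 a0 [M HM] h.
have M0 : 0 < M by apply: lt_le_trans (HM 0%N); rewrite (lt_le_trans ltr01)// upprod_ge1.
apply: (@lt_le_trans _ _ (pprodoo xpredT a x / M)); first by rewrite divr_gt0.
rewrite ler_pdivrMr//.
have cd := is_cvg_dnprod (N := 0%N) x0 a0.
have -> : dnprodoo 0 a x * M = limn (fun n => dnprod 0 a x n * M).
  by apply/esym/cvg_lim => //; apply: cvgMl.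
apply: ler_lim; first by apply: is_cvg_pprod => //; exists M.
  by apply: is_cvgMl.
apply: nearW => n; apply: (@le_trans _ _ (dnprod 0 a x n * upprod a x n)); last first.
  by rewrite ler_wpM2l// dnprod_ge0.
rewrite /dnprod add0n /upprod /pprod -big_split /= le_eqVlt; apply/orP; left.
by apply/eqP; apply: eq_bigr => m _; rewrite mulrC powR_max_min.
Qed.

End PowerProducts.

(** * Moments and almost sure boundedness *)

Lemma nneseries_bounded {R : realType} (a : nat -> R) :
  (forall i, 0 <= a i) -> (\sum_(0 <= i <oo) (a i)%:E < +oo)%E ->
  exists M, forall n, \sum_(0 <= i < n) a i <= M.
Proof.
move=> a0 aoo; have fa : (\sum_(0 <= i <oo) (a i)%:E)%E \is a fin_num.
  by rewrite ge0_fin_numE// nneseries_ge0// => n _ _; rewrite lee_fin.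
exists (fine (\sum_(0 <= i <oo) (a i)%:E)%E) => n.
rewrite -lee_fin fineK// -sumEFin.
by apply: nneseries_lim_ge => k _ _; rewrite lee_fin.
Qed.

Lemma summable_le {R : realType} (a : nat -> R) M : (forall i, 0 <= a i) ->
  (forall n, \sum_(0 <= i < n) a i <= M) -> forall i, a i <= M.
Proof.
move=> a0 HM i; apply: le_trans (HM i.+1); rewrite big_nat_recr//= lerDr.
exact: sumr_ge0.
Qed.

Lemma summable_cvg0 {R : realType} (a : nat -> R) M : (forall i, 0 <= a i) ->
  (forall n, \sum_(0 <= i < n) a i <= M) -> a n @[n --> \oo] --> 0.
Proof.
move=> a0 HM; apply: cvg_series_cvg_0; apply: nondecreasing_is_cvgn.
  by apply/nondecreasing_seqP => n; rewrite /series /= big_nat_recr//= lerDl.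
by exists M => _ [n _ <-]; exact: HM.
Qed.

Section Moments.
Context {R : realType} {d : measure_display} {T : measurableType d}.
Variables (P : probability T R) (X : nat -> {RV P >-> R}).
Hypothesis X_ge0 : forall i t, 0 <= X i t.
Hypothesis X_indep : mutually_independent X.
Hypothesis X_ident : identically_distributed X.
Hypothesis X_regvar : forall i, regularly_varying_m1 (X i).
Local Notation mu := (@lebesgue_measure R).

Definition tail (x : R) : R := prob P [set t | X 0 t > x].

Lemma gt_preimage i x : [set t | X i t > x] = X i @^-1` `]x, +oo[%classic.
Proof. by apply/seteqP; split => t /=; rewrite in_itv /= andbT. Qed.

Lemma P_gt i x : P [set t | X i t > x] = (tail x)%:E.
Proof.
rewrite /tail /prob fineK; last first.
  by rewrite fin_num_measure// gt_preimage -[X in measurable X]setTI; exact: measurable_funP.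
by rewrite !gt_preimage; exact: X_ident.
Qed.

Lemma tailE i x : prob P [set t | X i t > x] = tail x.
Proof. by rewrite /prob P_gt. Qed.

Lemma tail_gt0 x : 0 < tail x.
Proof. by have [+ _] := X_regvar 0; exact. Qed.

Lemma tail_le1 x : tail x <= 1.
Proof.
rewrite -lee_fin -(P_gt 0); apply: probability_le1.
by rewrite gt_preimage -[X in measurable X]setTI; exact: measurable_funP.
Qed.

Lemma tail_ni x y : x <= y -> tail y <= tail x.
Proof.
move=> xy; rewrite -lee_fin -!(P_gt 0); apply: le_measure; rewrite ?inE.
- by rewrite gt_preimage -[X in measurable X]setTI; exact: measurable_funP.
- by rewrite gt_preimage -[X in measurable X]setTI; exact: measurable_funP.
- by move=> t /=; exact: le_lt_trans.
Qed.

Lemma tail_rv s : 0 < s -> tail (s * x) / tail x @[x --> +oo] --> s^-1.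
Proof. by have [_] := X_regvar 0; exact. Qed.

Lemma integral_ident i (f : R -> \bar R) : measurable_fun setT f ->
  (forall x, 0 <= f x)%E -> (\int[P]_t f (X i t) = \int[P]_t f (X 0 t))%E.
Proof.
move=> mf f0; rewrite -[LHS](@ge0_integral_distribution _ _ _ _ _ P (X i))//.
rewrite -[RHS](@ge0_integral_distribution _ _ _ _ _ P (X 0))//.
by apply: eq_measure_integral => A mA _; exact: X_ident.
Qed.

(** Layer-cake formula: by Potter the tail of the [th]-th power at [r] is [O (r^(-p))] with
    [p > 1]. *)
Lemma moment_lty (th : R) : 0 < th < 1 ->
  (\int[P]_t (Num.max (X 0 t) 1 `^ th)%:E < +oo)%E.
Proof.
move=> /andP[th0 th1].
pose Z t := Num.max (X 0 t) 1 `^ th.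
have mZ : measurable_fun setT Z.
  apply: (measurableT_comp (measurable_powR _)).
  by apply: measurable_maxr => //; exact: measurable_cst.
pose Z' : {RV P >-> R} := HB.pack Z (isMeasurableFun.Build _ _ _ _ Z mZ).
have Z0 t : 0 <= Z' t by exact: powR_ge0.
have := ge0_expectation_ccdf Z0; rewrite unlock => ->.
(* This makes [1 - dl = (1 + th) / 2 > th], hence [p = (1 - dl) / th > 1] below. *)
pose dl := (1 - th) / 2.
have dl01 : 0 < dl < 1 by rewrite /dl; apply/andP; split; lra.
have [C [y0 [C1 y00 H _]]] := potter tail_gt0 tail_le1 tail_ni tail_rv dl01.
pose c := Num.max 1 (y0 `^ th).
have c1 : 1 <= c by rewrite le_max lexx.
have c0 : 0 < c by exact: lt_le_trans c1.
pose p := (1 - dl) / th.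
have p1 : 1 < p by rewrite /p ltr_pdivlMr// mul1r /dl; lra.
pose K := C * y0 `^ (1 - dl) * tail y0.
have bnd r : c <= r -> (ccdf Z' r <= (K * r `^ (- p))%:E)%E.
  move=> cr; have r1 : 1 <= r by exact: le_trans cr.
  have r0 : 0 < r by exact: lt_le_trans r1.
  pose s := r `^ th^-1.
  have s1 : 1 <= s.
    apply: (@le_trans _ _ (1 `^ th^-1)); first by rewrite powR1.
    by apply: le_powR => //; rewrite invr_ge0 ltW.
  have sth : s `^ th = r by rewrite /s powRVK ?gt_eqF// ltW.
  have sy0 : y0 <= s.
    rewrite /s -[leLHS](@powRK _ _ th) ?gt_eqF ?(ltW y00)//.
    apply: le_powR; rewrite ?invr_ge0 ?powR_ge0// ?(ltW th0)//.
    by apply: le_trans cr; rewrite le_max lexx orbT.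
  apply: (@le_trans _ _ (tail s)%:E).
    rewrite -(P_gt 0) /ccdf /distribution /pushforward.
    apply: le_measure; rewrite ?inE.
    - rewrite -[X in measurable X]setTI.
      by apply: (measurable_funP Z') => //; exact: measurable_itv.
    - by rewrite gt_preimage -[X in measurable X]setTI; exact: measurable_funP.
    move=> t /=; rewrite in_itv /= andbT => rZ; rewrite ltNge; apply/negP => Xs.
    have : Z t <= r.
      rewrite -sth; apply: le_powR; rewrite ?(ltW th0)// ?le_max ?X_ge0//.
      by rewrite ge_max Xs s1.
    by rewrite leNgt rZ.
  rewrite lee_fin; have := H y0 (s / y0) (lexx _).
  rewrite ler_pdivlMr// mul1r mulrCA divff ?gt_eqF// mulr1 => /(_ sy0) G.
  apply: (le_trans G).
  have s0 : 0 <= s by exact: powR_ge0.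
  rewrite powRM ?invr_ge0 ?(ltW y00)// powRV ?(ltW y00)//.
  rewrite (_ : - (-1 + dl) = 1 - dl); last by ring.
  have -> : s `^ (-1 + dl) = r `^ (- p).
    by rewrite /s -powRrM /p; congr (_ `^ _); field; rewrite gt_eqF.
  by rewrite /K le_eqVlt; apply/orP; left; apply/eqP; ring.
have cm : measurable_fun [set: R] (ccdf Z') by exact: ccdf_measurable.
have -> : `[0, +oo[%classic = `[0, c[%classic `|` `[c, +oo[%classic :> set R.
  by rewrite -itv_bndbnd_setU// bnd_simp// ltW.
rewrite ge0_integral_setU//=; first last.
- apply/disj_setPS => r /= []; rewrite !in_itv /= andbT => /andP[_ rc] cr.
  by move: (lt_le_trans rc cr); rewrite ltxx.
- exact: measurable_funTS.
apply: lte_add_pinfty.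
  apply: (@le_lt_trans _ _ (\int[mu]_(x in `[0%R, c[) 1)%E).
    apply: ge0_le_integral => //; first exact: measurable_funTS.
    by move=> x _; apply: probability_le1; exact: measurable_itv.
  rewrite integral_cst//= mul1e lebesgue_measure_itv /= lte_fin c0.
  by rewrite -EFinB ltry.
apply: (@le_lt_trans _ _ (\int[mu]_(x in `[c, +oo[) (K%:E * (x `^ (- p))%:E))%E).
  apply: ge0_le_integral => //.
  - exact: measurable_funTS.
  - apply: measurable_funTS; apply: emeasurable_funM; first exact: measurable_cst.
    by apply/measurable_EFinP; exact: measurable_powR.
  - by move=> x /=; rewrite in_itv /= andbT => /bnd; rewrite EFinM.
have K0 : 0 <= K by rewrite /K !mulr_ge0 ?powR_ge0// ?(ltW (tail_gt0 _))// (le_trans ler01).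
rewrite ge0_integralZl//.
- by rewrite integral_powR_pinfty// -EFinM ltry.
- by apply/measurable_EFinP; apply: measurable_funTS; exact: measurable_powR.
- by move=> x _; rewrite lee_fin powR_ge0.
Qed.

(** Young's inequality for [y^dl * 1]. The bound is linear in the exponent [dl], so the expectation
    of each factor is [1 + O (a_m)] and summable exponents give a convergent product of
    expectations. *)
Lemma powR_interp (y dl th : R) : 1 <= y -> 0 <= dl <= th -> 0 < th ->
  y `^ dl <= 1 + dl / th * (y `^ th - 1).
Proof.
move=> y1 /andP[dl0 dlth] th0.
have y0 : 0 <= y by exact: le_trans y1.
have [->|dlN0] := eqVneq dl 0; first by rewrite powRr0 mul0r mul0r addr0.
have [->|dlNth] := eqVneq dl th; first by rewrite divff ?gt_eqF// mul1r addrC subrK.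
have dl_gt0 : 0 < dl by rewrite lt0r dlN0.
pose s := dl / th.
have s0 : 0 < s by rewrite divr_gt0.
have s1 : s < 1 by rewrite ltr_pdivrMr// mul1r lt_neqAle dlNth.
have := @conjugate_powR _ (y `^ dl) 1 s^-1 (1 - s)^-1 (powR_ge0 _ _) ler01.
rewrite !invr_gt0 subr_gt0 !invrK => /(_ s0 s1 _).
rewrite mulr1 powR1 mul1r -powRrM.
have -> : dl * s^-1 = th by rewrite /s invf_div mulrCA divff// mulr1.
move=> h; apply: (le_trans (h _)); first by ring.
by rewrite -/s; lra.
Qed.

Definition upexp th := fine (\int[P]_t (Num.max (X 0 t) 1 `^ th)%:E)%E.

Lemma measurable_upprod (a : nat -> R) n :
  measurable_fun setT (fun t => upprod a (X^~ t) n).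
Proof.
apply: measurable_prod => m _; apply: (measurableT_comp (measurable_powR _)).
by apply: measurable_maxr => //; exact: measurable_cst.
Qed.

(** By independence the expectation is the product of those of the factors; each is at most
    [1 + a_m c <= exp (a_m c)] with [c = upexp th / th], uniformly in [n]. *)
Lemma integral_upprod_le th (a : nat -> R) S n : 0 < th < 1 ->
  (forall m, 0 <= a m <= th) -> (forall n, \sum_(0 <= m < n) a m <= S) ->
  (\int[P]_t (upprod a (X^~ t) n)%:E <= (expR (S * (upexp th / th)))%:E)%E.
Proof.
move=> th01 ath HS; have /andP[th0 th1] := th01.
have M1 : (\int[P]_t (Num.max (X 0 t) 1 `^ th)%:E = (upexp th)%:E)%E.
  rewrite /upexp fineK// ge0_fin_numE; first exact: moment_lty.
  by apply: integral_ge0 => t _; rewrite lee_fin powR_ge0.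
have upexp0 : 0 <= upexp th.
  by apply: fine_ge0; apply: integral_ge0 => t _; rewrite lee_fin powR_ge0.
have mmax (r : R) : measurable_fun setT (fun y : R => Num.max y 1 `^ r).
  apply: (measurableT_comp (measurable_powR _)).
  by apply: measurable_maxr => //; exact: measurable_cst.
rewrite (expectation_prod X_indep (f := fun m y => Num.max y 1 `^ a m))//; last first.
  by move=> m x; exact: powR_ge0.
apply: (@le_trans _ _ (\prod_(0 <= m < n) (expR (a m * (upexp th / th)))%:E)%E); last first.
  rewrite -[leLHS](_ : (\prod_(0 <= m < n) expR (a m * (upexp th / th)))%:E = _)%E; last first.
    by elim: n => [|n IH]; [rewrite !big_geq|rewrite !big_nat_recr//= EFinM IH].
  rewrite lee_fin -expR_sum -mulr_suml ler_expR ler_wpM2r//.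
  by rewrite divr_ge0// ltW.
have le1 m : (\int[P]_t (Num.max (X m t) 1 `^ a m)%:E <= (expR (a m * (upexp th / th)))%:E)%E.
  rewrite (integral_ident m (f := fun y => (Num.max y 1 `^ a m)%:E)); last 2 first.
  - exact/measurable_EFinP.
  - by move=> x; rewrite lee_fin powR_ge0.
  have /andP[am0 amth] := ath m.
  apply: (@le_trans _ _ (\int[P]_t (1%:E + (a m / th)%:E * (Num.max (X 0 t) 1 `^ th)%:E))%E).
    apply: ge0_le_integral => //.
    - by move=> t _; rewrite lee_fin powR_ge0.
    - by apply/measurable_EFinP; apply: (measurableT_comp (mmax _)).
    - apply: emeasurable_funD; first exact: measurable_cst.
      apply: emeasurable_funM; first exact: measurable_cst.
      by apply/measurable_EFinP; apply: (measurableT_comp (mmax _)).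
    - move=> t _; rewrite -EFinM -EFinD lee_fin.
      apply: (le_trans (@powR_interp _ _ th _ _ th0)).
      + by rewrite le_max lexx orbT.
      + by rewrite am0.
      + rewrite lerD2l ler_wpM2l ?divr_ge0 ?(ltW th0)//.
        by rewrite gerBl.
  rewrite ge0_integralD//; first last.
  - apply: emeasurable_funM; first exact: measurable_cst.
    by apply/measurable_EFinP; apply: (measurableT_comp (mmax _)).
  - by move=> t _; rewrite -EFinM lee_fin mulr_ge0 ?powR_ge0// divr_ge0// ltW.
  rewrite integral_cst//= probability_setT mule1 ge0_integralZl//; first last.
  - by rewrite lee_fin divr_ge0// ltW.
  - by move=> t _; rewrite lee_fin powR_ge0.
  - by apply/measurable_EFinP; apply: (measurableT_comp (mmax _)).
  rewrite M1 -EFinM -EFinD lee_fin mulrAC -mulrA.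
  exact: expR_ge1Dx.
elim: n => [|n IH]; first by rewrite !big_geq.
rewrite !big_nat_recr//=; apply: lee_pmul => //.
- apply: prode_ge0 => m _; apply: integral_ge0 => t _; rewrite lee_fin; exact: powR_ge0.
- by apply: integral_ge0 => t _; rewrite lee_fin; exact: powR_ge0.
Qed.

(** Taken in the extended reals: for nonnegative exponents the monotone limit exists at every point,
    before any boundedness is known. *)
Definition upprodoo (a : nat -> R) t : \bar R := limn (fun n => (upprod a (X^~ t) n)%:E).

Lemma upprod_le_oo (a : nat -> R) t n : (forall m, 0 <= a m) ->
  ((upprod a (X^~ t) n)%:E <= upprodoo a t)%E.
Proof.
move=> a0; apply: lime_ge.
  apply: ereal_nondecreasing_is_cvgn => k l kl.
  by rewrite lee_fin; exact: upprod_nd.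
by near=> m; rewrite lee_fin upprod_nd//; near: m; exact: nbhs_infty_ge.
Unshelve. all: by end_near. Qed.

Lemma measurable_upprodoo (a : nat -> R) : (forall m, 0 <= a m) ->
  measurable_fun setT (upprodoo a).
Proof.
move=> a0; apply: (emeasurable_fun_cvg (fun n t => (upprod a (X^~ t) n)%:E)).
  by move=> n; apply/measurable_EFinP; exact: measurable_upprod.
move=> t _; apply: ereal_nondecreasing_is_cvgn.
by move=> k l kl; rewrite lee_fin; exact: upprod_nd.
Qed.

Lemma integrable_upprodoo th (a : nat -> R) S : 0 < th < 1 ->
  (forall m, 0 <= a m <= th) -> (forall n, \sum_(0 <= m < n) a m <= S) ->
  P.-integrable setT (upprodoo a).
Proof.
move=> th01 ath HS.
have a0 m : 0 <= a m by have /andP[] := ath m.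
have up0 n t : (0 <= (upprod a (X^~ t) n)%:E)%E.
  by rewrite lee_fin (le_trans ler01)// upprod_ge1.
apply/integrableP; split; first exact: measurable_upprodoo.
under eq_integral do rewrite gee0_abs ?(le_trans _ (upprod_le_oo _ 0 _))//.
rewrite (_ : \int[P]_t upprodoo a t =
    limn (fun n => \int[P]_t (upprod a (X^~ t) n)%:E))%E; last first.
  apply: monotone_convergence => //.
  - by move=> n; apply/measurable_EFinP; exact: measurable_upprod.
  - by move=> t _ k l kl; rewrite lee_fin; exact: upprod_nd.
apply: (@le_lt_trans _ _ (expR (S * (upexp th / th)))%:E); last exact: ltry.
apply: lime_le.
  apply: ereal_nondecreasing_is_cvgn => k l kl; apply: ge0_le_integral => //.
  - by apply/measurable_EFinP; exact: measurable_upprod.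
  - by apply/measurable_EFinP; exact: measurable_upprod.
  - by move=> t _; rewrite lee_fin; exact: upprod_nd.
by apply: nearW => n; exact: integral_upprod_le.
Qed.

(** The exponents may exceed 1, where moments can be infinite. Scaled by a small [c] they all lie
    below 1/2, so the limit of the scaled products is integrable and thus finite almost surely; the
    original product is its power of exponent [1 / c]. *)
Lemma ae_upbounded (a : nat -> R) : (forall m, 0 <= a m) ->
  (\sum_(0 <= i <oo) (a i)%:E < +oo)%E ->
  {ae P, forall t, upbounded a (X^~ t)}.
Proof.
move=> a0 /(nneseries_bounded a0)[S HS].
have S0 : 0 <= S by have := HS 0%N; rewrite big_geq.
pose c := 2^-1 / (1 + S).
have S1 : 0 < 1 + S by rewrite ltr_wpDr.
have c0 : 0 < c by rewrite divr_gt0.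
have cS : c * S <= 2^-1.
  by rewrite /c mulrAC ler_pdivrMr// ler_pM2l// lerDr.
have ia : P.-integrable setT (upprodoo (fun m => c * a m)).
  apply: (@integrable_upprodoo 2^-1 _ (c * S)).
  - by rewrite invr_gt0 ltr0n invf_lt1 ?ltr1n.
  - move=> m; rewrite mulr_ge0 ?(ltW c0)//=; apply: le_trans cS.
    by rewrite ler_pM2l//; exact: summable_le HS m.
  - by move=> n; rewrite -mulr_sumr ler_pM2l.
have := integrable_ae measurableT ia; apply: filterS => t /(_ I) ft.
exists (fine (upprodoo (fun m => c * a m) t) `^ c^-1) => n.
have ca0 m : 0 <= c * a m by rewrite mulr_ge0// ltW.
have := upprod_le_oo t n ca0; rewrite -(fineK ft) lee_fin => h.
have up0 b m : (forall m, 0 <= b m) -> 0 <= upprod b (X^~ t) m.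
  by move=> b0; rewrite (le_trans ler01)// upprod_ge1.
rewrite -[leLHS](@powRK _ _ c) ?gt_eqF ?up0//.
apply: le_powR; rewrite ?invr_ge0 ?(ltW c0) ?powR_ge0//.
apply: le_trans h; rewrite le_eqVlt; apply/orP; left; apply/eqP.
rewrite /upprod; elim: n => [|n IH]; first by rewrite !big_geq// powR1.
have p0 : 0 <= \prod_(0 <= m < n) Num.max (X m t) 1 `^ a m := up0 a n a0.
by rewrite !big_nat_recr//= powRM ?powR_ge0 ?p0// IH -powRrM [a n * _]mulrC.
Qed.

End Moments.

(** * Positivity of infinite products *)

Section AlmostSureInclusion.
Context {R : realType} {d : measure_display} {T : measurableType d}.
Variable P : probability T R.

Lemma ae_le_measure (A B : set T) : measurable A -> measurable B ->
  {ae P, forall t, A t -> B t} -> (P A <= P B)%E.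
Proof.
move=> mA mB [N [mN N0 sub]].
apply: (@le_trans _ _ (P (B `|` N))).
  apply: le_measure; rewrite ?inE//; first exact: measurableU.
  move=> t At; have [Bt|nB] := pselect (B t); [by left|right].
  by apply: sub => /= /(_ At).
apply: (le_trans (measureU2 _ mB mN)).
by rewrite [X in (_ + X <= _)%E](_ : _ = 0%E) ?adde0.
Qed.

Lemma ae_eq_measure (A B : set T) : measurable A -> measurable B ->
  {ae P, forall t, A t <-> B t} -> P A = P B.
Proof.
move=> mA mB AB; apply/eqP; rewrite eq_le; apply/andP; split.
  by apply: ae_le_measure => //; apply: filterS AB => t [].
by apply: ae_le_measure => //; apply: filterS AB => t [].
Qed.

Lemma prob_ge0 (A : set T) : 0 <= prob P A.
Proof. by rewrite /prob fine_ge0. Qed.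

Lemma probK (A : set T) : measurable A -> (prob P A)%:E = P A.
Proof. by move=> mA; rewrite /prob fineK// fin_num_measure. Qed.

Lemma prob_le (A B : set T) : measurable A -> measurable B ->
  {ae P, forall t, A t -> B t} -> prob P A <= prob P B.
Proof. by move=> mA mB AB; rewrite -lee_fin !probK//; exact: ae_le_measure. Qed.

Lemma prob_eq (A B : set T) : measurable A -> measurable B ->
  {ae P, forall t, A t <-> B t} -> prob P A = prob P B.
Proof. by move=> mA mB AB; rewrite /prob (ae_eq_measure mA mB). Qed.

Lemma ae_of_prob1 (A : set T) : measurable A -> P A = 1%E -> {ae P, forall t, A t}.
Proof.
move=> mA A1; exists (~` A); split; first exact: measurableC.
  by rewrite probability_setC// A1 subee.
by [].
Qed.

Lemma bigcup_prob_gt0 (A : nat -> set T) : (forall n, measurable (A n)) ->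
  (0 < P (\bigcup_n A n))%E -> exists n, (0 < P (A n))%E.
Proof.
move=> mA h; apply: contrapT => /forallNP H.
have A0 n : P (A n) = 0%E.
  by apply/eqP; rewrite eq_le measure_ge0 andbT leNgt; apply/negP.
have : P.-negligible (\bigcup_n A n).
  by apply: negligible_bigcup => n; exists (A n); split => //; exact: A0.
move=> /measure_negligible h0; rewrite h0 ?ltxx// in h.
exact: bigcupT_measurable.
Qed.

End AlmostSureInclusion.

Section ZeroOne.
Context {R : realType} {d : measure_display} {T : measurableType d}.
Variables (P : probability T R) (X : nat -> {RV P >-> R}).
Hypothesis X_ge0 : forall i t, 0 <= X i t.
Hypothesis X_indep : mutually_independent X.
Hypothesis X_ident : identically_distributed X.
Hypothesis X_regvar : forall i, regularly_varying_m1 (X i).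

Lemma measurable_gt0 d' (T' : measurableType d') (f : T' -> R) : measurable_fun setT f -> measurable [set t | 0 < f t].
Proof.
move=> mf; rewrite (_ : [set t | _] = f @^-1` `]0, +oo[%classic).
  by rewrite -[X in measurable X]setTI; exact: mf.
by apply/seteqP; split => t /=; rewrite in_itv /= andbT.
Qed.

Lemma measurable_pprodoo_off i (A : pred nat) (a : nat -> R) : ~~ A i ->
  measurable_fun [set: off X i] ((fun t => pprodoo A a (X^~ t)) : off X i -> R).
Proof.
move=> Ai; apply: (@measurable_infprod _ _ (off X i) A (fun m t => X m t `^ a m)) => m Am.
apply: (measurableT_comp (measurable_powR _)).
by apply: measurable_off; apply: contraNneq Ai => <-.
Qed.

Lemma measurable_pprodoo (A : pred nat) (a : nat -> R) :
  measurable_fun [set: T] (fun t => pprodoo A a (X^~ t)).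
Proof.
apply: (@measurable_infprod _ _ T A (fun m t => X m t `^ a m)) => m Am.
by apply: (measurableT_comp (measurable_powR _)).
Qed.

Lemma measurable_dnprod_gen d' (T' : measurableType d') (Y : nat -> T' -> R) N (a : nat -> R) n :
  (forall m, (N <= m)%N -> measurable_fun setT (Y m)) ->
  measurable_fun setT (fun t => dnprod N a (Y^~ t) n).
Proof.
move=> mY.
have -> : (fun t => dnprod N a (Y^~ t) n) =
  (fun t => \prod_(m <- iota N n) (if (N <= m)%N then Num.min (Y m t) 1 `^ a m else 1)).
  apply/funext => t; rewrite /dnprod /index_iota addKn; apply: eq_big_seq => m.
  by rewrite mem_iota => /andP[-> _].
apply: measurable_prod => m _; have [mn|mn] := leqP N m; last exact: measurable_cst.
apply: (measurableT_comp (measurable_powR _)).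
by apply: measurable_minr; [exact: mY|exact: measurable_cst].
Qed.

Lemma measurable_dnprodoo_off i N (a : nat -> R) : (i < N)%N ->
  measurable_fun [set: off X i] ((fun t => dnprodoo N a (X^~ t)) : off X i -> R).
Proof.
move=> iN; apply: (@measurable_limn _ _ (off X i) (fun n t => dnprod N a (X^~ t) n)) => n.
apply: (@measurable_dnprod_gen _ (off X i) (fun m => X m : off X i -> R)) => m Nm.
by apply: measurable_off; rewrite neq_ltn (leq_trans iN Nm) orbT.
Qed.

Lemma measurable_dnprodoo N (a : nat -> R) :
  measurable_fun [set: T] (fun t => dnprodoo N a (X^~ t)).
Proof.
apply: (@measurable_limn _ _ T (fun n t => dnprod N a (X^~ t) n)) => n.
exact: measurable_dnprod_gen.
Qed.

(* With [p n] the expected product of the first [n] factors, the expected tail product from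
   [N] on is [L / p N] where [L = lim p]; it tends to [1] as soon as [L > 0]. *)
Lemma ae_dnprodoo_gt0 (a : nat -> R) : (forall m, 0 <= a m) ->
  {ae P, forall t, upbounded a (X^~ t)} ->
  0 < prob P [set t | pprodoo xpredT a (X^~ t) > 0] ->
  {ae P, forall t, exists N, 0 < dnprodoo N a (X^~ t)}.
Proof.
move=> a0 ub pos.
pose W N t := dnprodoo N a (X^~ t).
pose e m := fine (\int[P]_t (Num.min (X m t) 1 `^ a m)%:E)%E.
have mmin m : measurable_fun setT (fun y : R => Num.min y 1 `^ a m).
  apply: (measurableT_comp (measurable_powR _)).
  by apply: measurable_minr => //; exact: measurable_cst.
have mW N : measurable_fun setT (W N) by exact: measurable_dnprodoo.
have Xt0 t m : 0 <= X m t by exact: X_ge0.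
have le1 (f : T -> R) : measurable_fun setT f -> (forall t, 0 <= f t <= 1) ->
    (0 <= \int[P]_t (f t)%:E <= 1)%E.
  move=> mf f01; apply/andP; split.
    by apply: integral_ge0 => t _; rewrite lee_fin; have /andP[] := f01 t.
  apply: (@le_trans _ _ (\int[P]_t 1)%E).
    apply: ge0_le_integral => //.
    - by move=> t _; rewrite lee_fin; have /andP[] := f01 t.
    - exact/measurable_EFinP.
    - by move=> t _; rewrite lee_fin; have /andP[] := f01 t.
  by rewrite integral_cst//= probability_setT mule1.
have fin01 (f : T -> R) : measurable_fun setT f -> (forall t, 0 <= f t <= 1) ->
    (\int[P]_t (f t)%:E)%E \is a fin_num.
  move=> mf f01; have /andP[h0 h1] := le1 f mf f01.
  by rewrite ge0_fin_numE// (le_lt_trans h1)// ltry.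
have W01 N t : 0 <= W N t <= 1 by rewrite /W dnprodoo_ge0// dnprodoo_le1.
have eE m : (\int[P]_t (Num.min (X m t) 1 `^ a m)%:E = (e m)%:E)%E.
  rewrite /e fineK// fin01//; first exact: (measurableT_comp (mmin m)).
  by move=> t; rewrite powR_ge0 powR_min_le1.
pose q N n := \prod_(N <= m < N + n) e m.
have Edn N n : (\int[P]_t (dnprod N a (X^~ t) n)%:E = (q N n)%:E)%E.
  have -> : (\int[P]_t (dnprod N a (X^~ t) n)%:E = \int[P]_t
      (\prod_(0 <= m < N + n) (if (N <= m)%N then Num.min (X m t) 1 `^ a m else 1))%:E)%E.
    apply: eq_integral => t _; congr EFin.
    rewrite (@big_cat_nat _ _ _ N)//= ?leq_addr// [X in _ = X * _]big1_seq ?mul1r.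
      rewrite /dnprod; apply: eq_big_seq => m; rewrite mem_index_iota => /andP[-> _]//.
    by move=> m; rewrite mem_index_iota => /andP[_ /andP[_ mN]]; rewrite leqNgt mN.
  rewrite (expectation_prod X_indep (f := fun m y => if (N <= m)%N then Num.min y 1 `^ a m else 1)); last 2 first.
  - by move=> m; case: leqP => // _; exact: measurable_cst.
  - by move=> m x; case: leqP => // _; exact: powR_ge0.
  rewrite (@big_cat_nat _ _ _ N)//= ?leq_addr// [X in (X * _)%E]big1_seq ?mul1e; last first.
    move=> m; rewrite mem_index_iota => /andP[_ /andP[_ mN]].
    transitivity (\int[P]_t cst 1%E t)%E.
      by apply: eq_integral => t _; rewrite leqNgt mN.
    by rewrite integral_cst//= probability_setT mule1.
  rewrite /q; elim: n => [|n IH]; first by rewrite !addn0 !big_geq.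
  rewrite addnS !big_nat_recr ?leq_addr//= IH EFinM; congr (_ * _)%E.
  exact: eE.
pose w N := fine (\int[P]_t (W N t)%:E)%E.
have wE N : (\int[P]_t (W N t)%:E = (w N)%:E)%E by rewrite /w fineK// fin01.
have qw N : q N n @[n --> \oo] --> w N.
  have dc : (\int[P]_t (dnprod N a (X^~ t) n)%:E @[n --> \oo] --> \int[P]_t (W N t)%:E)%E.
    have [|||||_ _] // := @dominated_convergence _ T R P setT measurableT
      (fun n t => (dnprod N a (X^~ t) n)%:E) (fun t => (W N t)%:E) (cst 1%E).
    - by move=> n; apply/measurable_EFinP; exact: measurable_dnprod_gen.
    - exact/measurable_EFinP.
    - apply: nearW => t _; apply: cvg_EFin; first exact: nearW.
      exact: is_cvg_dnprod.
    - exact: finite_measure_integrable_cst.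
    - apply: nearW => t n _; rewrite gee0_abs ?lee_fin ?dnprod_ge0//.
      apply: (le_trans (dnprod_ni N (Xt0 t) a0 (leq0n n))).
      by rewrite /dnprod addn0 big_geq.
  move: dc; rewrite wE; under eq_cvg do rewrite Edn.
  by move=> /fine_cvgP[_].
(* Otherwise the product of the [min (X m) 1] powers would vanish almost surely, and with it the
   full product, against [pos]. *)
have w0 : 0 < w 0%N.
  rewrite lt0r; apply/andP; split; last first.
    by rewrite -lee_fin -wE; have /andP[] := le1 (W 0%N) (mW _) (W01 _).
  apply/eqP => w00; have := wE 0%N; rewrite w00.
  move=> intW.
  have mW0 : measurable_fun setT (EFin \o W 0%N) by exact/measurable_EFinP.
  have /(ae_eq_integral_abs P measurableT mW0).1 aeW :
      (\int[P]_(t in setT) `|(EFin \o W 0%N) t| = 0)%E.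
    transitivity (\int[P]_t (W 0%N t)%:E)%E; last exact: intW.
    apply: eq_integral => t _.
    by rewrite gee0_abs//= lee_fin; have /andP[] := W01 0%N t.
  have mp := measurable_gt0 (measurable_pprodoo xpredT a).
  move: pos; rewrite ltNge => /negP; apply; rewrite -lee_fin probK//.
  apply: (@le_trans _ _ (P set0)); last by rewrite measure0.
  apply: ae_le_measure => //.
  apply: filterS2 ub aeW => t ubt /(_ I) /= [W0] h.
  have := pprodoo_gt0_dnprod (Xt0 t) a0 ubt h.
  by rewrite -/(W 0%N t) W0 ltxx.
pose p N := q 0%N N.
have pw N : p N * w N = w 0%N.
  have h1 : p N * q N n @[n --> \oo] --> p N * w N by apply: cvgMr; exact: qw.
  have h2 : p N * q N n @[n --> \oo] --> w 0%N.
    have := qw 0%N; rewrite -(cvg_shiftn N); apply: cvg_trans.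
    apply: near_eq_cvg; near=> n.
    by rewrite /= /p /q !add0n [(n + N)%N]addnC (@big_cat_nat _ _ _ N)//= leq_addr.
  exact: (cvg_unique _ h1 h2).
have w_cvg1 : w n @[n --> \oo] --> (1 : R).
  have -> : w = fun N => w 0%N / p N.
    apply/funext => N; rewrite -(pw N) mulrAC divff ?mul1r//.
    by apply: contra_eq_neq (pw N) => ->; rewrite mul0r lt_eqF.
  rewrite -(@divff _ (w 0%N)) ?gt_eqF//; apply: cvgM; first exact: cvg_cst.
  by apply: cvgV; rewrite ?gt_eqF//; exact: qw.
pose H := \bigcup_N [set t | 0 < W N t].
have mWN N : measurable [set t | 0 < W N t] by exact: measurable_gt0.
have mH : measurable H by exact: bigcupT_measurable.
have H1 : P H = 1%E.
  apply/eqP; rewrite eq_le probability_le1//=.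
  (* The tail product is at most 1, so its expectation is at most the probability that it is
     positive; letting [N] grow gives [P H = 1]. *)
  have wH N : w N <= fine (P H).
    rewrite -lee_fin -wE fineK ?fin_num_measure//.
    apply: (@le_trans _ _ (P [set t | 0 < W N t])); last first.
      apply: le_measure; rewrite ?inE//.
      by move=> t ht; exists N.
    rewrite -[X in P X]setIT -integral_indic//; apply: ge0_le_integral => //.
    - by move=> t _; rewrite lee_fin; have /andP[] := W01 N t.
    - exact/measurable_EFinP.
    - by apply/measurable_EFinP; exact: measurable_indic.
    - move=> t _; rewrite lee_fin indicE; have /andP[h0 h1] := W01 N t.
      have [h|h] := ltP 0 (W N t); first by rewrite mem_set.
      by rewrite (le_trans h).
  rewrite -(@fineK _ (P H)) ?fin_num_measure// lee_fin.
  rewrite -(cvg_lim _ w_cvg1)//; apply: limr_le; first by apply/cvg_ex; exists 1.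
  exact: nearW.
have := ae_of_prob1 mH H1; apply: filterS => t [N _ h].
by exists N.
Unshelve. all: by end_near. Qed.

(** Two events of positive probability may be disjoint, so separate positivity of the products is
    not enough. Almost surely both tail products are positive from some [N] on; the remaining [N]
    variables are then required to be positive one after the other, each independently of the rest
    and with probability [tail 0 > 0]. *)
Lemma joint_positivity (a b : nat -> R) : (forall m, 0 <= a m) -> (forall m, 0 <= b m) ->
  {ae P, forall t, upbounded a (X^~ t)} -> {ae P, forall t, upbounded b (X^~ t)} ->
  {ae P, forall t, exists N, 0 < dnprodoo N a (X^~ t)} ->
  {ae P, forall t, exists N, 0 < dnprodoo N b (X^~ t)} ->
  forall A : pred nat,
  0 < prob P [set t | 0 < pprodoo A a (X^~ t) /\ 0 < pprodoo A b (X^~ t)].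
Proof.
move=> a0 b0 uba ubb dna dnb A.
have Xt0 t m : 0 <= X m t by exact: X_ge0.
pose G N k := [set t | [/\ 0 < dnprodoo N a (X^~ t), 0 < dnprodoo N b (X^~ t) &
  forall m, (k <= m < N)%N -> 0 < X m t]].
have GE N k : G N k = [set t | 0 < dnprodoo N a (X^~ t)] `&` [set t | 0 < dnprodoo N b (X^~ t)]
    `&` \bigcap_(m in [set m | (k <= m < N)%N]) [set t | 0 < X m t].
  by apply/seteqP; split => [t [h1 h2 h3]|t [[h1 h2] h3]].
have mG N k : measurable (G N k).
  rewrite GE; apply: measurableI; last first.
    by apply: bigcap_measurableType => m _; exact: measurable_gt0.
  by apply: measurableI; apply: measurable_gt0; exact: measurable_dnprodoo.
have mGoff N k : (k < N)%N -> measurable (G N k.+1 : set (off X k)).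
  move=> kN; rewrite GE; apply: measurableI; last first.
    apply: bigcap_measurableType => m /= /andP[km _].
    apply: (@measurable_gt0 _ (off X k)); apply: measurable_off.
    by rewrite neq_ltn km orbT.
  by apply: measurableI; apply: (@measurable_gt0 _ (off X k)); exact: measurable_dnprodoo_off.
(* For [k = N] no variable is constrained. The events cover almost everything, since positivity of a
   tail product is inherited by later tails. *)
have [N GN] : exists N, (0 < P (G N N))%E.
  apply: bigcup_prob_gt0 => //.
  apply: (@lt_le_trans _ _ 1%E) => //.
  rewrite -(@probability_setT _ _ _ P); apply: ae_le_measure => //.
    exact: bigcupT_measurable.
  apply: filterS2 dna dnb => t [N1 h1] [N2 h2] _.
  have mono c N N' : (forall m, 0 <= c m) -> (N <= N')%N ->
      0 < dnprodoo N c (X^~ t) -> 0 < dnprodoo N' c (X^~ t).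
    move=> c0 NN' /lt_le_trans; apply.
    have cN := is_cvg_dnprod (N := N) (Xt0 t) c0.
    have cN' := is_cvg_dnprod (N := N') (Xt0 t) c0.
    apply: limr_ge => //; near=> n.
    apply: (le_trans (nonincreasing_cvgn_ge (dnprod_ni N (Xt0 t) c0) cN (N' - N + n))).
    rewrite /dnprod addnA subnKC// (@big_cat_nat _ _ _ N')//= ?leq_addr//.
    rewrite ler_piMl//; first by apply: prodr_ge0 => m _; exact: powR_ge0.
    apply: prodr_ile1 => m _; rewrite powR_ge0 powR_min_le1//.
  exists (maxn N1 N2) => //; split.
  - by apply: mono h1 => //; exact: leq_maxl.
  - by apply: mono h2 => //; exact: leq_maxr.
  - by move=> m /andP[h h']; move: (leq_ltn_trans h h'); rewrite ltnn.
have Gk k : (k <= N)%N -> (0 < P (G N (N - k)%N))%E.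
  elim: k => [_|k IH kN]; first by rewrite subn0.
  have kN' : (N - k.+1 < N)%N by rewrite ltn_subrL (leq_trans _ kN).
  have e : (N - k.+1).+1 = (N - k)%N by rewrite subnSK.
  have -> : G N (N - k.+1)%N = X (N - k.+1)%N @^-1` `]0, +oo[%classic `&` G N (N - k.+1).+1.
    apply/seteqP; split => [t [h1 h2 h3]|t /= [] ].
      split; first by rewrite /= in_itv /= andbT; apply: h3; rewrite leqnn.
      by split => // m /andP[hm1 hm2]; apply: h3; rewrite hm2 (ltnW hm1).
    rewrite in_itv /= andbT => h0 [h1 h2 h3]; split => // m /andP[hm1 hm2].
    move: hm1; rewrite leq_eqVlt => /predU1P[<-//|hm1].
    by apply: h3; rewrite hm1.
  rewrite (indep_off X_indep)//; last exact: mGoff.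
  rewrite e mule_gt0//; last by apply: IH; exact: ltnW.
  by rewrite -gt_preimage (P_gt X_ident) lte_fin (tail_gt0 X_regvar).
have {}Gk := Gk N (leqnn N); rewrite subnn in Gk.
rewrite -lte_fin probK; last first.
  rewrite (_ : [set t | _] = [set t | 0 < pprodoo A a (X^~ t)] `&`
    [set t | 0 < pprodoo A b (X^~ t)])//.
  by apply: measurableI; apply: measurable_gt0; exact: measurable_pprodoo.
apply: (lt_le_trans Gk); apply: ae_le_measure => //.
  rewrite (_ : [set t | _] = [set t | 0 < pprodoo A a (X^~ t)] `&`
    [set t | 0 < pprodoo A b (X^~ t)])//.
  by apply: measurableI; apply: measurable_gt0; exact: measurable_pprodoo.
apply: filterS2 uba ubb => t ua ub [h1 h2 h3].
(* For [m >= N] a vanishing power would annihilate the tail product; [X m t] itself may be 0 there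
   if [c m = 0]. *)
have fac c m : (forall m, 0 <= c m) -> 0 < dnprodoo N c (X^~ t) -> 0 < X m t `^ c m.
  move=> c0 h; have [mN|Nm] := ltnP m N; first by rewrite powR_gt0// h3.
  rewrite lt_neqAle powR_ge0 andbT eq_sym; apply/negP => /eqP xm.
  have : dnprodoo N c (X^~ t) <= 0.
    apply: (le_trans (nonincreasing_cvgn_ge (dnprod_ni N (Xt0 t) c0)
      (is_cvg_dnprod (N := N) (Xt0 t) c0) (m.+1 - N))).
    rewrite /dnprod subnKC ?(leq_trans Nm)// big_nat_recr//=.
    move/eqP: xm; rewrite powR_eq0 => /andP[/eqP -> cm0].
    by rewrite (min_idPl ler01) powR0// mulr0.
  by rewrite leNgt h.
by split; apply: (@pprodoo_gt0 _ _ _ _ N) => // m _; exact: fac.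
Unshelve. all: by end_near. Qed.

(** Almost surely a product can vanish only through one of its factors, not by accumulation. This
    turns positivity of a product into the factorwise indicators of the final formula. *)
Lemma pprodoo_gt0P (A : pred nat) (a : nat -> R) : (forall m, 0 <= a m) ->
  {ae P, forall t, upbounded a (X^~ t)} ->
  {ae P, forall t, exists N, 0 < dnprodoo N a (X^~ t)} ->
  {ae P, forall t, 0 < pprodoo A a (X^~ t) <-> forall m, A m -> 0 < X m t `^ a m}.
Proof.
move=> a0; apply: filterS2 => t ub [N dn].
have Xt0 m : 0 <= X m t by exact: X_ge0.
split; last exact: pprodoo_gt0 dn.
move=> h m Am; rewrite lt_neqAle powR_ge0 andbT eq_sym; apply/negP => /eqP xm.
by move: h; rewrite (pprodoo_eq0 Xt0 a0 Am xm) ltxx.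
Qed.

End ZeroOne.

(** * The linear program *)

Section LinearProgramSolutions.
Context {R : realType}.
Implicit Types (a b kappa : nat -> R).

(* The indices may coincide. *)
Definition kappa3 (i j k : nat) (p q r : R) (m : nat) : R :=
  p * (m == i)%:R + q * (m == j)%:R + r * (m == k)%:R.

Lemma sum_pointmass (f : nat -> R) i n : (i < n)%N ->
  \sum_(0 <= m < n) f m * (m == i)%:R = f i.
Proof.
move=> iN; rewrite (bigD1_seq i) ?iota_uniq//=; last by rewrite mem_index_iota.
rewrite eqxx mulr1 big1_seq ?addr0// => m /andP[/negbTE -> _].
by rewrite mulr0.
Qed.

Lemma nneseries_kappa3 (f : nat -> R) i j k p q r :
  (\sum_(0 <= m <oo) (f m * kappa3 i j k p q r m)%:E = (p * f i + q * f j + r * f k)%:E)%E.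
Proof.
apply/cvg_lim => //.
apply: (@cvg_trans _ (cst (p * f i + q * f j + r * f k)%:E @ \oo)); last exact: cvg_cst.
apply: near_eq_cvg; near=> n; rewrite /= sumEFin; congr EFin.
under eq_bigr do rewrite /kappa3 !mulrDr !(mulrCA (f _)).
rewrite !big_split /= -!mulr_sumr !sum_pointmass//.
- by near: n; exact: nbhs_infty_gt.
- by near: n; exact: nbhs_infty_gt.
- by near: n; exact: nbhs_infty_gt.
Unshelve. all: by end_near. Qed.

Lemma objective_kappa3 i j k p q r : objective (kappa3 i j k p q r) = (p + q + r)%:E.
Proof.
have := nneseries_kappa3 (fun=> 1) i j k p q r; rewrite !mulr1 => <-.
by apply: eq_eseriesr => m _; rewrite mul1r.
Qed.

Lemma feasible_kappa3 a b i j k p q r : 0 <= p -> 0 <= q -> 0 <= r ->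
  1 <= p * a i + q * a j + r * a k -> 1 <= p * b i + q * b j + r * b k ->
  feasible a b (kappa3 i j k p q r).
Proof.
move=> p0 q0 r0 ha hb; split.
- by move=> m; rewrite /kappa3 !addr_ge0// mulr_ge0.
- by rewrite nneseries_kappa3 lee_fin.
- by rewrite nneseries_kappa3 lee_fin.
Qed.

(** Add the two constraints with weights [lam] and [1 - lam]: the left side becomes at most [m]
    times the objective, the right side 1. *)
Lemma weak_duality a b (lam m : R) kappa : (forall k, 0 <= a k) -> (forall k, 0 <= b k) ->
  0 <= lam <= 1 -> 0 < m -> (forall k, lam * a k + (1 - lam) * b k <= m) ->
  feasible a b kappa -> ((m^-1)%:E <= objective kappa)%E.
Proof.
move=> a0 b0 /andP[l0 l1] m0 Hm [k0 fa fb].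
have l1' : 0 <= 1 - lam by rewrite subr_ge0.
have h : (1 <= m%:E * objective kappa)%E.
  rewrite /objective -nneseriesZl; last by move=> n _; rewrite lee_fin.
  apply: (@le_trans _ _ (\sum_(0 <= i <oo)
      (lam%:E * (a i * kappa i)%:E + (1 - lam)%:E * (b i * kappa i)%:E))%E); last first.
    apply: lee_nneseries => k _.
      by move=> _; rewrite -!EFinM -EFinD lee_fin addr_ge0// !mulr_ge0.
    rewrite -!EFinM -EFinD lee_fin !mulrA -mulrDl.
    by rewrite ler_wpM2r.
  rewrite nneseriesD; first last.
  - by move=> n _ _; rewrite -EFinM lee_fin !mulr_ge0.
  - by move=> n _ _; rewrite -EFinM lee_fin !mulr_ge0.
  rewrite !nneseriesZl; try by move=> n _; rewrite lee_fin mulr_ge0.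
  have -> : (1 = lam%:E * 1 + (1 - lam)%:E * 1)%E.
    by rewrite !mule1 -EFinD addrC subrK.
  by apply: leeD; apply: lee_wpmul2l; rewrite ?lee_fin.
rewrite -(@lee_pmul2l _ m%:E)//.
by rewrite -EFinM divff ?gt_eqF.
Qed.

(** The indices are made distinct because the lower tail bound treats [X_i] and [X_j] as
    independent; if the minimax returns one index, [i.+1] is added with weight 0. *)
Lemma lp_duality a b : (forall k, 0 <= a k) -> (forall k, 0 <= b k) ->
  a @ \oo --> (0 : R) -> b @ \oo --> (0 : R) ->
  (exists i, a i <> 0) -> (exists i, b i <> 0) ->
  exists (lam m : R) (i j : nat) (p q : R),
    [/\ 0 <= lam <= 1, 0 < m, forall k, lam * a k + (1 - lam) * b k <= m & i != j] /\
    [/\ 0 <= p, 0 <= q, p + q = m^-1,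
      1 <= p * a i + q * a j & 1 <= p * b i + q * b j].
Proof.
move=> a0 b0 acv bcv [i0 ai] [j0 bj].
have [lam [m [l01 m0 Hm H]]] := minimax a0 b0 acv bcv.
have {ai} ai : 0 < a i0 by rewrite lt0r a0 andbT; exact/eqP.
have {bj} bj : 0 < b j0 by rewrite lt0r b0 andbT; exact/eqP.
have /andP[l0 l1] := l01.
have mgt0 : 0 < m.
  have [lz|lz] := eqVneq lam 0.
    by apply: lt_le_trans (Hm j0); rewrite lz mul0r add0r subr0 mul1r.
  apply: lt_le_trans (Hm i0); rewrite ltr_wpDr ?mulr_ge0 ?subr_ge0//.
  by rewrite mulr_gt0// lt0r lz.
have [i [j [p [q [p0 q0 pq h1 h2]]]]] := H mgt0.
have [ij|ij] := eqVneq i j; last first.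
  by exists lam, m, i, j, p, q.
exists lam, m, i, i.+1, (p + q), 0; split; split => //.
- by rewrite neq_ltn ltnSn.
- exact: addr_ge0.
- by rewrite addr0.
- by rewrite mul0r addr0 mulrDl {2}ij.
- by rewrite mul0r addr0 mulrDl {2}ij.
Qed.

Lemma optimal_kappa2 a b (lam m : R) i j p q : (forall k, 0 <= a k) -> (forall k, 0 <= b k) ->
  0 <= lam <= 1 -> 0 < m -> (forall k, lam * a k + (1 - lam) * b k <= m) ->
  0 <= p -> 0 <= q -> p + q = m^-1 ->
  1 <= p * a i + q * a j -> 1 <= p * b i + q * b j ->
  optimal a b (kappa3 i j i p q 0).
Proof.
move=> a0 b0 l01 m0 Hm p0 q0 pq h1 h2; split.
  by apply: feasible_kappa3 => //; rewrite mul0r addr0.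
move=> kappa' f'; rewrite objective_kappa3 addr0 pq.
exact: weak_duality l01 m0 Hm f'.
Qed.

Lemma objective_optimal a b (lam m : R) i j p q kappa :
  (forall k, 0 <= a k) -> (forall k, 0 <= b k) ->
  0 <= lam <= 1 -> 0 < m -> (forall k, lam * a k + (1 - lam) * b k <= m) ->
  0 <= p -> 0 <= q -> p + q = m^-1 ->
  1 <= p * a i + q * a j -> 1 <= p * b i + q * b j ->
  optimal a b kappa -> objective kappa = (m^-1)%:E.
Proof.
move=> a0 b0 l01 m0 Hm p0 q0 pq h1 h2 [fk ok].
have [fk2 ok2] := optimal_kappa2 a0 b0 l01 m0 Hm p0 q0 pq h1 h2.
apply/eqP; rewrite eq_le (weak_duality a0 b0 l01 m0 Hm fk) andbT.
by have := ok _ fk2; rewrite objective_kappa3 addr0 pq.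
Qed.

Lemma near_le_powR (r s c : R) : s < r -> 0 < c ->
  \forall x \near +oo, x `^ s <= c * x `^ r.
Proof.
move=> sr c0.
have /cvgryPge/(_ c^-1) H := @cvg_powR_pinfty R (r - s) ltac:(by rewrite subr_gt0).
near=> x.
have x0 : 0 < x by near: x; exact: nbhs_pinfty_gt.
have h : c^-1 <= x `^ (r - s) by near: x; exact: H.
have -> : x `^ r = x `^ (r - s) * x `^ s by rewrite -powRDgt0// subrK.
rewrite mulrA ler_peMl ?powR_ge0//.
by rewrite -(@mulfV _ c) ?gt_eqF// ler_pM2l.
Unshelve. all: by end_near. Qed.

Lemma littleo_pinfty (f g : R -> R) : (forall x, 0 <= f x) -> (forall x, 0 <= g x) ->
  (forall e, 0 < e -> \forall x \near +oo, f x <= e * g x) ->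
  f =o_ (pinfty_nbhs R) g.
Proof.
move=> f0 g0 H; apply/eqoP => e e0; apply: filterS (H e e0) => x.
by rewrite !ger0_norm.
Qed.

End LinearProgramSolutions.

(** * Logarithmic asymptotics *)

Section LogarithmicAsymptotics.
Context {R : realType} {d : measure_display} {T : measurableType d}.
Variables (P : probability T R) (X : nat -> {RV P >-> R}).
Hypothesis X_ge0 : forall i t, 0 <= X i t.
Hypothesis X_indep : mutually_independent X.
Hypothesis X_ident : identically_distributed X.
Hypothesis X_regvar : forall i, regularly_varying_m1 (X i).
Variables (a b : nat -> R) (Sa Sb : R).
Hypothesis a0 : forall m, 0 <= a m.
Hypothesis b0 : forall m, 0 <= b m.
Hypothesis sum_a : forall n, \sum_(0 <= m < n) a m <= Sa.
Hypothesis sum_b : forall n, \sum_(0 <= m < n) b m <= Sb.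
Hypothesis uba : {ae P, forall t, upbounded a (X^~ t)}.
Hypothesis ubb : {ae P, forall t, upbounded b (X^~ t)}.

Local Notation Y0 := (fun t => pprodoo xpredT a (X^~ t)).
Local Notation Y1 := (fun t => pprodoo xpredT b (X^~ t)).
Local Notation tl := (tail X).

Lemma measurable_gt2 (f g : T -> R) u v : measurable_fun setT f -> measurable_fun setT g ->
  measurable [set t | f t > u /\ g t > v].
Proof.
move=> mf mg; rewrite (_ : [set t | _] = [set t | f t > u] `&` [set t | g t > v])//.
apply: measurableI.
  rewrite (_ : [set t | _] = f @^-1` `]u, +oo[%classic).
    by rewrite -[X in measurable X]setTI; exact: mf.
  by apply/seteqP; split => t /=; rewrite in_itv /= andbT.
rewrite (_ : [set t | _] = g @^-1` `]v, +oo[%classic).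
  by rewrite -[X in measurable X]setTI; exact: mg.
by apply/seteqP; split => t /=; rewrite in_itv /= andbT.
Qed.

Lemma markov_bound (f : T -> \bar R) (A : set T) (c : R) : measurable A -> 0 <= c ->
  measurable_fun setT f -> (forall t, 0 <= f t)%E ->
  {ae P, forall t, A t -> (c%:E <= f t)%E} -> (c%:E * P A <= \int[P]_t f t)%E.
Proof.
move=> mA c0 mf f0 Af.
rewrite -[X in P X]setIT -integral_indic// -ge0_integralZl//; first last.
- by apply/measurable_EFinP; exact: measurable_indic.
apply: ae_ge0_le_integral => //.
- by move=> t _; rewrite -EFinM lee_fin mulr_ge0.
- apply: emeasurable_funM; first exact: measurable_cst.
  by apply/measurable_EFinP; exact: measurable_indic.
apply: filterS Af => t h _; rewrite indicE.
have [tA|tA] := boolP (t \in A); last by rewrite mule0.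
by rewrite mule1; apply: h; exact: set_mem.
Qed.

Lemma joint_tail_upper (lam m th : R) : 0 <= lam <= 1 -> 0 < m ->
  (forall k, lam * a k + (1 - lam) * b k <= m) -> 0 < th < 1 ->
  exists C, 0 < C /\ forall x, 0 < x ->
    prob P [set t | Y0 t > x /\ Y1 t > x] <= C * x `^ (- (th / m)).
Proof.
move=> /andP[l0 l1] m0 Hm th01; have /andP[th0 th1] := th01.
(* Then [c1 + c2 = th / m] is the decay rate, while [g k = (th / m) (lam a_k + (1 - lam) b_k) <= th
   < 1] keeps the expectation finite. *)
pose c1 := th / m * lam; pose c2 := th / m * (1 - lam).
have thm : 0 < th / m by rewrite divr_gt0.
have c10 : 0 <= c1 by rewrite mulr_ge0// ltW.
have c20 : 0 <= c2 by rewrite mulr_ge0 ?subr_ge0// ltW.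
pose g k := c1 * a k + c2 * b k.
have g0 k : 0 <= g k by rewrite addr_ge0// mulr_ge0.
have gth k : 0 <= g k <= th.
  have E : g k = th / m * (lam * a k + (1 - lam) * b k) by rewrite /g /c1 /c2; ring.
  by rewrite g0 /= E mulrAC ler_pdivrMr// ler_pM2l.
have sg n : \sum_(0 <= k < n) g k <= c1 * Sa + c2 * Sb.
  by rewrite big_split /= -!mulr_sumr lerD// ler_wpM2l.
have ig := integrable_upprodoo X_ge0 X_indep X_ident X_regvar th01 gth sg.
pose I := (\int[P]_t upprodoo X g t)%E.
have up0 t : (0 <= upprodoo X g t)%E.
  apply: le_trans (upprod_le_oo X t 0 g0); rewrite lee_fin (le_trans ler01)//.
  exact: upprod_ge1.
have I0 : (0 <= I)%E by exact: integral_ge0.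
have Ifin : I \is a fin_num.
  rewrite ge0_fin_numE//; have /integrableP[_] := ig.
  by apply: le_lt_trans; apply: ge0_le_integral => //;
    [exact: measurable_upprodoo|apply: measurableT_comp => //; exact: measurable_upprodoo|
     move=> t _; rewrite gee0_abs].
exists (fine I + 1); split; first by rewrite ltr_wpDl// fine_ge0.
move=> x x0.
set B := [set t | Y0 t > x /\ Y1 t > x].
have mA : measurable B by apply: measurable_gt2; exact: measurable_pprodoo.
have xthm : 0 < x `^ (th / m) by rewrite powR_gt0.
have : ((x `^ (th / m))%:E * P B <= I)%E.
  apply: markov_bound => //; [exact: ltW|exact: measurable_upprodoo|].
  apply: filterS2 uba ubb => t ua ub [h1 h2].
  have Xt0 k : 0 <= X k t by exact: X_ge0.
  have := pprodoo_comb xpredT a0 b0 Xt0 c10 c20 ua ub => E.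
  apply: (@le_trans _ _ (pprodoo xpredT g (X^~ t))%:E).
    rewrite lee_fin [leRHS]E.
    have -> : x `^ (th / m) = x `^ c1 * x `^ c2.
      by rewrite -powRDge0// /c1 /c2 -mulrDr addrC subrK mulr1.
    by apply: ler_pM; rewrite ?powR_ge0//; apply: le_powR => //; exact: ltW.
  have [M uM] : upbounded g (X^~ t) by exact: upbounded_comb.
  have cup : cvgn (upprod g (X^~ t)).
    apply: nondecreasing_is_cvgn; first exact: upprod_nd.
    by exists M => _ [n _ <-].
  have -> : upprodoo X g t = (limn (upprod g (X^~ t)))%:E.
    by apply/cvg_lim => //; apply: cvg_EFin => //; exact: nearW.
  rewrite lee_fin; apply: pprodoo_le_upprod => // n.
  apply: nondecreasing_cvgn_le => //; exact: upprod_nd.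
rewrite -(probK P mA) -(fineK Ifin) -EFinM lee_fin => h.
rewrite powRN ler_pdivlMr// mulrC; apply: (le_trans h).
by rewrite lerDl.
Qed.

(** The case [p = 0] belongs to a factor that is not large: its threshold [K] is constant and costs
    only the constant [tl K]. *)
Lemma tail_lower_scaled (p K dl : R) : 0 <= p -> 0 < K -> 0 < dl < 1 ->
  exists c, 0 < c /\ \forall x \near +oo, c * x `^ (- (p * (1 + dl))) <= tl (K * x `^ p).
Proof.
move=> p0 K0 dl01.
have := tail_lower (tail_gt0 X_regvar) (tail_le1 X_ident) (tail_ni X_ident) (tail_rv X_regvar) dl01.
move=> [c [y0 [c0 y00 H]]].
have [->|pN0] := eqVneq p 0.
  exists (tl K); split; first exact: tail_gt0.
  by apply: nearW => x; rewrite mul0r oppr0 !powRr0 !mulr1.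
have pgt0 : 0 < p by rewrite lt0r pN0.
exists (c * K `^ (- 1 - dl)); split; first by rewrite mulr_gt0// powR_gt0.
have /cvgryPge/(_ (y0 / K)) E := @cvg_powR_pinfty R p pgt0.
near=> x.
have hy : y0 <= K * x `^ p.
  by rewrite mulrC -ler_pdivrMr//; near: x; exact: E.
apply: le_trans (H _ hy); rewrite powRM ?powR_ge0// ?(ltW K0)// -powRrM.
by rewrite -mulrA (_ : p * (-1 - dl) = - (p * (1 + dl)))//; ring.
Unshelve. all: by end_near. Qed.

Lemma joint_tail_lower (i j : nat) (p q dl : R) :
  i != j -> 0 <= p -> 0 <= q -> 1 <= p * a i + q * a j -> 1 <= p * b i + q * b j ->
  0 < dl < 1 ->
  (forall A : pred nat,
    0 < prob P [set t | 0 < pprodoo A a (X^~ t) /\ 0 < pprodoo A b (X^~ t)]) ->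
  exists c, 0 < c /\ \forall x \near +oo,
    c * x `^ (- ((p + q) * (1 + dl))) <= prob P [set t | Y0 t > x /\ Y1 t > x].
Proof.
move=> ij p0 q0 ha hb dl01 Hpos.
pose A : pred nat := fun m => (m != i) && (m != j).
pose U t := pprodoo A a (X^~ t); pose V t := pprodoo A b (X^~ t).
have Ai : ~~ A i by rewrite /A eqxx.
have Aj : ~~ A j by rewrite /A eqxx andbF.
have mUi := @measurable_pprodoo_off _ _ _ P X i A a Ai.
have mVi := @measurable_pprodoo_off _ _ _ P X i A b Ai.
have mUj := @measurable_pprodoo_off _ _ _ P X j A a Aj.
have mVj := @measurable_pprodoo_off _ _ _ P X j A b Aj.
have mU := @measurable_pprodoo _ _ _ P X A a.
have mV := @measurable_pprodoo _ _ _ P X A b.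
(* These events exhaust the one where [U] and [V] are both positive, so one of them has positive
   probability; this provides the lower bound [c] of the other factors. *)
pose G (n : nat) := [set t | U t > n.+1%:R^-1 /\ V t > n.+1%:R^-1].
have [n hn] : exists n : nat, (0 < P (G n))%E.
  apply: bigcup_prob_gt0.
    by move=> n; exact: measurable_gt2.
  have := Hpos A; rewrite -lte_fin probK; last exact: measurable_gt2.
  rewrite (_ : \bigcup_n G n = [set t | 0 < U t /\ 0 < V t])//.
  apply/seteqP; split => [t [n _ [h1 h2]]|t [h1 h2]].
    have h : 0 < n.+1%:R^-1 :> R by [].
    by split; exact: lt_trans h _.
  have [n1 hn1] : exists n : nat, n.+1%:R^-1 < Num.min (U t) (V t).
    have h : 0 < Num.min (U t) (V t) by rewrite lt_min h1 h2.
    by have [n] := ltr_add_invr h; rewrite add0r => ?; exists n.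
  by exists n1 => //; move: hn1; rewrite lt_min => /andP[].
pose c : R := n.+1%:R^-1; rewrite /G -/c in hn.
have c0 : 0 < c by rewrite invr_gt0.
have posab (e : nat -> R) : (forall m, 0 <= e m) -> 1 <= p * e i + q * e j -> 0 < e i + e j.
  move=> e0 he; rewrite lt0r addr_ge0// andbT; apply/negP => /eqP ee.
  have ei : e i = 0 by have := e0 i; have := e0 j; lra.
  have ej : e j = 0 by have := e0 i; have := e0 j; lra.
  by move: he; rewrite ei ej !mulr0 addr0 ler10.
have sa := posab a a0 ha; have sb := posab b b0 hb.
(* Large enough that [K^(a_i + a_j) c >= 1] and [K^(b_i + b_j) c >= 1]: raising both thresholds by
   [K] compensates the factor [c]. *)
pose K := 1 + c^-1 `^ (a i + a j)^-1 + c^-1 `^ (b i + b j)^-1.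
have K0 : 0 < K by rewrite /K -addrA ltr_pwDl// addr_ge0// powR_ge0.
have Ke (e : nat -> R) : 0 < e i + e j -> c^-1 `^ (e i + e j)^-1 <= K ->
    1 <= K `^ (e i + e j) * c.
  move=> se h; rewrite -ler_pdivrMr// mul1r -[leLHS](@powRVK _ _ (e i + e j)) ?gt_eqF//; last first.
    by rewrite invr_ge0 ltW.
  by apply: le_powR => //; [exact: ltW|exact: powR_ge0].
have Ka : 1 <= K `^ (a i + a j) * c.
  by apply: Ke => //; rewrite /K addrAC lerDr addr_ge0// powR_ge0.
have Kb : 1 <= K `^ (b i + b j) * c.
  by apply: Ke => //; rewrite /K lerDr addr_ge0// powR_ge0.
have [ci [ci0 Hi]] := tail_lower_scaled p0 K0 dl01.
have [cj [cj0 Hj]] := tail_lower_scaled q0 K0 dl01.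
pose w := fine (P [set t | U t > c /\ V t > c]).
have mUV : measurable [set t | U t > c /\ V t > c] by exact: measurable_gt2.
have wE : P [set t | U t > c /\ V t > c] = w%:E by rewrite /w fineK// fin_num_measure.
have w0 : 0 < w by rewrite -lte_fin /w fineK// fin_num_measure.
exists (ci * cj * w); split; first by rewrite !mulr_gt0.
near=> x.
have x1 : 1 <= x by near: x; exact: nbhs_pinfty_ge.
have x0 : 0 < x by exact: lt_le_trans x1.
have Hxi : ci * x `^ (- (p * (1 + dl))) <= tl (K * x `^ p) by near: x; exact: Hi.
have Hxj : cj * x `^ (- (q * (1 + dl))) <= tl (K * x `^ q) by near: x; exact: Hj.
pose E := [set t | X i t > K * x `^ p] `&` ([set t | X j t > K * x `^ q] `&`
  [set t | U t > c /\ V t > c]).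
have mX k y : measurable [set t | X k t > y].
  by rewrite gt_preimage -[X in measurable X]setTI; exact: measurable_funP.
have PE : P E = (tl (K * x `^ p) * (tl (K * x `^ q) * w))%:E.
  rewrite /E gt_preimage (indep_off X_indep)//; last first.
    apply: (@measurableI _ (off X i)).
      rewrite gt_preimage; have := @measurable_off _ _ _ P X i j.
      rewrite eq_sym => /(_ ij measurableT `]K * x `^ q, +oo[%classic (measurable_itv _)).
      by rewrite setTI.
    rewrite (_ : [set t | _] = U @^-1` `]c, +oo[ `&` V @^-1` `]c, +oo[).
      apply: (@measurableI _ (off X i)).
        by have := mUi measurableT `]c, +oo[%classic (measurable_itv _); rewrite setTI.
      by have := mVi measurableT `]c, +oo[%classic (measurable_itv _); rewrite setTI.
    by apply/seteqP; split => t /=; rewrite !in_itv /= !andbT.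
  rewrite [in X in (_ * P X)%E]gt_preimage (indep_off X_indep)//; last first.
    rewrite (_ : [set t | _] = U @^-1` `]c, +oo[ `&` V @^-1` `]c, +oo[).
      apply: (@measurableI _ (off X j)).
        by have := mUj measurableT `]c, +oo[%classic (measurable_itv _); rewrite setTI.
      by have := mVj measurableT `]c, +oo[%classic (measurable_itv _); rewrite setTI.
    by apply/seteqP; split => t /=; rewrite !in_itv /= !andbT.
  rewrite -!gt_preimage !(P_gt X_ident).
  by rewrite wE -!EFinM.
have mE : measurable E by apply: measurableI => //; exact: measurableI.
have mA : measurable [set t | Y0 t > x /\ Y1 t > x].
  by apply: measurable_gt2; exact: measurable_pprodoo.
apply: (@le_trans _ _ (prob P E)).
  rewrite /prob PE /=.
  have -> : x `^ (- ((p + q) * (1 + dl))) = x `^ (- (p * (1 + dl))) * x `^ (- (q * (1 + dl))).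
    by rewrite -powRDgt0//; congr (_ `^ _); ring.
  rewrite (_ : _ * _ * _ * _ = (ci * x `^ (- (p * (1 + dl)))) * ((cj * x `^ (- (q * (1 + dl)))) * w)); last by ring.
  apply: ler_pM => //.
  - by rewrite mulr_ge0 ?powR_ge0// ltW.
  - by rewrite !mulr_ge0 ?powR_ge0// ltW.
  - by rewrite ler_wpM2r// ltW.
apply: prob_le => //; apply: filterS2 uba ubb => t ua ub [h1 [h2 [h3 h4]]].
have Xt0 k : 0 <= X k t by exact: X_ge0.
have key (e : nat -> R) : (forall m, 0 <= e m) -> upbounded e (X^~ t) ->
    1 <= p * e i + q * e j -> 1 <= K `^ (e i + e j) * c -> c < pprodoo A e (X^~ t) ->
    x < pprodoo xpredT e (X^~ t).
  move=> e0 ue he Ke' hc.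
  rewrite (pprodoo_D1 (i := i))// (pprodoo_D1 (i := j))//=; last by rewrite eq_sym.
  have c' := lt_trans c0 hc.
  rewrite mulrA; apply: (@le_lt_trans _ _ ((K * x `^ p) `^ e i * (K * x `^ q) `^ e j * c)).
    rewrite !powRM ?powR_ge0 ?(ltW K0)// mulrACA -powRDge0//.
    rewrite -!powRrM -powRDge0 ?mulr_ge0// mulrAC.
    apply: (@le_trans _ _ (x `^ (p * e i + q * e j))).
      rewrite -[leLHS]powRr1 ?(ltW x0)//; exact: ler_powR.
    by rewrite ler_peMl// powR_ge0.
  apply: (@le_lt_trans _ _ (X i t `^ e i * X j t `^ e j * c)).
    rewrite ler_pM2r//; apply: ler_pM; rewrite ?powR_ge0//; apply: le_powR => //.
    - by rewrite mulr_ge0 ?powR_ge0// ltW.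
    - exact: ltW.
    - by rewrite mulr_ge0 ?powR_ge0// ltW.
    - exact: ltW.
  rewrite ltr_pM2l; last first.
    by rewrite mulr_gt0// powR_gt0//; [apply: le_lt_trans h1|apply: le_lt_trans h2];
      rewrite mulr_ge0 ?powR_ge0// ltW.
  by [].
by split; exact: key.
Unshelve. all: by end_near. Qed.

Lemma joint_tail_littleo (lam m : R) i j p q : 0 <= lam <= 1 -> 0 < m ->
  (forall k, lam * a k + (1 - lam) * b k <= m) ->
  i != j -> 0 <= p -> 0 <= q -> p + q = m^-1 ->
  1 <= p * a i + q * a j -> 1 <= p * b i + q * b j ->
  (forall A : pred nat,
    0 < prob P [set t | 0 < pprodoo A a (X^~ t) /\ 0 < pprodoo A b (X^~ t)]) ->
  forall eps : R, 0 < eps ->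
   ((fun x : R => prob P [set t | Y0 t > x /\ Y1 t > x])
      =o_ (pinfty_nbhs R) (fun x : R => x `^ (eps - m^-1))) /\
   ((fun x : R => x `^ (- eps - m^-1))
      =o_ (pinfty_nbhs R) (fun x : R => prob P [set t | Y0 t > x /\ Y1 t > x])).
Proof.
move=> l01 m0 Hm ij p0 q0 pq ha hb Hpos eps eps0.
have mV0 : 0 < m^-1 by rewrite invr_gt0.
(* In both bounds the exponent is off by [dl / m], here at most [eps / 2], which leaves a strict gap
   for the little-o. *)
pose dl := Num.min 2^-1 (eps / (2 * m^-1)).
have dl0 : 0 < dl by rewrite lt_min invr_gt0 ltr0n divr_gt0// mulr_gt0.
have dl2 : dl <= 2^-1 by rewrite ge_min lexx.
have dl1 : dl < 1 by lra.
have dle : dl * m^-1 <= eps / 2.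
  apply: (@le_trans _ _ (eps / (2 * m^-1) * m^-1)).
    by rewrite ler_pM2r// ge_min lexx orbT.
  by rewrite le_eqVlt; apply/orP; left; apply/eqP; field; rewrite gt_eqF.
have dl01 : 0 < dl < 1 by rewrite dl0.
have dm0 : 0 < dl * m^-1 by rewrite mulr_gt0.
split.
- apply: littleo_pinfty => [x|x|]; [exact: prob_ge0|exact: powR_ge0|].
  have [|C [C0 H]] := @joint_tail_upper lam m (1 - dl) l01 m0 Hm; first by apply/andP; split; lra.
  move=> e e0.
  have := @near_le_powR _ (eps - m^-1) (- ((1 - dl) / m)) (e / C).
  rewrite mulrBl mul1r divr_gt0// => /(_ ltac:(lra) isT) N.
  near=> x; have x0 : 0 < x by near: x; exact: nbhs_pinfty_gt.
  apply: (le_trans (H _ x0)); rewrite mulrBl mul1r.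
  rewrite mulrC -ler_pdivlMr// mulrAC.
  by near: x; exact: N.
- apply: littleo_pinfty => [x|x|e e0]; [exact: powR_ge0|exact: prob_ge0|].
  have [c [c0 H]] := joint_tail_lower ij p0 q0 ha hb dl01 Hpos.
  have := @near_le_powR _ (- (m^-1 * (1 + dl))) (- eps - m^-1) (e * c).
  rewrite mulrDr mulr1 [m^-1 * dl]mulrC mulr_gt0// => /(_ ltac:(lra) isT) N.
  near=> x.
  apply: (@le_trans _ _ (e * (c * x `^ (- (m^-1 * (1 + dl)))))).
    rewrite mulrA mulrDr mulr1 [m^-1 * dl]mulrC.
    by near: x; exact: N.
  by rewrite ler_pM2l// -pq; near: x; exact: H.
Unshelve. all: by end_near. Qed.

End LogarithmicAsymptotics.

(** * One large factor *)

Section Breiman.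
Context {R : realType} {d : measure_display} {T : measurableType d}.
Variables (P : probability T R) (X : nat -> {RV P >-> R}).
Hypothesis X_ge0 : forall i t, 0 <= X i t.
Hypothesis X_indep : mutually_independent X.
Hypothesis X_ident : identically_distributed X.
Hypothesis X_regvar : forall i, regularly_varying_m1 (X i).
Local Notation tl := (tail X).

Lemma measurable_tail : measurable_fun setT tl.
Proof.
have -> : tl = fine \o ccdf (X 0).
  by apply/funext => x; rewrite /tail /prob /= /ccdf /distribution /pushforward gt_preimage.
by apply: measurableT_comp => //; exact: ccdf_measurable.
Qed.

(** The probability that [X_i * M > y] for a constant [M >= 0] and [y > 0]. The test is needed
    because [y / 0 = 0] would give [tl 0] instead of 0. *)
Definition scaled_tail (y M : R) : R := if 0 < M then tl (y / M) else 0.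

Lemma measurable_scaled_tail y : measurable_fun setT (scaled_tail y).
Proof.
have -> : scaled_tail y = (fun M => if 0 < M then tl (y * M `^ (-1)) else 0).
  by apply/funext => M; rewrite /scaled_tail; case: ltP => // M0; rewrite powR_inv1// ltW.
apply: measurable_fun_ifT.
- by apply: measurable_fun_ltr; [exact: measurable_cst|exact: measurable_id].
- by apply: (measurableT_comp measurable_tail); apply: measurable_funM.
- exact: measurable_cst.
Qed.

Lemma scaled_tail_ge0 y M : 0 <= scaled_tail y M.
Proof. by rewrite /scaled_tail; case: ifPn => // _; rewrite ltW// (tail_gt0 X_regvar). Qed.

Lemma P_mul_gt i y M : 0 <= M -> 0 < y ->
  P [set s | X i s * M > y] = (scaled_tail y M)%:E.
Proof.
move=> M0 y0; rewrite /scaled_tail; case: ifPn => [Mgt0|].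
  rewrite -(P_gt X_ident i); congr (P _); apply/seteqP; split => t /=.
    by rewrite ltr_pdivrMr.
  by rewrite ltr_pdivrMr.
rewrite -leNgt => M0'; have -> : M = 0 by apply/eqP; rewrite eq_le M0 M0'.
rewrite (_ : [set s | _] = set0) ?measure0//.
by apply/seteqP; split => t //=; rewrite mulr0 ltNge ltW.
Qed.

(** Conditioning on [N], which depends on the variables other than [X i] only. *)
Lemma prob_mul_off i (N : T -> R) y : 0 < y -> (forall t, 0 <= N t) ->
  measurable_fun [set: off X i] (N : off X i -> R) ->
  P [set t | X i t * N t > y] = (\int[P]_t (scaled_tail y (N t))%:E)%E.
Proof.
move=> y0 N0 mN.
have mN' := off_measurable_fun mN.
pose B := [set z : R * R | z.1 * z.2 > y].
have mB : measurable B.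
  rewrite (_ : B = (fun z : R * R => z.1 * z.2) @^-1` `]y, +oo[%classic).
    rewrite -[X in measurable X]setTI; apply: measurable_funM => //.
  by apply/seteqP; split => t /=; rewrite in_itv /= andbT.
have mA : measurable [set t | X i t * N t > y].
  rewrite (_ : [set t | _] = (fun t => X i t * N t) @^-1` `]y, +oo[%classic).
    by rewrite -[X in measurable X]setTI; apply: measurable_funM => //.
  by apply/seteqP; split => t /=; rewrite in_itv /= andbT.
rewrite -[X in P X]setIT -integral_indic//.
transitivity (\int[P]_t (\1_B (X i t, N t))%:E)%E.
  by apply: eq_integral => t _; congr EFin; rewrite !indicE; congr (_ %:R); congr nat_of_bool;
    apply/idP/idP => /set_mem h; exact/mem_set.
rewrite (integral_off X_indep (f := fun z => (\1_B z)%:E) mN)//; last first.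
  by apply/measurable_EFinP; exact: measurable_indic.
apply: eq_integral => t _; rewrite -(P_mul_gt i)// -[X in P X]setIT -integral_indic//.
  rewrite (_ : [set t | _] = (fun s => X i s * N t) @^-1` `]y, +oo[%classic).
    by rewrite -[X in measurable X]setTI; apply: measurable_funM.
  by apply/seteqP; split => s /=; rewrite in_itv /= andbT.
Qed.

(** The two powers serve [M >= 1] and [M <= 1]. Unlike the coarser [scaled_tail_bound], this bound
    vanishes at [M = 0]; that is essential when [M] is itself integrated over a half-line. *)
Lemma scaled_tail_potter (eta : R) : 0 < eta < 1 -> exists C y0 : R, [/\ 0 < C, 0 < y0 &
  forall y M, y0 <= y -> 0 <= M ->
    scaled_tail y M / tl y <= C * (M `^ (1 + eta) + M `^ (1 - eta))].
Proof.
move=> eta01; have /andP[eta0 eta1] := eta01.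
have [C [y0 [C1 y00 H1 H2]]] := potter (tail_gt0 X_regvar) (tail_le1 X_ident)
  (tail_ni X_ident) (tail_rv X_regvar) eta01.
have C0 : 0 < C by exact: lt_le_trans C1.
exists C, y0; split => // y M hy M0.
have p1 e : 0 <= M `^ e by exact: powR_ge0.
rewrite /scaled_tail; case: ifPn => [Mgt0|_]; last first.
  by rewrite mul0r mulr_ge0// ?(ltW C0)// addr_ge0.
have tly := tail_gt0 X_regvar y.
rewrite ler_pdivrMr//.
have MV0 : 0 < M^-1 by rewrite invr_gt0.
have [M1|M1] := leP M^-1 1.
  apply: (le_trans (H2 y M^-1 hy _)); first by rewrite MV0.
  rewrite ler_pM2r// ler_pM2l// (powRV _ M0) opprB opprK.
  by rewrite [eta + 1]addrC lerDl.
apply: (le_trans (H1 y M^-1 hy (ltW M1))).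
rewrite ler_pM2r// ler_pM2l// (powRV _ M0) opprD opprK.
by rewrite lerDr.
Qed.

Lemma scaled_tail_bound (eta : R) : 0 < eta < 1 -> exists C y0 : R, [/\ 0 < C, 0 < y0 &
  forall y M, y0 <= y -> 0 <= M -> scaled_tail y M / tl y <= C * (1 + M `^ (1 + eta))].
Proof.
move=> eta01; have /andP[eta0 eta1] := eta01.
have [C [y0 [C0 y00 H]]] := scaled_tail_potter eta01.
exists (C * 2), y0; split => //; first by rewrite mulr_gt0.
move=> y M hy M0; apply: (le_trans (H y M hy M0)); rewrite -mulrA ler_pM2l//.
have p1 : 0 <= M `^ (1 + eta) by exact: powR_ge0.
suff : M `^ (1 - eta) <= 1 + M `^ (1 + eta) by lra.
have [M1|M1] := leP M 1.
  apply: (@le_trans _ _ 1); last by rewrite lerDl.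
  by apply: powR_le1; rewrite ?M0// subr_ge0 ltW.
apply: (@le_trans _ _ (M `^ (1 + eta))); last by rewrite lerDr.
by apply: ler_powR; [exact: ltW|lra].
Qed.

(** The multiplier [N x] may depend on [x]: when one of the two constraints becomes slack in the
    limit, it still shows in the multiplier for finite [x]. It is enough that [N x] is eventually
    equal to [M] along each path and dominated by one [L] with a moment of order above 1. *)
Lemma breiman i (M L : T -> R) (N : R -> T -> R) (y : R -> R) (eta : R) :
  (forall x, measurable_fun [set: off X i] (N x : off X i -> R)) ->
  (forall x t, 0 <= N x t) -> (forall t, 0 <= M t) ->
  measurable_fun setT M -> measurable_fun setT L ->
  y x @[x --> +oo] --> +oo ->
  {ae P, forall t, \forall x \near +oo, N x t = M t} ->
  {ae P, forall t, forall x, N x t <= L t} ->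
  0 < eta < 1 -> (\int[P]_t (L t `^ (1 + eta))%:E < +oo)%E ->
  ('E_P[M])%E \is a fin_num /\
  prob P [set t | X i t * N x t > y x] / tl (y x) @[x --> +oo] --> fine 'E_P[M]%E.
Proof.
move=> mN N0 M0 mM mL yoo NM NL eta01 IL.
have /andP[eta0 eta1] := eta01.
have [C [y0 [C0 y00 H]]] := scaled_tail_bound eta01.
pose g t := (C * (1 + L t `^ (1 + eta)))%:E.
have mLp : measurable_fun setT (fun t => L t `^ (1 + eta)).
  exact: (measurableT_comp (measurable_powR _)).
have ig : P.-integrable setT g.
  apply/integrableP; split.
    by apply/measurable_EFinP; apply: measurable_funM => //; apply: measurable_funD.
  rewrite (_ : \int[P]_x `|g x| = \int[P]_t (C%:E * (1 + (L t `^ (1 + eta))%:E)))%E; last first.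
    apply: eq_integral => t _; rewrite /g gee0_abs ?EFinM ?EFinD//.
    by rewrite lee_fin mulr_ge0 ?(ltW C0)// addr_ge0// powR_ge0.
  rewrite ge0_integralZl//; first last.
  - by rewrite lee_fin ltW.
  - by move=> t _; rewrite -EFinD lee_fin addr_ge0// powR_ge0.
  - by apply: emeasurable_funD; [exact: measurable_cst|exact/measurable_EFinP].
  rewrite ge0_integralD//; first last.
  - exact/measurable_EFinP.
  - by move=> t _; rewrite lee_fin powR_ge0.
  rewrite integral_cst//= probability_setT mule1.
  apply: lte_mul_pinfty; rewrite ?lee_fin ?(ltW C0)//.
  by apply: lte_add_pinfty => //; exact: ltry.
have mN' x := off_measurable_fun (mN x).
have main (u : nat -> R) : u n @[n --> \oo] --> +oo ->
    P.-integrable setT (EFin \o M) /\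
    prob P [set t | X i t * N (u n) t > y (u n)] / tl (y (u n)) @[n --> \oo] -->
      fine (\int[P]_t (M t)%:E)%E.
  move=> uoo.
  have yu : y (u n) @[n --> \oo] --> +oo by exact: (cvg_comp u y uoo yoo).
  (* Dominated convergence wants the bound for every [n], Potter's bound holds from [y0] on; the
     finitely many other terms are replaced by 0. *)
  pose ok n := y0 <= y (u n).
  pose f n t := (if ok n then scaled_tail (y (u n)) (N (u n) t) / tl (y (u n)) else 0)%:E.
  have okn : \forall n \near \oo, ok n by move/cvgryPge: yu; exact.
  have [|||||iM _ cM] := @dominated_convergence _ T R P setT measurableT f (EFin \o M) g.
  - move=> n; apply/measurable_EFinP; case: (ok n); last exact: measurable_cst.
    apply: measurable_funM => //.
    exact: (measurableT_comp (measurable_scaled_tail _)).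
  - exact/measurable_EFinP.
  - apply: filterS NM => t Nt _; apply: cvg_EFin; first exact: nearW.
    have Nu : \forall n \near \oo, N (u n) t = M t by exact: uoo Nt.
    have lim : scaled_tail (y (u n)) (M t) / tl (y (u n)) @[n --> \oo] --> M t.
      have [Mt0|] := ltP 0 (M t); last first.
        move=> Mt0; have -> : M t = 0 by apply/eqP; rewrite eq_le Mt0 M0.
        by under eq_cvg do rewrite /scaled_tail ltxx mul0r; exact: cvg_cst.
      under eq_cvg do rewrite /scaled_tail Mt0 [_ / M t]mulrC.
      have := tail_rv X_regvar (s := (M t)^-1); rewrite invrK invr_gt0 => /(_ Mt0) h.
      exact: (cvg_comp _ _ yu h).
    move: lim; apply: cvg_trans; apply: near_eq_cvg; near=> n.
    have hN : N (u n) t = M t by near: n; exact: Nu.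
    have ho : ok n by near: n; exact: okn.
    by rewrite /= /f ho hN.
  - exact: ig.
  - apply: filterS NL => t Nt n _.
    rewrite /f /g; case: ifPn => [ho|_]; last first.
      by rewrite abse0 lee_fin mulr_ge0 ?(ltW C0)// addr_ge0// powR_ge0.
    rewrite gee0_abs; last by rewrite lee_fin divr_ge0 ?scaled_tail_ge0// ltW// (tail_gt0 X_regvar).
    rewrite lee_fin; apply: (le_trans (H _ _ ho (N0 _ _))).
    rewrite ler_pM2l// lerD2l; apply: le_powR => //.
    by rewrite addr_ge0// ltW.
  split => //.
  have fM : (\int[P]_t (M t)%:E)%E \is a fin_num by exact: integrable_fin_num iM.
  have : (\int[P]_t f n t @[n --> \oo] --> (fine (\int[P]_t (M t)%:E))%:E)%E.
    by rewrite fineK.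
  move=> /fine_cvgP[_]; apply: cvg_trans; apply: near_eq_cvg; near=> n.
  have ho : ok n by near: n; exact: okn.
  have yn0 : 0 < y (u n) by exact: lt_le_trans ho.
  rewrite /= /prob (prob_mul_off yn0 (N0 _) (mN _)) /f.
  have tly := tail_gt0 X_regvar (y (u n)).
  under eq_integral do rewrite ho mulrC EFinM.
  rewrite ge0_integralZl//; first last.
  - by rewrite lee_fin invr_ge0 ltW.
  - by move=> t _; rewrite lee_fin scaled_tail_ge0.
  - by apply/measurable_EFinP; exact: (measurableT_comp (measurable_scaled_tail _)).
  rewrite fineM//.
    by rewrite mulrC.
  rewrite -(prob_mul_off yn0 (N0 _) (mN _)) fin_num_measure//.
  rewrite (_ : [set t | _] = (fun t => X i t * N (u n) t) @^-1` `]y (u n), +oo[%classic).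
    by rewrite -[X in measurable X]setTI; apply: measurable_funM => //.
  by apply/seteqP; split => t /=; rewrite in_itv /= andbT.
rewrite unlock; split.
  have [iM _] := main (fun n => n%:R) ltac:(by apply/cvgryPge => A; exact: nbhs_infty_ger).
  exact: integrable_fin_num iM.
by apply/cvg_pinftyP => u uoo; have [_] := main u uoo.
Unshelve. all: by end_near. Qed.

End Breiman.

Lemma ltr_powR2 {R : realType} (r p q : R) : 0 < r -> 0 <= p -> 0 <= q ->
  (p `^ r < q `^ r) = (p < q).
Proof.
move=> r0 p0 q0; apply/idP/idP; last exact: lt_powR.
by apply: contraTT; rewrite -!leNgt; apply: le_powR => //; exact: ltW.
Qed.

(** By [0^0 = 1] an omitted factor is one with exponent 0, so moment bounds for full products apply
    to subproducts. *)
Lemma pprodoo_restrict {R : realType} (A : pred nat) (a x : nat -> R) :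
  pprodoo A a x = pprodoo xpredT (fun m => if A m then a m else 0) x.
Proof.
congr (limn _); apply/funext => n; rewrite /pprod big_mkcond.
by apply: eq_bigr => m _; case: ifP => // _; rewrite powRr0.
Qed.

(** If the large factor has exponent [e] and the others have at most [m], the moment of order
    [1 + eta] of their [1 / e]-th powers involves exponents up to [(1 + eta) m / e]. Raising [m] to
    at least [e / 2] makes [k] at most 2 and hence [eta < 1]; then [th] is [(1 + eta) / k]. *)
Lemma exponent_margin {R : realType} (m e : R) : 0 < e -> m < e ->
  exists eta th : R, [/\ 0 < eta < 1, 0 < th < 1 & (1 + eta) / e * m <= th].
Proof.
move=> e0 me.
pose m1 := Num.max m (e / 2).
have m1e : m1 < e by rewrite gt_max me /=; lra.
have mm1 : m <= m1 by rewrite le_max lexx.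
have em1 : e / 2 <= m1 by rewrite le_max lexx orbT.
have m10 : 0 < m1 by lra.
pose k := e / m1.
have k1 : 1 < k by rewrite /k ltr_pdivlMr// mul1r.
have k2 : k <= 2 by rewrite /k ler_pdivrMr//; lra.
exists ((k - 1) / 2), ((1 + k^-1) / 2); split.
- by apply/andP; split; lra.
- have kV : k^-1 < 1 by rewrite invf_lt1// (lt_trans ltr01).
  have kV0 : 0 < k^-1 by rewrite invr_gt0 (lt_trans ltr01).
  by apply/andP; split; lra.
- have -> : (1 + k^-1) / 2 = (1 + (k - 1) / 2) / e * m1.
    rewrite /k; field; rewrite !gt_eqF//.
  rewrite ler_wpM2l// divr_ge0// ?(ltW e0)//; lra.
Qed.

Section OneLargeFactor.
Context {R : realType} {d : measure_display} {T : measurableType d}.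
Variables (P : probability T R) (X : nat -> {RV P >-> R}).
Hypothesis X_ge0 : forall i t, 0 <= X i t.
Hypothesis X_indep : mutually_independent X.
Hypothesis X_ident : identically_distributed X.
Hypothesis X_regvar : forall i, regularly_varying_m1 (X i).
Variables (a b : nat -> R) (Sa Sb : R).
Hypothesis a0 : forall m, 0 <= a m.
Hypothesis b0 : forall m, 0 <= b m.
Hypothesis sum_a : forall n, \sum_(0 <= m < n) a m <= Sa.
Hypothesis sum_b : forall n, \sum_(0 <= m < n) b m <= Sb.
Hypothesis uba : {ae P, forall t, upbounded a (X^~ t)}.
Hypothesis ubb : {ae P, forall t, upbounded b (X^~ t)}.
Local Notation Y0 := (fun t => pprodoo xpredT a (X^~ t)).
Local Notation Y1 := (fun t => pprodoo xpredT b (X^~ t)).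
Local Notation tl := (tail X).

Lemma upprodoo_upbounded (g : nat -> R) t : (forall m, 0 <= g m) ->
  upbounded g (X^~ t) -> ((pprodoo xpredT g (X^~ t))%:E <= upprodoo X g t)%E.
Proof.
move=> g0 [M uM].
have Xt0 k : 0 <= X k t by exact: X_ge0.
have cup : cvgn (upprod g (X^~ t)).
  apply: nondecreasing_is_cvgn; first exact: upprod_nd.
  by exists M => _ [n _ <-].
have -> : upprodoo X g t = (limn (upprod g (X^~ t)))%:E.
  by apply/cvg_lim => //; apply: cvg_EFin => //; exact: nearW.
rewrite lee_fin; apply: pprodoo_le_upprod => // n.
apply: nondecreasing_cvgn_le => //; exact: upprod_nd.
Qed.

(** The source of the finite moments in both limit theorems: only the combined exponents of the
    retained factors must stay below 1, not those of [U] and [V] separately. *)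
Lemma integral_pprodoo_lty (A : pred nat) (c1 c2 th : R) : 0 <= c1 -> 0 <= c2 ->
  0 < th < 1 -> (forall m, A m -> c1 * a m + c2 * b m <= th) ->
  (\int[P]_t (pprodoo A a (X^~ t) `^ c1 * pprodoo A b (X^~ t) `^ c2)%:E < +oo)%E.
Proof.
move=> c10 c20 th01 Hth; have /andP[th0 _] := th01.
pose h m := c1 * a m + c2 * b m.
pose g m := if A m then h m else 0.
have h0 m : 0 <= h m by rewrite addr_ge0// mulr_ge0.
have g0 m : 0 <= g m by rewrite /g; case: ifP.
have gh m : 0 <= g m <= h m by rewrite g0 /g; case: ifP => _; rewrite ?lexx ?h0.
have gth m : 0 <= g m <= th.
  by rewrite g0 /g; case: ifPn => [/Hth//|_]; exact: ltW.
have sg n : \sum_(0 <= k < n) g k <= c1 * Sa + c2 * Sb.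
  apply: (@le_trans _ _ (\sum_(0 <= k < n) h k)).
    by apply: ler_sum => k _; have /andP[] := gh k.
  by rewrite big_split /= -!mulr_sumr lerD// ler_wpM2l.
have ig := integrable_upprodoo X_ge0 X_indep X_ident X_regvar th01 gth sg.
have up0 t : (0 <= upprodoo X g t)%E.
  apply: le_trans (upprod_le_oo X t 0 g0); rewrite lee_fin (le_trans ler01)//.
  exact: upprod_ge1.
apply: (@le_lt_trans _ _ (\int[P]_t upprodoo X g t)%E); last first.
  have /integrableP[_] := ig; apply: le_lt_trans; apply: ge0_le_integral => //.
  - exact: measurable_upprodoo.
  - by apply: measurableT_comp => //; exact: measurable_upprodoo.
  - by move=> t _; rewrite gee0_abs.
have mp e c : measurable_fun setT (fun t => pprodoo A e (X^~ t) `^ c).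
  by apply: (measurableT_comp (measurable_powR _)); exact: measurable_pprodoo.
apply: ae_ge0_le_integral => //.
- by move=> t _; rewrite lee_fin mulr_ge0 ?powR_ge0.
- by apply/measurable_EFinP; apply: measurable_funM.
- exact: measurable_upprodoo.
apply: filterS2 uba ubb => t ua ub _.
have Xt0 k : 0 <= X k t by exact: X_ge0.
rewrite -(pprodoo_comb A a0 b0 Xt0 c10 c20 ua ub) pprodoo_restrict.
apply: upprodoo_upbounded => //.
by apply: (upbounded_le gh); exact: upbounded_comb.
Qed.

Lemma integral_scaled_lty (f g : T -> R) (K : R) : 0 <= K ->
  measurable_fun setT f -> measurable_fun setT g ->
  (forall t, 0 <= f t) -> (forall t, 0 <= g t) ->
  {ae P, forall t, f t <= K * g t} -> (\int[P]_t (g t)%:E < +oo)%E ->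
  (\int[P]_t (f t)%:E < +oo)%E.
Proof.
move=> K0 mf mg f0 g0 fg Ig.
apply: (@le_lt_trans _ _ (\int[P]_t (K%:E * (g t)%:E))%E).
  apply: ae_ge0_le_integral => //.
  - by move=> t _; rewrite lee_fin.
  - exact/measurable_EFinP.
  - by move=> t _; rewrite -EFinM lee_fin mulr_ge0.
  - by apply: emeasurable_funM; [exact: measurable_cst|exact/measurable_EFinP].
  - by apply: filterS fg => t h _; rewrite -EFinM lee_fin.
rewrite ge0_integralZl//.
- exact: lte_mul_pinfty.
- exact/measurable_EFinP.
- by move=> t _; rewrite lee_fin.
Qed.

Variables (i : nat) (s0 s1 : R).
Hypotheses (s0_gt0 : 0 < s0) (s1_gt0 : 0 < s1).
Local Notation U := (fun t => pprodoo (fun m => m != i) a (X^~ t)).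
Local Notation V := (fun t => pprodoo (fun m => m != i) b (X^~ t)).

Let U_ge0 t : 0 <= U t. Proof. exact: pprodoo_ge0. Qed.
Let V_ge0 t : 0 <= V t. Proof. exact: pprodoo_ge0. Qed.

Lemma measurable_U : measurable_fun setT U. Proof. exact: measurable_pprodoo. Qed.
Lemma measurable_V : measurable_fun setT V. Proof. exact: measurable_pprodoo. Qed.

Lemma measurable_U_off : measurable_fun [set: off X i] (U : off X i -> R).
Proof. by apply: measurable_pprodoo_off; rewrite eqxx. Qed.

Lemma measurable_V_off : measurable_fun [set: off X i] (V : off X i -> R).
Proof. by apply: measurable_pprodoo_off; rewrite eqxx. Qed.

Lemma measurable_mul_gt (N : T -> R) y : measurable_fun setT N ->
  measurable [set t | X i t * N t > y].
Proof.
move=> mN; rewrite (_ : [set t | _] = (fun t => X i t * N t) @^-1` `]y, +oo[%classic).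
  by rewrite -[X in measurable X]setTI; apply: measurable_funM => //.
by apply/seteqP; split => t /=; rewrite in_itv /= andbT.
Qed.

(** With equal exponents the two conditions merge into [X_i^e * min (U / s0, V / s1) > x]. *)
Lemma one_large_eq (e lam m : R) : a i = e -> b i = e -> 0 < e ->
  0 <= lam <= 1 -> m < e -> (forall j, j != i -> lam * a j + (1 - lam) * b j <= m) ->
  let Z := fun t => Num.min (s0^-1 * U t) (s1^-1 * V t) `^ (1 / e) in
  ('E_P[Z])%E \is a fin_num /\
  prob P [set t | Y0 t > s0 * x /\ Y1 t > s1 * x] / tl (x `^ (1 / e))
    @[x --> +oo] --> fine ('E_P[Z])%E.
Proof.
move=> ai bi e0 l01 me Hm Z; have /andP[l0 l1] := l01.
have [eta [th [eta01 th01 Hth]]] := exponent_margin e0 me.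
have /andP[eta0 eta1] := eta01.
have eV0 : 0 < 1 / e by rewrite divr_gt0.
have mmin d' (T' : measurableType d') (f g : T' -> R) : measurable_fun setT f ->
    measurable_fun setT g ->
    measurable_fun setT (fun t => Num.min (s0^-1 * f t) (s1^-1 * g t) `^ (1 / e)).
  move=> mf mg; apply: (measurableT_comp (measurable_powR _)).
  by apply: measurable_minr; apply: measurable_funM.
have mZ : measurable_fun setT Z by apply: mmin; [exact: measurable_U|exact: measurable_V].
have mZoff : measurable_fun [set: off X i] (Z : off X i -> R).
  by apply: (@mmin _ (off X i)); [exact: measurable_U_off|exact: measurable_V_off].
have Z0 t : 0 <= Z t by exact: powR_ge0.
pose p := (1 + eta) / e.
have p0 : 0 < p by rewrite divr_gt0// addr_gt0.
(* The minimum to the power [p] is at most [(U / s0)^c1 (V / s1)^c2], and this mixture has exponents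
   at most [p m <= th]; [U] and [V] alone may lack the required moments. *)
pose c1 := p * lam; pose c2 := p * (1 - lam).
have c10 : 0 <= c1 by rewrite mulr_ge0// ltW.
have c20 : 0 <= c2 by rewrite mulr_ge0 ?subr_ge0// ltW.
have IZ : (\int[P]_t (Z t `^ (1 + eta))%:E < +oo)%E.
  apply: (@integral_scaled_lty _ (fun t => U t `^ c1 * V t `^ c2)
    (s0^-1 `^ c1 * s1^-1 `^ c2)).
  - by rewrite mulr_ge0 ?powR_ge0.
  - exact: (measurableT_comp (measurable_powR _)).
  - by apply: measurable_funM; apply: (measurableT_comp (measurable_powR _));
      [exact: measurable_U|exact: measurable_V].
  - by move=> t; exact: powR_ge0.
  - by move=> t; rewrite mulr_ge0 ?powR_ge0.
  - apply: nearW => t; have U0 := U_ge0 t; have V0 := V_ge0 t.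
    have u0 : 0 <= s0^-1 * U t by rewrite mulr_ge0// invr_ge0 ltW.
    have v0 : 0 <= s1^-1 * V t by rewrite mulr_ge0// invr_ge0 ltW.
    rewrite /Z -powRrM (_ : 1 / e * (1 + eta) = c1 + c2); last first.
      by rewrite /c1 /c2 /p; ring.
    have mn0 : 0 <= Num.min (s0^-1 * U t) (s1^-1 * V t) by rewrite le_min u0 v0.
    rewrite powRDge0// mulrACA -!powRM// ?invr_ge0 ?(ltW s0_gt0) ?(ltW s1_gt0)//.
    by apply: ler_pM; rewrite ?powR_ge0//; apply: le_powR => //;
      rewrite ge_min lexx ?orbT.
  - apply: (integral_pprodoo_lty c10 c20 th01) => j ji.
    apply: le_trans Hth; rewrite (_ : _ + _ = p * (lam * a j + (1 - lam) * b j)); last first.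
      by rewrite /c1 /c2; ring.
    by rewrite ler_pM2l// Hm.
have [fZ cZ] := @breiman _ _ _ _ X X_indep X_ident X_regvar i Z Z (fun=> Z)
  (fun x => x `^ (1 / e)) eta (fun=> mZoff) (fun=> Z0) Z0 mZ mZ (cvg_powR_pinfty eV0)
  ltac:(by apply: nearW => t; exact: nearW) ltac:(exact: nearW) eta01 IZ.
split => //; move: cZ; apply: cvg_trans; apply: near_eq_cvg; near=> x.
have x0 : 0 < x by near: x; exact: nbhs_pinfty_gt.
congr (_ / _); apply: prob_eq.
- exact: measurable_mul_gt.
- by apply: measurable_gt2; exact: measurable_pprodoo.
apply: filterS2 uba ubb => t ua ub; have U0 := U_ge0 t; have V0 := V_ge0 t => /=.
have Xt0 k : 0 <= X k t by exact: X_ge0.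
rewrite (pprodoo_D1 a0 Xt0 ua (i := i))// (pprodoo_D1 b0 Xt0 ub (i := i))//= ai bi.
have u0 : 0 <= s0^-1 * U t by rewrite mulr_ge0// invr_ge0 ltW.
have v0 : 0 <= s1^-1 * V t by rewrite mulr_ge0// invr_ge0 ltW.
have mn0 : 0 <= Num.min (s0^-1 * U t) (s1^-1 * V t) by rewrite le_min u0 v0.
have xe0 : 0 <= X i t `^ e by exact: powR_ge0.
rewrite /Z (_ : X i t * _ = (X i t `^ e * Num.min (s0^-1 * U t) (s1^-1 * V t)) `^ (1 / e)); last first.
  by rewrite powRM// -powRrM mul1r divff ?gt_eqF// powRr1.
rewrite ltr_powR2 ?(ltW x0) ?mulr_ge0// minr_pMr// lt_min.
rewrite !(mulrCA _ s0^-1) !(mulrCA _ s1^-1) !ltr_pdivlMl//.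
by split=> [/andP[]|[-> ->]].
Unshelve. all: by end_near. Qed.

(** When [X_i] is of order [x^(1/e)], the power [X_i^(a_i)] is far larger than [x]. So the first
    condition only asks in the limit that [U > 0], which is where the indicators come from. *)
Lemma one_large_gt (e m : R) : b i = e -> 0 < e -> e < a i -> m < e ->
  (forall j, j != i -> b j <= m) ->
  {ae P, forall t, exists N, 0 < dnprodoo N a (X^~ t)} ->
  let Z := infprod (fun j => j != i) (fun j t => X j t `^ (b j / e) *
     \1_[set t' | X j t' `^ a j > 0] t) in
  ('E_P[Z])%E \is a fin_num /\
  prob P [set t | Y0 t > s0 * x /\ Y1 t > s1 * x] / tl (x `^ (1 / e))
    @[x --> +oo] --> fine ('E_P[Z])%E * s1 `^ (- (1 / e)).
Proof.
move=> bi e0 eai me Hm dna Z.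
have [eta [th [eta01 th01 Hth]]] := exponent_margin e0 me.
have /andP[eta0 eta1] := eta01.
have eV0 : 0 < 1 / e by rewrite divr_gt0.
have ai0 : 0 < a i by exact: lt_trans eai.
have aV0 : 0 < 1 / a i by rewrite divr_gt0.
have dl0 : 0 < 1 / e - 1 / a i by rewrite subr_gt0 !div1r ltf_pV2.
pose M1 t := (s1^-1 * V t) `^ (1 / e).
pose M t := if 0 < U t then M1 t else 0.
(* The second entry expresses [X_i^(a_i) U > s0 x] after rescaling to the level [x^(1/e)]; it tends
   to infinity if [U t > 0] and is 0 otherwise. *)
pose N x t := Num.min (M1 t) ((s0^-1 * U t) `^ (1 / a i) * x `^ (1 / e - 1 / a i)).
have M10 t : 0 <= M1 t by exact: powR_ge0.
have M0 t : 0 <= M t by rewrite /M; case: ifP.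
have N0 x t : 0 <= N x t by rewrite le_min M10 mulr_ge0 ?powR_ge0.
have msc d' (T' : measurableType d') (f : T' -> R) c r : measurable_fun setT f ->
    measurable_fun setT (fun t => (c * f t) `^ r).
  by move=> mf; apply: (measurableT_comp (measurable_powR _)); apply: measurable_funM.
have mM1 : measurable_fun setT M1 by apply: msc; exact: measurable_V.
have mM : measurable_fun setT M.
  apply: measurable_fun_ifT => //.
  by apply: measurable_fun_ltr; [exact: measurable_cst|exact: measurable_U].
have mN x : measurable_fun [set: off X i] (N x : off X i -> R).
  apply: measurable_minr; first by apply: (@msc _ (off X i)); exact: measurable_V_off.
  apply: measurable_funM; last exact: measurable_cst.
  by apply: (@msc _ (off X i)); exact: measurable_U_off.
have IM1 : (\int[P]_t (M1 t `^ (1 + eta))%:E < +oo)%E.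
  pose c2 := (1 + eta) / e.
  have c20 : 0 <= c2 by rewrite divr_ge0 ?(ltW e0)// addr_ge0// ltW.
  apply: (@integral_scaled_lty _ (fun t => U t `^ 0 * V t `^ c2) (s1^-1 `^ c2)).
  - exact: powR_ge0.
  - exact: (measurableT_comp (measurable_powR _)).
  - by apply: measurable_funM; apply: (measurableT_comp (measurable_powR _));
      [exact: measurable_U|exact: measurable_V].
  - by move=> t; exact: powR_ge0.
  - by move=> t; rewrite mulr_ge0 ?powR_ge0.
  - apply: nearW => t; have U0 := U_ge0 t; have V0 := V_ge0 t.
    rewrite /M1 /= -powRrM powRr0 [X in _ <= _ * X]mul1r -powRM// ?invr_ge0 ?(ltW s1_gt0)//.
    by rewrite (_ : 1 / e * (1 + eta) = c2)// /c2 div1r mulrC.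
  - apply: (integral_pprodoo_lty (lexx 0) c20 th01) => j ji.
    rewrite mul0r add0r; apply: le_trans Hth.
    rewrite -/c2 ler_wpM2l// Hm//.
have NM : {ae P, forall t, \forall x \near +oo, N x t = M t}.
  apply: nearW => t; have U0 := U_ge0 t; have V0 := V_ge0 t.
  rewrite /M; have [U1|U1] := ltP 0 (U t); last first.
    have Uz : U t = 0 by apply/eqP; rewrite eq_le U0 U1.
    apply: nearW => x; rewrite /N Uz mulr0 powR0 ?gt_eqF// mul0r.
    by apply/min_idPr; exact: M10.
  have c0 : 0 < (s0^-1 * U t) `^ (1 / a i) by rewrite powR_gt0// mulr_gt0// invr_gt0.
  have /cvgryPge/(_ (M1 t / (s0^-1 * U t) `^ (1 / a i))) := @cvg_powR_pinfty R _ dl0.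
  apply: filterS => x; rewrite ler_pdivrMr// => h.
  by apply/min_idPl; rewrite mulrC.
have [fM cM] := @breiman _ _ _ _ X X_indep X_ident X_regvar i M M1 N
  (fun x => x `^ (1 / e)) eta mN N0 M0 mM mM1 (cvg_powR_pinfty eV0)
  NM ltac:(by apply: nearW => t x; rewrite ge_min lexx) eta01 IM1.
have ZM : {ae P, forall t, Z t = s1 `^ (1 / e) * M t}.
  have gtP := @pprodoo_gt0P _ _ _ P X X_ge0 (fun m => m != i) a a0 uba dna.
  apply: filterS2 gtP ubb => t Upos ub; have U0 := U_ge0 t; have V0 := V_ge0 t.
  have Xt0 k : 0 <= X k t by exact: X_ge0.
  rewrite /M; have [U1|U1] := ltP 0 (U t).
    have Xpos := Upos.1 U1.
    rewrite /M1 powRM// ?invr_ge0 ?(ltW s1_gt0)// mulrA -powRM ?invr_ge0 ?(ltW s1_gt0)//.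
    rewrite divff ?gt_eqF// powR1 mul1r.
    rewrite -(pprodoo_scale (fun m => m != i) b0 Xt0 (ltW eV0) ub).
    rewrite /Z /infprod /pprodoo; congr (limn _); apply/funext => n.
    apply: eq_bigr => j ji; rewrite indicE mem_set ?mulr1/=; last exact: Xpos.
    by congr (_ `^ _); rewrite mul1r mulrC.
  rewrite mulr0; have /existsNP[j /not_implyP[ji /negP xj]] :
      ~ (forall m, m != i -> 0 < X m t `^ a m).
    by move=> /(Upos.2); rewrite ltNge U1.
  apply/cvg_lim => //; apply: (@cvg_trans _ (cst (0 : R) @ \oo)); last exact: cvg_cst.
  apply: near_eq_cvg; near=> n.
  have jn : (j < n)%N by near: n; exact: nbhs_infty_gt.
  rewrite big_mkcond (bigD1_seq j) ?iota_uniq//=; last by rewrite mem_index_iota.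
  by rewrite ji indicE memNset ?mulr0 ?mul0r//=; exact/negP.
have mZ : measurable_fun setT Z.
  apply: measurable_infprod => j ji; apply: measurable_funM.
    exact: (measurableT_comp (measurable_powR _)).
  apply: measurable_indic; apply: measurable_gt0.
  exact: (measurableT_comp (measurable_powR _)).
have s1e : 0 < s1 `^ (1 / e) by rewrite powR_gt0.
have EZ : ('E_P[Z] = (s1 `^ (1 / e))%:E * 'E_P[M])%E.
  rewrite unlock -ge0_integralZl//; first last.
  - by rewrite lee_fin ltW.
  - by move=> t _; rewrite lee_fin.
  - exact/measurable_EFinP.
  apply: ae_eq_integral => //.
  - exact/measurable_EFinP.
  - by apply: emeasurable_funM; [exact: measurable_cst|exact/measurable_EFinP].
  - by apply: filterS ZM => t h _; rewrite h EFinM.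
split; first by rewrite EZ fin_numM.
have sE : s1 `^ (1 / e) * s1 `^ (- (1 / e)) = 1 by rewrite -powRDgt0// subrr powRr0.
rewrite EZ fineM// mulrAC sE [1 * fine _]mul1r.
move: cM; apply: cvg_trans; apply: near_eq_cvg; near=> x.
have x0 : 0 < x by near: x; exact: nbhs_pinfty_gt.
congr (_ / _); apply: prob_eq.
- by apply: measurable_mul_gt; exact: off_measurable_fun (mN x).
- by apply: measurable_gt2; exact: measurable_pprodoo.
apply: filterS2 uba ubb => t ua ub; have U0 := U_ge0 t; have V0 := V_ge0 t => /=.
have Xt0 k : 0 <= X k t by exact: X_ge0.
rewrite (pprodoo_D1 a0 Xt0 ua (i := i))// (pprodoo_D1 b0 Xt0 ub (i := i))//= bi.
have u0 : 0 <= s0^-1 * U t by rewrite mulr_ge0// invr_ge0 ltW.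
have v0 : 0 <= s1^-1 * V t by rewrite mulr_ge0// invr_ge0 ltW.
have key (r c W : R) : 0 < r -> 0 < c -> 0 <= W ->
    (c * x < X i t `^ r * W) = (x `^ (1 / r) < X i t * (c^-1 * W) `^ (1 / r)).
  move=> r0 c0 W0; have cW0 : 0 <= c^-1 * W by rewrite mulr_ge0// invr_ge0 ltW.
  have e1 : X i t = (X i t `^ r) `^ (1 / r) by rewrite div1r powRK ?gt_eqF.
  rewrite [X in _ = (_ < X * _)]e1 -powRM ?powR_ge0//.
  have h1 : 0 <= X i t `^ r * (c^-1 * W) by exact: mulr_ge0 (powR_ge0 _ _) cW0.
  rewrite ltr_powR2 ?divr_gt0 ?(ltW x0)//.
  by rewrite [X in _ = (_ < X)]mulrCA ltr_pdivlMl.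
rewrite key// key// /N minr_pMr// lt_min andbC.
have xd : 0 < x `^ (1 / e - 1 / a i) by rewrite powR_gt0.
rewrite -[X in _ <-> is_true X /\ _](ltr_pM2r xd) -powRDgt0//.
rewrite (_ : 1 / a i + (1 / e - 1 / a i) = 1 / e); last by ring.
rewrite mulrA.
by split=> [/andP[]|[-> ->]].
Unshelve. all: by end_near. Qed.

End OneLargeFactor.

(** * Quantile functions *)

Section Quantile.
Context {R : realType}.
Variable G : R -> R.
Hypothesis G_ni : forall x y, x <= y -> G y <= G x.
Hypothesis G_rc : right_continuous G.
Hypothesis G_cvg0 : G x @[x --> +oo] --> 0.
Local Notation mu := (@lebesgue_measure R).

(** Generalized inverse of a nonincreasing function on the half-line. The element 0 keeps the set
    nonempty when [w] exceeds all values of [G]. *)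
Definition quantile (w : R) : R :=
  if 0 < w then sup [set a | a = 0 \/ 0 <= a /\ w < G a] else 0.

Lemma has_sup_quantile w : 0 < w -> has_sup [set a | a = 0 \/ 0 <= a /\ w < G a].
Proof.
move=> w0; split; first by exists 0; left.
have : \forall x \near +oo, G x < w by apply: (cvgr_lt _ G_cvg0).
move=> [M [_ HM]]; exists (Num.max 0 (M + 1)) => a [->|[a0 wa]].
  by rewrite le_max lexx.
rewrite le_max; apply/orP; right; rewrite leNgt; apply/negP => Ma.
have Ga : G (M + 1) < w by apply: HM; rewrite ltrDl.
by have := lt_le_trans wa (G_ni (ltW Ma)); rewrite ltNge (ltW Ga).
Qed.

Lemma quantile_ge0 w : 0 <= quantile w.
Proof.
rewrite /quantile; case: ifPn => // w0.
by apply: sup_upper_bound; [exact: has_sup_quantile|left].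
Qed.

(** Strictness on both sides comes from right continuity: [w < G a] persists a little to the right
    of [a], so the supremum exceeds [a]. *)
Lemma quantileP w a : 0 < w -> 0 <= a -> (a < quantile w) = (w < G a).
Proof.
move=> w0 a0; rewrite /quantile w0; apply/idP/idP.
  apply: contraTT; rewrite -!leNgt => Gaw.
  apply: sup_le_ub; first by exists 0; left.
  move=> b [->//|[b0 wb]]; rewrite leNgt; apply/negP => ab.
  by have := lt_le_trans wb (G_ni (ltW ab)); rewrite ltNge Gaw.
move=> wa.
have Ga : G x @[x --> a^'+] --> G a by exact: G_rc.
have near_lt : \forall x \near a^'+, w < G x by exact: (cvgr_gt (G a) Ga).
have [x [wx ax]] : exists x, w < G x /\ a < x.
  by apply: (@filter_ex _ a^'+); apply: filterI near_lt _; exact: nbhs_right_gt.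
apply: (lt_le_trans ax).
apply: sup_upper_bound; first exact: has_sup_quantile.
by right; split => //; apply: le_trans (ltW ax).
Qed.

Lemma quantile_gt_set a : 0 <= a ->
  [set w | a < quantile w] = `]0, G a[%classic.
Proof.
move=> a0; apply/seteqP; split => w /=; rewrite in_itv /=.
  have [w0|w0] := ltP 0 w; first by rewrite quantileP// => ->.
  by rewrite /quantile (le_gtF w0) ltNge a0.
by move=> /andP[w0]; rewrite quantileP.
Qed.

Lemma measurable_quantile : measurable_fun setT quantile.
Proof.
apply: (measurability _ (RGenOInfty.measurableE R)) => //.
move=> _ [_ [x ->] <-]; rewrite setTI.
have [x0|x0] := leP 0 x.
  rewrite (_ : _ @^-1` _ = [set w | x < quantile w]).
    by rewrite quantile_gt_set//; exact: measurable_itv.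
  by apply/seteqP; split => w /=; rewrite in_itv /= andbT.
rewrite (_ : _ @^-1` _ = setT)//; apply/seteqP; split => w //= _.
by rewrite in_itv /= andbT (lt_le_trans x0)// quantile_ge0.
Qed.

End Quantile.

Section QuantileLaw.
Context {R : realType} {d : measure_display} {T : measurableType d}.
Variable P : probability T R.
Local Notation mu := (@lebesgue_measure R).

(* [quantile] pushes Lebesgue measure forward to [c^-1] times the law of [Y] (off [0]). *)
Lemma integral_quantile (Y : T -> R) (G : R -> R) (c : R) (h : R -> R) :
  (forall x y, x <= y -> G y <= G x) -> right_continuous G -> G x @[x --> +oo] --> 0 ->
  measurable_fun setT Y -> (forall t, 0 <= Y t) -> 0 < c ->
  (forall a, 0 <= a -> P [set t | Y t > a] = (c * G a)%:E) ->
  measurable_fun setT h -> (forall a, 0 <= h a) -> h 0 = 0 ->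
  (\int[P]_t (h (Y t))%:E = c%:E * \int[mu]_(w in `]0%R, +oo[) (h (quantile G w))%:E)%E.
Proof.
move=> G_ni G_rc G_cvg0 mY Y0 c0 PY mh h0 hz.
have mq := measurable_quantile G_ni G_rc G_cvg0.
have cV0 : 0 < c^-1 by rewrite invr_gt0.
have Gle a : 0 <= a -> G a <= c^-1.
  move=> a0; rewrite -(ler_pM2l c0) divff ?gt_eqF// -lee_fin -PY//.
  apply: probability_le1; rewrite (_ : [set t | _] = Y @^-1` `]a, +oo[%classic).
    by rewrite -[X in measurable X]setTI; exact: mY.
  by apply/seteqP; split => t /=; rewrite in_itv /= andbT.
have G0 a : 0 <= a -> 0 <= G a.
  by move=> a0; rewrite -(ler_pM2l c0) mulr0 -lee_fin -PY.
(* [G] is at most [1 / c], so the quantile vanishes beyond; as [h 0 = 0], the half-line can be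
   replaced by a bounded interval with its uniform probability, under which the quantile has the law
   of [Y]. *)
have hq0 w : ~~ (0 < w <= c^-1) -> h (quantile G w) = 0.
  rewrite negb_and -leNgt -ltNge => /orP[w0|wc]; first by rewrite /quantile (le_gtF w0).
  have w0 : 0 < w by exact: lt_trans wc.
  rewrite (_ : quantile G w = 0)//; apply/eqP; rewrite eq_le quantile_ge0// andbT.
  by rewrite leNgt quantileP// -leNgt (le_trans (Gle 0 _))// ltW.
have key (f : R -> \bar R) : measurable_fun setT f -> (forall x, 0 <= f x)%E ->
    (\int[uniform_prob cV0]_w f w = c%:E * \int[mu]_(w in `[0%R, (c^-1)%R]) f w)%E.
  by move=> mf f0; rewrite integral_uniform// subr0 invrK.
have PYx x : 0 <= x -> P (Y @^-1` `]x, +oo[%classic) = (c * G x)%:E.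
  move=> x0; rewrite -PY//; congr (P _).
  by apply/seteqP; split => t /=; rewrite in_itv /= andbT.
have Uqx x : 0 <= x ->
    uniform_prob cV0 (quantile G @^-1` `]x, +oo[%classic) = (c * G x)%:E.
  move=> x0; have E0 : quantile G @^-1` `]x, +oo[%classic = `]0, G x[%classic.
    rewrite -quantile_gt_set//.
    by apply/seteqP; split => t /=; rewrite in_itv /= andbT.
  rewrite E0 -[X in uniform_prob cV0 X]setIT -integral_indic//.
  rewrite key//; last by apply/measurable_EFinP; exact: measurable_indic.
  rewrite (@integral_indic _ _ _ mu _ (measurable_itv _) _ (measurable_itv _)).
  rewrite setIidl; last first.
    move=> w /=; rewrite !in_itv /= => /andP[w0 wG].
    by rewrite (ltW w0) (le_trans (ltW wG))// Gle.
  rewrite EFinM; congr (_ * _)%E; apply: (etrans (lebesgue_measure_itv _)) => /=.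
  rewrite lte_fin; case: ltP => Gx; first by rewrite -EFinB subr0.
  by congr EFin; apply/eqP; rewrite eq_le G0.
pose Y' : {mfun T >-> R} := HB.pack Y (isMeasurableFun.Build _ _ _ _ Y mY).
pose q' : {mfun measurableTypeR R >-> R} := HB.pack (quantile G)
  (isMeasurableFun.Build _ _ (measurableTypeR R) R (quantile G) mq).
pose U : probability (measurableTypeR R) R := uniform_prob cV0.
have m12 B : measurable B -> distribution P Y' B = distribution U q' B.
  move=> mB; apply: (measure_unique (@RGenOInfty.G R) (fun k => `]- k%:R, +oo[%classic)) => //.
  - exact: RGenOInfty.measurableE.
  - move=> _ _ [x ->] [y ->]; exists (Num.max x y); apply/seteqP; split => z /=;
      rewrite !in_itv /= !andbT gt_max; first by move=> [-> ->].
    by move=> /andP[].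
  - by move=> k; exists (- k%:R).
  - apply/seteqP; split => // x _.
    exists (Num.bound `|x|) => //=; rewrite in_itv /= andbT ltrNl.
    by apply: (le_lt_trans (ler_norm _)); rewrite normrN; exact: archi_boundP.
  - move=> _ [x ->]; have [x0|x0] := leP 0 x.
      by apply: (etrans (PYx x x0)); rewrite -Uqx.
    transitivity (1 : \bar R)%E.
      apply: etrans (probability_setT P); congr (P _).
      by apply/seteqP; split => t //= _; rewrite in_itv /= andbT (lt_le_trans x0).
    apply/esym; apply: etrans (probability_setT U); congr (U _).
    by apply/seteqP; split => t //= _; rewrite in_itv /= andbT (lt_le_trans x0)// quantile_ge0.
  - move=> k; apply: (le_lt_trans (probability_le1 _ _)); last exact: ltry.
    exact: measurable_itv.
have mhE : measurable_fun setT (EFin \o h) by exact/measurable_EFinP.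
have h0E x : (0 <= (EFin \o h) x)%E by rewrite lee_fin.
transitivity (\int[distribution P Y']_y (h y)%:E)%E.
  by rewrite (@ge0_integral_distribution _ _ _ _ _ P Y' (EFin \o h)).
transitivity (\int[distribution U q']_y (h y)%:E)%E.
  by apply: eq_measure_integral => A mA _; exact: m12.
rewrite (@ge0_integral_distribution _ _ _ _ _ U q' (EFin \o h))//.
transitivity (c%:E * \int[mu]_(w in `[0%R, (c^-1)%R]) (h (quantile G w))%:E)%E.
  by apply: key => [|x]; [apply/measurable_EFinP; exact: measurableT_comp|rewrite lee_fin].
congr (_ * _)%E; rewrite [LHS]integral_mkcond [RHS]integral_mkcond.
apply: eq_integral => w _; rewrite !patchE.
have [wc|wc] := boolP (0 < w <= c^-1).
  have /andP[w0 w1] := wc; rewrite !mem_set//= in_itv /= ?w0//.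
  by rewrite ltW.
by rewrite hq0// !if_same.
Qed.

End QuantileLaw.

Lemma cvg_minr {R : realType} (u v : nat -> R) (l m : R) :
  u n @[n --> \oo] --> l -> v n @[n --> \oo] --> m ->
  Num.min (u n) (v n) @[n --> \oo] --> Num.min l m.
Proof.
move=> ul vm; under eq_cvg do rewrite minr_absE; rewrite minr_absE.
apply: cvgM; [|exact: cvg_cst]; apply: cvgD; first exact: cvgD.
by apply: cvgN; apply: cvg_norm; apply: cvgB.
Qed.

Section ScaledPowerIntegrals.
Context {R : realType}.
Local Notation mu := (@lebesgue_measure R).

Lemma measurable_cst_powR (K r : R) (D : set R) :
  measurable_fun D (fun x : R => (K * x `^ r)%:E).
Proof.
apply/measurable_EFinP; apply: measurable_funTS.
by apply: measurable_funM; [exact: measurable_cst|exact: measurable_powR].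
Qed.

Lemma scaled_power (z w r x : R) : 0 < w -> 0 < x ->
  z * (w / x) `^ r = z * w `^ r * x `^ (- r).
Proof.
move=> w0 x0; rewrite powRM ?invr_ge0 ?(ltW w0) ?(ltW x0)// (powRV _ (ltW x0)).
by rewrite mulrA.
Qed.

Lemma powR_sub1 (w r : R) : 0 < w -> w `^ r * w `^ (1 - r) = w.
Proof. by move=> w0; rewrite -powRDgt0// addrC subrK powRr1// ltW. Qed.

Lemma integral_scaled_power (z w r : R) : 0 <= z -> 0 < w -> 0 <= r < 1 ->
  (\int[mu]_(x in `]0%R, w[) (z * (w / x) `^ r)%:E = (z * w / (1 - r))%:E)%E.
Proof.
move=> z0 w0 r01.
transitivity (\int[mu]_(x in `]0%R, w[) (z * w `^ r * x `^ (- r))%:E)%E.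
  by apply: eq_integral => x /set_mem /=; rewrite in_itv /= => /andP[x0 _]; rewrite scaled_power.
rewrite integral_itv_bndo_bndc; last exact: measurable_cst_powR.
have k0 : 0 <= z * w `^ r by rewrite mulr_ge0 ?powR_ge0.
under eq_integral do rewrite EFinM.
rewrite ge0_integralZl//; first last.
- by move=> x _; rewrite lee_fin powR_ge0.
- by apply/measurable_EFinP; apply: measurable_funTS; exact: measurable_powR.
rewrite integral_powR_0// -EFinM; congr EFin.
by rewrite -[X in _ = z * X / _](powR_sub1 r w0) !mulrA.
Qed.

Lemma integral_scaled_power_pinfty (z w r : R) : 0 <= z -> 0 < w -> 1 < r ->
  (\int[mu]_(x in `[w, +oo[) (z * (w / x) `^ r)%:E = (z * w / (r - 1))%:E)%E.
Proof.
move=> z0 w0 r1.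
transitivity (\int[mu]_(x in `[w, +oo[) (z * w `^ r * x `^ (- r))%:E)%E.
  apply: eq_integral => x /set_mem /=; rewrite in_itv /= => /andP[wx _].
  by rewrite scaled_power// (lt_le_trans w0).
have k0 : 0 <= z * w `^ r by rewrite mulr_ge0 ?powR_ge0.
under eq_integral do rewrite EFinM.
rewrite ge0_integralZl//; first last.
- by move=> x _; rewrite lee_fin powR_ge0.
- by apply/measurable_EFinP; apply: measurable_funTS; exact: measurable_powR.
rewrite integral_powR_pinfty// -EFinM; congr EFin.
by rewrite -[X in _ = z * X / _](powR_sub1 r w0) !mulrA.
Qed.

Lemma integral_split_at (w : R) (f : R -> \bar R) : 0 < w ->
  measurable_fun (`]0%R, +oo[%classic : set R) f -> (forall x, 0 < x -> (0 <= f x)%E) ->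
  (\int[mu]_(x in `]0%R, +oo[) f x =
   \int[mu]_(x in `]0%R, w[) f x + \int[mu]_(x in `[w, +oo[) f x)%E.
Proof.
move=> w0 mf f0.
have E0 : `]0%R, +oo[%classic = `]0, w[ `|` `[w, +oo[ :> set R.
  apply/seteqP; split => x /=; rewrite !in_itv /= ?andbT.
    by move=> x0; have [xw|xw] := ltP x w; [left; rewrite x0|right].
  by case => [/andP[]//|wx]; exact: lt_le_trans wx.
rewrite E0 ge0_integral_setU//; rewrite -?E0//.
- by move=> x /=; rewrite in_itv /= andbT; exact: f0.
- apply/disj_setPS => x [/=]; rewrite !in_itv /= andbT => /andP[_ xw] wx.
  by move: xw; rewrite ltNge wx.
Qed.

Lemma integral_two_powers (z w r1 r2 : R) (f : R -> R) : 0 <= z -> 0 < w -> 0 <= r1 < 1 -> 1 < r2 ->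
  measurable_fun (`]0%R, +oo[%classic : set R) f ->
  (forall x, 0 < x -> f x = if x < w then z * (w / x) `^ r1 else z * (w / x) `^ r2) ->
  (\int[mu]_(x in `]0%R, +oo[) (f x)%:E = (z * w / (1 - r1) + z * w / (r2 - 1))%:E)%E.
Proof.
move=> z0 w0 r1_01 r2_1 mf fE.
rewrite (integral_split_at w0); [|exact/measurable_EFinP|]; last first.
  by move=> x x0; rewrite fE// lee_fin; case: ifP => _; rewrite mulr_ge0 ?powR_ge0.
rewrite EFinD -integral_scaled_power// -integral_scaled_power_pinfty//.
congr (_ + _)%E; apply: eq_integral => x /set_mem /=; rewrite in_itv /= ?andbT.
  by move=> /andP[x0 xw]; rewrite fE// xw.
by move=> wx; rewrite fE ?(lt_le_trans w0)// ltNge wx.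
Qed.

End ScaledPowerIntegrals.

(** * Two large factors *)

Section JointFactor.
Context {R : realType}.
Variables ai aj bi bj : R.
Hypotheses (aj0 : 0 <= aj) (aij : aj < ai) (bi0 : 0 <= bi) (bij : bi < bj).
Local Notation mu := (@lebesgue_measure R).
Let ai_gt0 : 0 < ai. Proof. exact: le_lt_trans aij. Qed.
Let bj_gt0 : 0 < bj. Proof. exact: le_lt_trans bij. Qed.
Let ai_neq0 : ai != 0. Proof. by rewrite gt_eqF. Qed.
Let bjV_neq0 : bj^-1 != 0. Proof. by rewrite invr_eq0 gt_eqF. Qed.

(* The [c] for which [b c > 1] is equivalent to [a^ai b^aj u > 1] and [a^bi b^bj v > 1]
   together, see [joint_factorP]; when [aj = 0] the first condition does not involve [b]. *)
Definition joint_factor (a u v : R) : R :=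
  let r := (a `^ bi * v) `^ bj^-1 in
  if aj == 0 then (if 1 < a `^ ai * u then r else 0)
  else Num.min ((a `^ ai * u) `^ aj^-1) r.

Lemma joint_factor_ge0 a u v : 0 <= joint_factor a u v.
Proof.
rewrite /joint_factor; case: ifP => _; first by case: ifP => _; rewrite ?powR_ge0.
by rewrite le_min !powR_ge0.
Qed.

Lemma joint_factor0 u v : joint_factor 0 u v = 0.
Proof.
rewrite /joint_factor (powR0 ai_neq0) mul0r ltr10; case: eqP => // /eqP ajn.
have ajV : aj^-1 != 0 by rewrite invr_eq0.
by rewrite (powR0 ajV); apply/min_idPl; exact: powR_ge0.
Qed.

Lemma joint_factor_u0 a v : joint_factor a 0 v = 0.
Proof.
rewrite /joint_factor mulr0 ltr10; case: eqP => // /eqP ajn.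
by rewrite powR0 ?invr_eq0//; apply/min_idPl; exact: powR_ge0.
Qed.

Lemma joint_factor_v0 a u : joint_factor a u 0 = 0.
Proof.
rewrite /joint_factor /= mulr0 (powR0 bjV_neq0) if_same; case: ifP => // _.
by apply/min_idPr; exact: powR_ge0.
Qed.

Lemma joint_factorP a b u v : 0 <= a -> 0 <= b -> 0 <= u -> 0 <= v ->
  (1 < a `^ ai * b `^ aj * u /\ 1 < a `^ bi * b `^ bj * v) <-> 1 < b * joint_factor a u v.
Proof.
move=> a0 b0 u0 v0.
have p0 : 0 <= a `^ ai * u by rewrite mulr_ge0 ?powR_ge0.
have r0 : 0 <= a `^ bi * v by rewrite mulr_ge0 ?powR_ge0.
have key e x : 0 < e -> 0 <= x -> (1 < b `^ e * x) = (1 < b * x `^ e^-1).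
  move=> e0 x0.
  rewrite -[RHS](ltr_powR2 e0 ler01) ?mulr_ge0 ?powR_ge0// powR1.
  by rewrite powRM ?powR_ge0// powRVK ?gt_eqF.
rewrite /joint_factor ![_ * b `^ _]mulrC -!mulrA (key bj)//.
case: eqP => [->|/eqP ajn].
  rewrite powRr0 mul1r; case: ifPn => [_|_]; first by split=> [[]|].
  by rewrite mulr0 ltr10; split=> [[]|].
rewrite (key aj)//; last by rewrite lt_neqAle eq_sym ajn.
by rewrite minr_pMr// lt_min; split=> [[-> ->]|/andP[]].
Qed.

(** A minimum to the power [s + t] is at most one entry to the power [s] times the other to the
    power [t], here with [s = aj c1] and [t = bj c2]. For [aj = 0] the indicator of [p > 1] is
    bounded by [p^c1]. *)
Lemma joint_factor_le a u v c1 c2 th th' : 0 <= a -> 0 <= u -> 0 <= v ->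
  0 <= c1 -> 0 <= c2 -> 0 < th' ->
  ai * c1 + bi * c2 = th -> aj * c1 + bj * c2 = th' ->
  joint_factor a u v `^ th' <= a `^ th * (u `^ c1 * v `^ c2).
Proof.
move=> a0 u0 v0 c10 c20 th'0 <- thE.
have p0 : 0 <= a `^ ai * u by rewrite mulr_ge0 ?powR_ge0.
have r0 : 0 <= a `^ bi * v by rewrite mulr_ge0 ?powR_ge0.
have RE : a `^ (ai * c1 + bi * c2) * (u `^ c1 * v `^ c2) =
    (a `^ ai * u) `^ c1 * (a `^ bi * v) `^ c2.
  rewrite powRDge0 ?mulr_ge0 ?(ltW ai_gt0)// !powRM ?powR_ge0// -!powRrM.
  by rewrite mulrACA.
rewrite {}RE /joint_factor; case: eqP => [aj_0|/eqP ajn].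
  case: ifPn => [p1|_]; last by rewrite powR0 ?gt_eqF// mulr_ge0 ?powR_ge0.
  rewrite -thE aj_0 mul0r add0r -powRrM mulrA mulVf ?gt_eqF// mul1r.
  rewrite ler_peMl ?powR_ge0//.
  by apply: powR_ge1 => //; exact: ltW.
rewrite -thE powRDge0 ?mulr_ge0 ?(ltW bj_gt0)//.
have aj_gt0 : 0 < aj by rewrite lt_neqAle eq_sym ajn.
have m0 : 0 <= Num.min ((a `^ ai * u) `^ aj^-1) ((a `^ bi * v) `^ bj^-1).
  by rewrite le_min !powR_ge0.
apply: ler_pM; rewrite ?powR_ge0//.
  rewrite (_ : (a `^ ai * u) `^ c1 = ((a `^ ai * u) `^ aj^-1) `^ (aj * c1)); last first.
    by rewrite -powRrM mulrA mulVf// mul1r.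
  by apply: le_powR; rewrite ?mulr_ge0// ge_min lexx.
rewrite (_ : (a `^ bi * v) `^ c2 = ((a `^ bi * v) `^ bj^-1) `^ (bj * c2)); last first.
  by rewrite -powRrM mulrA mulVf ?gt_eqF// mul1r.
by apply: le_powR; rewrite ?mulr_ge0 ?(ltW bj_gt0)// ge_min lexx orbT.
Qed.

Lemma measurable_joint_factor d (T : measurableType d) (f u v : T -> R) (D : set T) :
  measurable D ->
  measurable_fun D f -> measurable_fun D u -> measurable_fun D v ->
  measurable_fun D (fun t => joint_factor (f t) (u t) (v t)).
Proof.
move=> mD mf mu' mv.
have mp e : measurable_fun D (fun t => f t `^ e).
  by apply: (@measurableT_comp _ _ _ _ _ _ (fun x : R => x `^ e)) mf; exact: measurable_powR.
have mr : measurable_fun D (fun t => (f t `^ bi * v t) `^ bj^-1).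
  apply: (@measurableT_comp _ _ _ _ _ _ (fun x : R => x `^ bj^-1)); first exact: measurable_powR.
  exact: measurable_funM.
rewrite /joint_factor; case: eqP => _.
  apply: measurable_fun_if => //.
  - by apply: measurable_fun_ltr; [exact: measurable_cst|exact: measurable_funM].
  - by apply: measurable_funS mr => //; exact: subIsetl.
apply: measurable_minr => //.
apply: (@measurableT_comp _ _ _ _ _ _ (fun x : R => x `^ aj^-1)); first exact: measurable_powR.
exact: measurable_funM.
Qed.

(** The excluded case [a^ai u = 1] is the jump of the indicator used when [aj = 0]; it concerns a
    single [a], a null set for the integral over [w]. *)
Lemma joint_factor_cvg (x : nat -> R) (a u v : R) : (forall n, 0 <= x n) -> 0 < a ->
  0 <= u -> 0 <= v -> a `^ ai * u != 1 ->
  x n @[n --> \oo] --> a -> joint_factor (x n) u v @[n --> \oo] --> joint_factor a u v.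
Proof.
move=> x0 a0 u0 v0 a1 xa.
have cp e w f : 0 <= e -> 0 <= w -> 0 <= f ->
    (x n `^ e * w) `^ f @[n --> \oo] --> (a `^ e * w) `^ f.
  move=> e0 w0 f0; apply: continuous_powR => //.
  - by rewrite mulr_ge0 ?powR_ge0.
  - by move=> n; rewrite mulr_ge0 ?powR_ge0.
  - by apply: cvgMr_tmp; apply: continuous_powR => //; exact: ltW.
have cr : (x n `^ bi * v) `^ bj^-1 @[n --> \oo] --> (a `^ bi * v) `^ bj^-1.
  by apply: cp => //; rewrite invr_ge0 ltW.
rewrite /joint_factor; case: eqP => _.
  have cpu : x n `^ ai * u @[n --> \oo] --> a `^ ai * u.
    have := cp ai u 1 (ltW ai_gt0) u0 ler01; rewrite powRr1 ?mulr_ge0 ?powR_ge0//.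
    by under eq_cvg do rewrite powRr1 ?mulr_ge0 ?powR_ge0//.
  case: ltgtP a1 => // h _.
    move: cr; apply: cvg_trans; apply: near_eq_cvg.
    have : \forall n \near \oo, 1 < x n `^ ai * u by apply: (cvgr_gt _ cpu).
    by apply: filterS => n /= ->.
  apply: (@cvg_trans _ (cst (0 : R) @ \oo)); last exact: cvg_cst.
  apply: near_eq_cvg.
  have : \forall n \near \oo, x n `^ ai * u < 1 by apply: (cvgr_lt _ cpu).
  by apply: filterS => n hn /=; rewrite ltNge (ltW hn).
apply: cvg_minr => //; apply: cp; rewrite ?(ltW ai_gt0)// invr_ge0//.
Qed.

(** Solving [u = w^ai z^aj], [v = w^bi z^bj] for [w] and [z], the factor at [1 / x] is
    [z (w / x)^(bi / bj)] for [x < w] and [z (w / x)^(ai / aj)] for [x > w] (0 if [aj = 0]). The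
    first exponent is below 1 and the second above 1, so both pieces are integrable; their sum is
    [z w] times the constant of the theorem. *)
Lemma integral_joint_factor u v : 0 <= u -> 0 <= v ->
  let det := ai * bj - aj * bi in
  (\int[mu]_(w in `]0%R, +oo[) (joint_factor w^-1 u v)%:E =
   (det / ((ai - aj) * (bj - bi)) * (u `^ ((bj - bi) / det) * v `^ ((ai - aj) / det)))%:E)%E.
Proof.
move=> u0 v0 det.
have det0 : 0 < det.
  rewrite subr_gt0; apply: (@le_lt_trans _ _ (aj * bj)); first by rewrite ler_wpM2l// ltW.
  by rewrite ltr_pM2r.
have da : 0 < ai - aj by rewrite subr_gt0.
have db : 0 < bj - bi by rewrite subr_gt0.
have g1 : (bj - bi) / det != 0 by rewrite gt_eqF// divr_gt0.
have g2 : (ai - aj) / det != 0 by rewrite gt_eqF// divr_gt0.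
have [->|un] := eqVneq u 0.
  under eq_integral do rewrite joint_factor_u0.
  by rewrite powR0// mul0r mulr0 integral0.
have [->|vn] := eqVneq v 0.
  under eq_integral do rewrite joint_factor_v0.
  by rewrite (powR0 g2)// !mulr0 integral0.
have u1 : 0 < u by rewrite lt_neqAle eq_sym un.
have v1 : 0 < v by rewrite lt_neqAle eq_sym vn.
pose w := (u `^ bj * v `^ (- aj)) `^ det^-1.
pose z := (u `^ (- bi) * v `^ ai) `^ det^-1.
have pp x r : 0 < x -> 0 < x `^ r :> R by move=> ?; exact: powR_gt0.
have w0 : 0 < w by rewrite pp// mulr_gt0// pp.
have z0 : 0 < z by rewrite pp// mulr_gt0// pp.
have wzE e f : w `^ e * z `^ f = u `^ ((bj * e - bi * f) / det) * v `^ ((ai * f - aj * e) / det).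
  rewrite /w /z -!powRrM !powRM ?powR_ge0// -!powRrM mulrACA -!(powRDgt0 _ _ u1) -!(powRDgt0 _ _ v1).
  by congr (_ `^ _ * _ `^ _); ring.
move: w z w0 z0 wzE => w z w0 z0 wzE.
have wzu : w `^ ai * z `^ aj = u.
  rewrite wzE (_ : bj * ai - bi * aj = det); last by rewrite /det; ring.
  rewrite (_ : ai * aj - aj * ai = 0); last by ring.
  by rewrite mul0r powRr0 mulr1 divff ?gt_eqF// powRr1.
have wzv : w `^ bi * z `^ bj = v.
  rewrite wzE (_ : bj * bi - bi * bj = 0); last by ring.
  by rewrite mul0r powRr0 mul1r divff ?gt_eqF// powRr1.
have pE x : 0 < x -> x^-1 `^ ai * u = (w / x) `^ ai * z `^ aj.
  by move=> x0; rewrite -wzu powRM ?invr_ge0 ?ltW// mulrA [_ * w `^ _]mulrC.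
have rE x : 0 < x -> (x^-1 `^ bi * v) `^ bj^-1 = z * (w / x) `^ (bi / bj).
  move=> x0; rewrite -wzv mulrA [_ * w `^ _]mulrC -powRM ?invr_ge0 ?ltW//.
  rewrite powRM ?powR_ge0// (powRK _ (ltW z0)) ?gt_eqF//.
  by rewrite -powRrM mulrC.
have mjf : measurable_fun (`]0%R, +oo[%classic : set R) (fun x : R => joint_factor x^-1 u v).
  apply: (eq_measurable_fun (fun x : R => joint_factor (x `^ (-1)) u v)).
    by move=> x /set_mem /=; rewrite in_itv /= andbT => x0; rewrite powR_inv1// ltW.
  apply: measurable_joint_factor => //.
  by apply: measurable_funTS; exact: measurable_powR.
have bb : 0 <= bi / bj < 1.
  by rewrite divr_ge0 ?(ltW bj_gt0)// ltr_pdivrMr// mul1r.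
have wx1 x : 0 < x -> (1 < w / x) = (x < w) by move=> x0; rewrite ltr_pdivlMr// mul1r.
have zw : z * w = u `^ ((bj - bi) / det) * v `^ ((ai - aj) / det).
  have := wzE 1 1; rewrite !powRr1 ?(ltW w0) ?(ltW z0)// mulrC !mulr1.
  by move=> ->.
rewrite -zw.
have [aj_0|ajn] := eqVneq aj 0.
  rewrite (integral_split_at w0); [|exact/measurable_EFinP|]; last first.
    by move=> x _; rewrite lee_fin joint_factor_ge0.
  rewrite [X in (_ + X)%E](_ : _ = 0)%E; last first.
    apply: integral0_eq => x /=; rewrite in_itv /= andbT => wx.
    have x0 : 0 < x by exact: lt_le_trans wx.
    rewrite /joint_factor aj_0 eqxx pE// aj_0 powRr0 mulr1 ifF//.
    apply/negbTE; rewrite -leNgt; apply: powR_le1; first exact: ltW.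
    by rewrite divr_ge0 ?(ltW w0) ?(ltW x0)// ler_pdivrMr// mul1r.
  rewrite adde0.
  transitivity (\int[mu]_(x in `]0%R, w[) (z * (w / x) `^ (bi / bj))%:E)%E.
    apply: eq_integral => x /set_mem /=; rewrite in_itv /= => /andP[x0 xw].
    rewrite /joint_factor aj_0 eqxx pE// aj_0 powRr0 mulr1 rE// ifT//.
    by apply: powR_gt1 => //; rewrite wx1.
  rewrite integral_scaled_power// ?(ltW z0)//; congr EFin.
  rewrite /det aj_0 mul0r !subr0; field.
  by rewrite !gt_eqF.
have aj_gt0 : 0 < aj by rewrite lt_neqAle eq_sym ajn.
rewrite (@integral_two_powers _ z w (bi / bj) (ai / aj))// ?(ltW z0)//; first last.
- move=> x x0; rewrite /joint_factor (negbTE ajn) pE// rE//.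
  rewrite [X in Num.min X _](_ : _ = z * (w / x) `^ (ai / aj)); last first.
    by rewrite powRM ?powR_ge0// (powRK _ (ltW z0)) ?gt_eqF// -powRrM mulrC.
  have le_e : bi / bj <= ai / aj.
    by rewrite ler_pdivrMr// mulrAC ler_pdivlMr// mulrC -subr_ge0 ltW.
  have wx0 : 0 < w / x by rewrite divr_gt0.
  case: ifPn => [xw|].
    apply/min_idPr; rewrite ler_pM2l//; apply: ler_powR => //.
    by rewrite ltW// wx1.
  rewrite -leNgt => wx; apply/min_idPl; rewrite ler_pM2l//.
  by apply: ger_powR => //; rewrite wx0 ler_pdivrMr// mul1r.
- by rewrite ltr_pdivlMr// mul1r.
congr EFin; rewrite /det; field.
by rewrite !gt_eqF.
Qed.

End JointFactor.

Lemma right_continuous_scale {R : realType} (f : R -> R) (y c : R) : 0 < y ->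
  right_continuous f -> right_continuous (fun a => f (y * a) / c).
Proof.
move=> y0 frc x; apply: cvgM; last exact: cvg_cst.
apply/cvgrPdist_lt => e e0.
have frc' : f z @[z --> (y * x)^'+] --> f (y * x) by exact: frc.
have /cvgrPdist_lt/(_ e e0) := frc'.
move=> [D /= D0 HD]; exists (D / y) => /=; first by rewrite divr_gt0.
move=> z /=; rewrite ltr_pdivlMr// => xz lt_xz; apply: HD => /=; last by rewrite ltr_pM2l.
by rewrite -mulrBr normrM gtr0_norm// mulrC.
Qed.

(** Monotonicity substitutes for uniform convergence: [f n (M n)] lies between the values of [f n]
    at two fixed points close to [m]. *)
Lemma monotone_cvg_id {R : realType} (f : nat -> R -> R) (M : nat -> R) (m : R) :
  0 < m -> (forall n x y, x <= y -> f n x <= f n y) ->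
  (forall c, 0 < c -> f n c @[n --> \oo] --> c) ->
  M n @[n --> \oo] --> m -> f n (M n) @[n --> \oo] --> m.
Proof.
move=> m0 fnd fc Mm; apply/cvgrPdist_le => e e0.
pose c := Num.max (m - e / 2) (m / 2).
have c0 : 0 < c by rewrite lt_max divr_gt0// orbT.
have cm : c < m by rewrite gt_max; apply/andP; split; lra.
have cl : m - e / 2 <= c by rewrite le_max lexx.
have me0 : 0 < m + e / 2 by rewrite addr_gt0// divr_gt0.
near=> n.
have h1 : c < M n by near: n; apply: (cvgr_gt m Mm).
have h2 : M n < m + e / 2 by near: n; apply: (cvgr_lt m Mm); rewrite ltrDl divr_gt0.
have h3 : c - e / 2 < f n c.
  by near: n; apply: (cvgr_gt c (fc c c0)); rewrite ltrBlDr ltrDl divr_gt0.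
have h4 : f n (m + e / 2) < m + e / 2 + e / 2.
  by near: n; apply: (cvgr_lt _ (fc _ me0)); rewrite ltrDl divr_gt0.
have h5 := fnd n _ _ (ltW h1); have h6 := fnd n _ _ (ltW h2).
by rewrite ler_distlC; apply/andP; split; lra.
Unshelve. all: by end_near. Qed.

Section TwoLargeFactors.
Context {R : realType} {d : measure_display} {T : measurableType d}.
Variables (P : probability T R) (X : nat -> {RV P >-> R}).
Hypothesis X_ge0 : forall i t, 0 <= X i t.
Hypothesis X_indep : mutually_independent X.
Hypothesis X_ident : identically_distributed X.
Hypothesis X_regvar : forall i, regularly_varying_m1 (X i).
Local Notation tl := (tail X).
Local Notation mu := (@lebesgue_measure R).
Let tl_gt0 x : 0 < tl x. Proof. exact: tail_gt0 X_regvar x. Qed.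

Lemma tail_rc : right_continuous tl.
Proof.
have -> : tl = fine \o ccdf (X 0).
  by apply/funext => x; rewrite /tail /prob /= /ccdf /distribution /pushforward gt_preimage.
move=> x; apply: fine_cvg; have := @ccdf_right_continuous _ _ _ _ (X 0) x.
by rewrite fineK// fin_num_measure.
Qed.

Lemma tail_lim0 : tl x @[x --> +oo] --> 0.
Proof. exact: tail_cvg0 tl_gt0 (tail_le1 X_ident) (tail_ni X_ident) (tail_rv X_regvar). Qed.

Definition tail_quantile (y : R) : R -> R := quantile (fun a => tl (y * a) / tl y).

Section ScaledTail.
Variable y : R.
Hypothesis y0 : 0 < y.
Let G a := tl (y * a) / tl y.

Lemma quotient_ni a b : a <= b -> G b <= G a.
Proof. by move=> ab; rewrite ler_pM2r ?invr_gt0// (tail_ni X_ident)// ler_pM2l. Qed.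

Lemma quotient_rc : right_continuous G.
Proof. exact: right_continuous_scale tail_rc. Qed.

Lemma quotient_cvg0 : G x @[x --> +oo] --> 0.
Proof.
rewrite -[X in _ --> X](mul0r (tl y)^-1); apply: cvgM; last exact: cvg_cst.
apply: (cvg_comp _ _ _ tail_lim0); apply/cvgryPge => A.
near=> x; rewrite mulrC -ler_pdivrMr//; near: x; exact: nbhs_pinfty_ge.
Unshelve. all: by end_near. Qed.

Lemma tail_quantile_ge0 w : 0 <= tail_quantile y w.
Proof. exact: quantile_ge0 quotient_ni quotient_cvg0 w. Qed.

Lemma tail_quantileP w a : 0 < w -> 0 <= a -> (a < tail_quantile y w) = (w < tl (y * a) / tl y).
Proof. by move=> w0 a0; rewrite /tail_quantile (quantileP quotient_ni quotient_rc quotient_cvg0). Qed.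

Lemma measurable_tail_quantile : measurable_fun setT (tail_quantile y).
Proof. exact: measurable_quantile quotient_ni quotient_rc quotient_cvg0. Qed.

Lemma scaled_tail_nd a b : a <= b -> scaled_tail X y a <= scaled_tail X y b.
Proof.
move=> ab; rewrite /scaled_tail; case: ltP => a0; last first.
  by case: ltP => // _; exact: ltW.
have b0 := lt_le_trans a0 ab; rewrite b0 (tail_ni X_ident)//.
by rewrite ler_pM2l// lef_pV2.
Qed.

Lemma integral_tail_quantile i (h : R -> R) : measurable_fun setT h -> (forall a, 0 <= h a) -> h 0 = 0 ->
  (\int[P]_t (h (X i t / y))%:E =
   (tl y)%:E * \int[mu]_(w in `]0%R, +oo[) (h (tail_quantile y w))%:E)%E.
Proof.
move=> mh h0 hz.
rewrite (@integral_quantile _ _ _ P (fun t => X i t / y) G (tl y) h quotient_ni quotient_rc quotient_cvg0)//.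
- by apply: measurable_funM.
- by move=> t; rewrite divr_ge0// ltW.
- move=> a a0; rewrite /G mulrC divfK ?gt_eqF// -(P_gt X_ident i); congr (P _).
  by apply/seteqP; split => t /=; rewrite ltr_pdivlMr// mulrC.
Qed.

End ScaledTail.

Lemma scaled_tail_cvg (y M : nat -> R) (m : R) : y n @[n --> \oo] --> +oo ->
  0 < m -> M n @[n --> \oo] --> m ->
  scaled_tail X (y n) (M n) / tl (y n) @[n --> \oo] --> m.
Proof.
move=> yoo m0 Mm.
(* [scaled_tail] is monotone for positive levels only; the cut at 1 ensures this for every [n] and
   changes nothing eventually. *)
pose f n a := scaled_tail X (Num.max 1 (y n)) a / tl (y n).
have mx1 n : 0 < Num.max 1 (y n) by rewrite lt_max ltr01.
have y1 : \forall n \near \oo, 1 <= y n by move/cvgryPge: yoo; exact.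
suff h : f n (M n) @[n --> \oo] --> m.
  move: h; apply: cvg_trans; apply: near_eq_cvg; apply: filterS y1 => n h.
  by rewrite /f; move/max_idPr: h => ->.
apply: monotone_cvg_id => //.
  by move=> n a b ab; rewrite ler_pM2r ?invr_gt0// scaled_tail_nd.
move=> c c0.
have : tl (c^-1 * y n) / tl (y n) @[n --> \oo] --> c.
  have := tail_rv X_regvar (s := c^-1); rewrite invrK invr_gt0 => /(_ c0) h.
  exact: (cvg_comp _ _ yoo h).
apply: cvg_trans; apply: near_eq_cvg; apply: filterS y1 => n h.
by rewrite /f /scaled_tail c0 [_ / c]mulrC; move/max_idPr: h => ->.
Qed.

(** By [tail_quantileP], comparing the quantile with [c] is comparing [w] with the tail ratio at
    [c], which tends to [1 / c]. *)
Lemma tail_quantile_cvg (y : nat -> R) (w : R) : y n @[n --> \oo] --> +oo -> 0 < w ->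
  tail_quantile (y n) w @[n --> \oo] --> w^-1.
Proof.
move=> yoo w0; set m := w^-1; have m0 : 0 < m by rewrite invr_gt0.
have lim a : 0 < a -> tl (y n * a) / tl (y n) @[n --> \oo] --> a^-1.
  move=> a0; under eq_cvg do rewrite [_ * a]mulrC.
  exact: (cvg_comp _ _ yoo (tail_rv X_regvar a0)).
have y1 : \forall n \near \oo, 0 < y n by move/cvgryPgt: yoo; exact.
apply/cvgrPdist_le => e e0.
pose c := Num.max (m - e) (m / 2).
have c0 : 0 < c by rewrite lt_max divr_gt0// orbT.
have cm : c < m by rewrite gt_max; apply/andP; split; lra.
have cl : m - e <= c by rewrite le_max lexx.
have me0 : 0 < m + e by rewrite addr_gt0.
near=> n.
have yn0 : 0 < y n by near: n.
have h1 : c < tail_quantile (y n) w.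
  rewrite (tail_quantileP yn0)//; last exact: ltW.
  near: n; apply: (cvgr_gt _ (lim c c0)).
  by rewrite -[X in X < _]invrK ltf_pV2// posrE.
have h2 : tail_quantile (y n) w <= m + e.
  rewrite leNgt (tail_quantileP yn0)//; last exact: ltW.
  rewrite -leNgt; apply: ltW.
  near: n; apply: (cvgr_lt _ (lim _ me0)).
  by rewrite -[X in _ < X]invrK ltf_pV2// ?posrE// ltrDl.
by rewrite ler_distlC; apply/andP; split; lra.
Unshelve. all: by end_near. Qed.

(* Potter's bounds are inverted with a smaller exponent [del < eta], so that the right-hand side
   is integrable over ]0, +oo[. *)
Lemma tail_quantile_bound (eta : R) : 0 < eta < 1 -> exists C y0 r1 r2 : R,
  [/\ 0 < C, 0 < y0, 0 <= r1 < 1, 1 < r2 &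
  forall y w, y0 <= y -> 0 < w ->
    Num.min (tail_quantile y w `^ (1 + eta)) (tail_quantile y w `^ (1 - eta)) <=
      if w < C then 4 * (C / w) `^ r1 else 4 * (C / w) `^ r2].
Proof.
move=> /andP[eta0 eta1]; pose del := eta / 2.
have del01 : 0 < del < 1 by apply/andP; rewrite /del; split; lra.
have /andP[del0 del1] := del01.
have [C [y0 [C1 y00 H1 H2]]] := potter tl_gt0 (tail_le1 X_ident)
  (tail_ni X_ident) (tail_rv X_regvar) del01.
have C0 : 0 < C by exact: lt_le_trans C1.
have d1 : 0 < 1 - del by rewrite subr_gt0.
have d2 : 0 < 1 + del by rewrite addr_gt0.
have e1 : 0 < 1 - eta by rewrite subr_gt0.
exists C, y0, ((1 - eta) / (1 - del)), ((1 + eta) / (1 + del)); split => //.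
- by rewrite divr_ge0 ?(ltW e1) ?(ltW d1)// ltr_pdivrMr// mul1r /del; lra.
- by rewrite ltr_pdivlMr// mul1r /del; lra.
move=> y w hy w0.
have yy0 : 0 < y by exact: lt_le_trans hy.
have := tail_quantile_ge0 yy0 w; rewrite le_eqVlt => /orP[/eqP <-|q0].
  have -> : Num.min (0 `^ (1 + eta)) (0 `^ (1 - eta)) = 0 :> R.
    by rewrite !powR0 ?gt_eqF// ?addr_gt0// minxx.
  by case: ifP => _; rewrite mulr_ge0 ?powR_ge0.
(* A point strictly below the quantile, so that [tail_quantileP] applies. Returning from [a] to [q]
   costs at most [2^2 = 4], the exponents being at most 2. *)
set q := tail_quantile y w in q0 *; pose a := q / 2.
have a0 : 0 < a by rewrite divr_gt0.
have qa : q = 2 * a by rewrite /a; field.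
have wa : w < tl (y * a) / tl y.
  by rewrite -(tail_quantileP yy0)//; [rewrite -/q qa; lra|exact: ltW].
have Cw0 : 0 < C / w by rewrite divr_gt0.
have two_le e : 0 <= e <= 2 -> q `^ e <= 4 * a `^ e.
  move=> /andP[e0 e2]; rewrite qa powRM ?(ltW a0)// ler_wpM2r ?powR_ge0//.
  rewrite (_ : 4 = 2 `^ 2)%R; first by apply: ler_powR => //; lra.
  by rewrite powR_mulrn//; ring.
have h_lo : a <= 1 -> a `^ (1 + del) <= C / w.
  move=> a1; rewrite ler_pdivlMr// mulrC -ler_pdivlMr ?powR_gt0// -powRN.
  rewrite opprD; apply: ltW; apply: (lt_le_trans wa); rewrite ler_pdivrMr//.
  by apply: H2 => //; rewrite a0.
have h_hi : 1 <= a -> a `^ (1 - del) < C / w.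
  move=> a1; rewrite ltr_pdivlMr// mulrC -ltr_pdivlMr ?powR_gt0// -powRN opprB addrC.
  by apply: (lt_le_trans wa); rewrite ler_pdivrMr//; exact: H1.
have pe e f g : 0 < f -> 0 <= e -> a `^ f <= g -> a `^ e <= g `^ (e / f).
  move=> f0 ep h; have g0 : 0 <= g := le_trans (powR_ge0 _ _) h.
  rewrite (_ : a `^ e = (a `^ f) `^ (e / f)); last first.
    by rewrite -powRrM mulrCA divff ?gt_eqF// mulr1.
  by apply: le_powR; rewrite ?powR_ge0// divr_ge0// ltW.
have m1 : Num.min (q `^ (1 + eta)) (q `^ (1 - eta)) <= 4 * a `^ (1 - eta).
  by apply: (@le_trans _ _ (q `^ (1 - eta))); [rewrite ge_min lexx orbT|apply: two_le; lra].
have m2 : Num.min (q `^ (1 + eta)) (q `^ (1 - eta)) <= 4 * a `^ (1 + eta).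
  by apply: (@le_trans _ _ (q `^ (1 + eta))); [rewrite ge_min lexx|apply: two_le; lra].
case: ltP => wC.
  apply: (le_trans m1); rewrite ler_pM2l//.
  have [a1|a1] := leP a 1; last by apply: pe; rewrite ?(ltW e1)// ltW// h_hi// ltW.
  apply: (@le_trans _ _ 1).
    by apply: powR_le1; [exact: ltW|rewrite (ltW a0)].
  apply: powR_ge1; first by rewrite divr_ge0 ?(ltW e1) ?(ltW d1).
  by rewrite ler_pdivlMr// mul1r ltW.
apply: (le_trans m2); rewrite ler_pM2l//.
have [a1|a1] := leP a 1; first by apply: pe => //; [rewrite addr_ge0// ltW|exact: h_lo].
have := h_hi (ltW a1); rewrite ltNge => /negP[]; apply: (@le_trans _ _ 1).
  by rewrite ler_pdivrMr// mul1r.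
by apply: powR_ge1 => //; exact: ltW.
Qed.

(** At [m = 0] there is no positive point below for the monotone sandwich; instead Potter's bound
    tends to 0 with [M]. *)
Lemma scaled_tail_cvg_ge0 (y M : nat -> R) (m : R) : y n @[n --> \oo] --> +oo ->
  (forall n, 0 <= M n) -> 0 <= m -> M n @[n --> \oo] --> m ->
  scaled_tail X (y n) (M n) / tl (y n) @[n --> \oo] --> m.
Proof.
move=> yoo M0; rewrite le_eqVlt => /orP[/eqP <-|m0]; last exact: scaled_tail_cvg.
move=> M0lim.
have eta01 : 0 < (2^-1 : R) < 1 by rewrite invr_gt0 ltr0n invf_lt1 ?ltr1n.
have /andP[eta0 eta1] := eta01.
have [C [y0 [C0 y00 H]]] := scaled_tail_potter X_ident X_regvar eta01.
have e1 : 0 < 1 - 2^-1 :> R by rewrite subr_gt0.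
have e2 : 0 < 1 + 2^-1 :> R by rewrite addr_gt0.
have up : C * (M n `^ (1 + 2^-1) + M n `^ (1 - 2^-1)) @[n --> \oo] --> 0.
  rewrite [X in _ --> X](_ : _ = C * (0 `^ (1 + 2^-1) + 0 `^ (1 - 2^-1))); last first.
    by rewrite !powR0 ?gt_eqF// addr0 mulr0.
  apply: cvgM; first exact: cvg_cst.
  by apply: cvgD; apply: continuous_powR => //; exact: ltW.
apply: squeeze_cvgr (cvg_cst 0) up.
have : \forall n \near \oo, y0 <= y n by move/cvgryPge: yoo; exact.
apply: filterS => n yn; rewrite H// andbT divr_ge0 ?scaled_tail_ge0 ?(ltW (tl_gt0 _))//.
Qed.

Section InnerIntegral.
Variables ai aj bi bj : R.
Hypotheses (aj0 : 0 <= aj) (aij : aj < ai) (bi0 : 0 <= bi) (bij : bi < bj).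
Let det := ai * bj - aj * bi.
Local Notation JF := (joint_factor ai aj bi bj).

Lemma det_gt0 : 0 < det.
Proof.
rewrite subr_gt0; apply: (@le_lt_trans _ _ (aj * bj)); first by rewrite ler_wpM2l// ltW.
by rewrite ltr_pM2r// (le_lt_trans bi0).
Qed.

(* The exponents [c1, c2] of [u, v] solve [ai c1 + bi c2 = th], [aj c1 + bj c2 = th']. *)
Definition corner (th th' u v : R) : R :=
  u `^ ((th * bj - th' * bi) / det) * v `^ ((ai * th' - aj * th) / det).

(** The first exponent is the power taken of the quantile, the second that of the joint factor;
    Potter's bounds need [1 + eta] and [1 - eta] for each, hence four terms. *)
Definition corners (eta u v : R) : R :=
  corner (1 + eta) (1 + eta) u v + corner (1 - eta) (1 + eta) u v +
  (corner (1 + eta) (1 - eta) u v + corner (1 - eta) (1 - eta) u v).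

Lemma corner_ge0 th th' u v : 0 <= corner th th' u v.
Proof. by rewrite mulr_ge0 ?powR_ge0. Qed.

Variable eta : R.
Hypothesis eta01 : 0 < eta < 1.
Hypothesis eta_a : eta * (ai + aj) <= ai - aj.
Hypothesis eta_b : eta * (bj + bi) <= bj - bi.

(** At [th = th' = 1] both exponents are strictly positive; [eta_a] and [eta_b] say exactly that
    they stay nonnegative on the whole square. *)
Lemma corner_exponents_ge0 th th' : 1 - eta <= th -> th <= 1 + eta ->
  1 - eta <= th' -> th' <= 1 + eta ->
  0 <= (th * bj - th' * bi) / det /\ 0 <= (ai * th' - aj * th) / det.
Proof.
move=> h1 h2 h1' h2'.
have ai0 : 0 < ai by exact: le_lt_trans aij.
have bj0 : 0 < bj by exact: le_lt_trans bij.
split; rewrite divr_ge0// ?(ltW det_gt0)// subr_ge0.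
  apply: (@le_trans _ _ ((1 + eta) * bi)); first by rewrite ler_wpM2r.
  apply: (@le_trans _ _ ((1 - eta) * bj)); last by rewrite ler_wpM2r// ltW.
  rewrite -subr_ge0 (_ : _ - _ = bj - bi - eta * (bj + bi)) ?subr_ge0//; ring.
rewrite mulrC [ai * _]mulrC.
apply: (@le_trans _ _ ((1 + eta) * aj)); first by rewrite ler_wpM2r.
apply: (@le_trans _ _ ((1 - eta) * ai)); last by rewrite ler_wpM2r// ltW.
rewrite -subr_ge0 (_ : _ - _ = ai - aj - eta * (ai + aj)) ?subr_ge0//; ring.
Qed.

Lemma joint_factor_corners a u v th' : 0 <= a -> 0 <= u -> 0 <= v ->
  1 - eta <= th' <= 1 + eta ->
  JF a u v `^ th' <= Num.min (a `^ (1 + eta)) (a `^ (1 - eta)) *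
    (corner (1 + eta) th' u v + corner (1 - eta) th' u v).
Proof.
move=> a0 u0 v0 /andP[th1 th2]; have /andP[eta0 eta1] := eta01.
have ai0 : 0 < ai by exact: le_lt_trans aij.
have bj0 : 0 < bj by exact: le_lt_trans bij.
have th'0 : 0 < th' by lra.
have d0 := det_gt0.
have key th : 1 - eta <= th <= 1 + eta -> JF a u v `^ th' <= a `^ th * corner th th' u v.
  move=> /andP[h1 h2]; rewrite /corner; apply: (joint_factor_le aj0 aij bi0 bij) => //.
  - exact: (corner_exponents_ge0 h1 h2 th1 th2).1.
  - exact: (corner_exponents_ge0 h1 h2 th1 th2).2.
  - by rewrite /det; field; exact: (lt0r_neq0 d0).
  - by rewrite /det; field; exact: (lt0r_neq0 d0).
rewrite minElt; case: ifP => _.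
  apply: (le_trans (key (1 + eta) _)); first by rewrite lexx andbT; lra.
  by rewrite ler_wpM2l ?powR_ge0// lerDl corner_ge0.
apply: (le_trans (key (1 - eta) _)); first by rewrite lexx /=; lra.
by rewrite ler_wpM2l ?powR_ge0// lerDr corner_ge0.
Qed.

(** For [y, y' > 0]: the probability of the rescaled event given [U = u], [V = v] and [X_i / y]
    equal to its quantile at [w], divided by the tail of [X_j] at [y']. *)
Definition inner_integrand (y y' u v w : R) : R := scaled_tail X y' (JF (tail_quantile y w) u v) / tl y'.

Lemma inner_integrand_ge0 y y' u v w : 0 <= inner_integrand y y' u v w.
Proof. by rewrite divr_ge0 ?scaled_tail_ge0 ?(ltW (tl_gt0 _)). Qed.

Lemma measurable_inner_integrand y y' u v : 0 < y -> measurable_fun setT (inner_integrand y y' u v).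
Proof.
move=> y0; apply: measurable_funM => //.
apply: (measurableT_comp (measurable_scaled_tail X y')).
apply: measurable_joint_factor => //; exact: measurable_tail_quantile.
Qed.

(** The bound separates [(u, v)] from [w], so it dominates the inner integral in [w] and, after
    integration of [g], the outer one over [(U, V)]. *)
Lemma inner_dominated : exists (g : R -> R) (y0 : R),
  [/\ 0 < y0, mu.-integrable (`]0%R, +oo[%classic : set R) (EFin \o g),
   forall w, 0 <= g w &
   forall y y' u v w, y0 <= y -> y0 <= y' -> 0 <= u -> 0 <= v -> 0 < w ->
     inner_integrand y y' u v w <= corners eta u v * g w].
Proof.
have /andP[eta0 eta1] := eta01.
have [C1 [y1 [C10 y10 H1]]] := scaled_tail_potter X_ident X_regvar eta01.
have [C2 [y2 [r1 [r2 [C20 y20 r1_01 r2_1 H2]]]]] := tail_quantile_bound eta01.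
pose h w := if w < C2 then 4 * (C2 / w) `^ r1 else 4 * (C2 / w) `^ r2.
have h0 w : 0 <= h w by rewrite /h; case: ifP => _; rewrite mulr_ge0 ?powR_ge0.
have mh : measurable_fun (`]0%R, +oo[%classic : set R) h.
  apply: (eq_measurable_fun (fun w : R => if w < C2 then 4 * C2 `^ r1 * w `^ (- r1)
    else 4 * C2 `^ r2 * w `^ (- r2))).
    by move=> w /set_mem /=; rewrite in_itv /= andbT /h => w0; rewrite -!scaled_power.
  apply: measurable_funTS; apply: measurable_fun_ifT.
  - by apply: measurable_fun_ltr; [exact: measurable_id|exact: measurable_cst].
  - by apply: measurable_funM; [exact: measurable_cst|exact: measurable_powR].
  - by apply: measurable_funM; [exact: measurable_cst|exact: measurable_powR].
exists (fun w => C1 * h w), (Num.max y1 y2); split.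
- by rewrite lt_max y10.
- apply/integrableP; split.
    by apply/measurable_EFinP; apply: measurable_funM.
  rewrite (_ : integral _ _ _ = (C1%:E * \int[mu]_(w in `]0%R, +oo[) (h w)%:E)%E); last first.
    rewrite -ge0_integralZl ?lee_fin ?(ltW C10)//; first last.
    - by move=> w _; rewrite lee_fin.
    - exact/measurable_EFinP.
    by apply: eq_integral => w _ /=; rewrite ger0_norm// mulr_ge0// ltW.
  rewrite (@integral_two_powers _ 4 C2 r1 r2)//.
  by rewrite -EFinM ltry.
- by move=> w; rewrite mulr_ge0// ltW.
move=> y y' u v w; rewrite !ge_max => /andP[_ hy] /andP[hy' _] u0 v0 w0.
have yy0 : 0 < y by exact: lt_le_trans hy.
apply: (le_trans (H1 _ _ hy' (joint_factor_ge0 _ _ _ _ _ _ _))).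
rewrite mulrCA ler_pM2l// /corners mulrDl.
have mh' := H2 y w hy w0.
apply: lerD.
  apply: (le_trans (joint_factor_corners (tail_quantile_ge0 yy0 w) u0 v0 _)); first by apply/andP; split; lra.
  by rewrite mulrC ler_wpM2l ?addr_ge0 ?corner_ge0.
apply: (le_trans (joint_factor_corners (tail_quantile_ge0 yy0 w) u0 v0 _)); first by apply/andP; split; lra.
by rewrite mulrC ler_wpM2l ?addr_ge0 ?corner_ge0.
Qed.

Lemma inner_bound : exists B y0 : R, [/\ 0 <= B, 0 < y0 &
  forall y y' u v, y0 <= y -> y0 <= y' -> 0 <= u -> 0 <= v ->
   (\int[mu]_(w in `]0%R, +oo[) (inner_integrand y y' u v w)%:E <= (B * corners eta u v)%:E)%E].
Proof.
have [g [y0 [y00 ig g0 H]]] := inner_dominated.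
pose B := fine (\int[mu]_(w in `]0%R, +oo[) (g w)%:E)%E.
have BE : (\int[mu]_(w in `]0%R, +oo[) (g w)%:E = B%:E)%E.
  by rewrite fineK// (integrable_fin_num _ ig).
exists B, y0; split => //.
  by rewrite -lee_fin -BE integral_ge0// => w _; rewrite lee_fin.
move=> y y' u v hy hy' u0 v0.
have yy0 : 0 < y by exact: lt_le_trans hy.
have c0 : 0 <= corners eta u v by rewrite !addr_ge0 ?corner_ge0.
apply: (@le_trans _ _ (\int[mu]_(w in `]0%R, +oo[) ((corners eta u v)%:E * (g w)%:E))%E).
  apply: ge0_le_integral => //.
  - by move=> w _; rewrite lee_fin inner_integrand_ge0.
  - by apply/measurable_EFinP; apply: measurable_funTS; exact: measurable_inner_integrand.
  - by apply: emeasurable_funM; [exact: measurable_cst|have /integrableP[] := ig].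
  - by move=> w /=; rewrite in_itv /= andbT => w0; rewrite -EFinM lee_fin H.
rewrite ge0_integralZl// ?BE -?EFinM 1?mulrC//.
- by have /integrableP[] := ig.
- by move=> w _; rewrite lee_fin.
Qed.

Lemma inner_cvg (y y' : nat -> R) u v : 0 <= u -> 0 <= v ->
  y n @[n --> \oo] --> +oo -> y' n @[n --> \oo] --> +oo ->
  (\int[mu]_(w in `]0%R, +oo[) (inner_integrand (y n) (y' n) u v w)%:E @[n --> \oo] -->
   \int[mu]_(w in `]0%R, +oo[) (JF w^-1 u v)%:E)%E.
Proof.
move=> u0 v0 yoo y'oo.
have ai0 : 0 < ai by exact: le_lt_trans aij.
have [g [y0 [y00 ig g0 H]]] := inner_dominated.
have c0 : 0 <= corners eta u v by rewrite !addr_ge0 ?corner_ge0.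
pose ok n := (y0 <= y n) && (y0 <= y' n).
have okn : \forall n \near \oo, ok n.
  have h1 : \forall n \near \oo, y0 <= y n by move/cvgryPge: yoo; exact.
  have h2 : \forall n \near \oo, y0 <= y' n by move/cvgryPge: y'oo; exact.
  by apply: filterS2 h1 h2 => n a b; rewrite /ok a.
pose f n w := (if ok n then inner_integrand (y n) (y' n) u v w else 0)%:E.
pose D : set R := `]0%R, +oo[%classic.
have mD : measurable D by exact: measurable_itv.
have [|||||_ _ cM] := @dominated_convergence _ _ R mu D mD f
  (fun w => (JF w^-1 u v)%:E) (fun w => (corners eta u v)%:E * (g w)%:E)%E.
- move=> n; apply/measurable_EFinP; rewrite /f.
  have [/andP[hy _]|_] := boolP (ok n); last exact: measurable_cst.
  by apply: measurable_funTS; apply: measurable_inner_integrand; exact: lt_le_trans hy.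
- apply/measurable_EFinP.
  apply: (eq_measurable_fun (fun w : R => JF (w `^ (-1)) u v)).
    by move=> w /set_mem; rewrite /D /= in_itv /= andbT => w0; rewrite powR_inv1// ltW.
  apply: measurable_joint_factor => //.
  by apply: measurable_funTS; exact: measurable_powR.
(* The only [w] at which [w^(-ai) u = 1], the possible discontinuity of the joint factor. *)
- exists [set u `^ ai^-1]; split => //; first exact: lebesgue_measure_set1.
  move=> w /= /not_implyP[]; rewrite /D /= in_itv /= andbT => w0 nlim.
  apply: contrapT => wu; apply: nlim; apply: cvg_EFin; first exact: nearW.
  have wV0 : 0 < w^-1 by rewrite invr_gt0.
  have h1 : w^-1 `^ ai * u != 1.
    apply/eqP => h; apply: wu.
    have -> : u = w `^ ai.
      rewrite -[LHS]mul1r -(_ : w `^ ai * w^-1 `^ ai = 1) ?mulr1.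
        by rewrite -mulrA h mulr1.
      by rewrite -powRM ?(ltW w0) ?(ltW wV0)// divff ?gt_eqF// powR1.
    by rewrite powRK ?gt_eqF// ltW.
  pose z n := if ok n then tail_quantile (y n) w else 1.
  have z0 n : 0 <= z n.
    rewrite /z; case: ifPn => // /andP[hy _]; apply: tail_quantile_ge0; exact: lt_le_trans hy.
  have zlim : z n @[n --> \oo] --> w^-1.
    have := tail_quantile_cvg yoo w0; apply: cvg_trans; apply: near_eq_cvg.
    by apply: filterS okn => n; rewrite /z => ->.
  have Jlim := joint_factor_cvg aj0 aij bi0 bij z0 wV0 u0 v0 h1 zlim.
  have := scaled_tail_cvg_ge0 y'oo (fun n => joint_factor_ge0 _ _ _ _ _ _ _)
    (joint_factor_ge0 _ _ _ _ _ _ _) Jlim.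
  apply: cvg_trans; apply: near_eq_cvg.
  by apply: filterS okn => n ho; rewrite /= /f /z ho.
- exact: integrableZl.
- apply: nearW => w n; rewrite /D /= in_itv /= andbT => w0.
  rewrite -EFinM /f; case: ifPn => [/andP[hy hy']|_].
    by rewrite ger0_norm ?inner_integrand_ge0// lee_fin H.
  by rewrite normr0 lee_fin mulr_ge0.
move: cM; apply: cvg_trans; apply: near_eq_cvg.
by apply: filterS okn => n ho; rewrite /= /f ho.
Qed.

End InnerIntegral.

End TwoLargeFactors.

Section TwoLargeFactorsLimit.
Context {R : realType} {d : measure_display} {T : measurableType d}.
Variables (P : probability T R) (X : nat -> {RV P >-> R}).
Hypothesis X_ge0 : forall i t, 0 <= X i t.
Hypothesis X_indep : mutually_independent X.
Hypothesis X_ident : identically_distributed X.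
Hypothesis X_regvar : forall i, regularly_varying_m1 (X i).
Variables (a b : nat -> R) (Sa Sb : R).
Hypothesis a0 : forall m, 0 <= a m.
Hypothesis b0 : forall m, 0 <= b m.
Hypothesis sum_a : forall n, \sum_(0 <= m < n) a m <= Sa.
Hypothesis sum_b : forall n, \sum_(0 <= m < n) b m <= Sb.
Hypothesis uba : {ae P, forall t, upbounded a (X^~ t)}.
Hypothesis ubb : {ae P, forall t, upbounded b (X^~ t)}.
Local Notation Y0 := (fun t => pprodoo xpredT a (X^~ t)).
Local Notation Y1 := (fun t => pprodoo xpredT b (X^~ t)).
Local Notation tl := (tail X).
Local Notation mu := (@lebesgue_measure R).
Let tl_gt0 x : 0 < tl x. Proof. exact: tail_gt0 X_regvar x. Qed.

Variables (i j : nat).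
Hypotheses (ij : i != j) (aij : a j < a i) (bij : b i < b j).
Let det := a i * b j - a j * b i.
Let det0 : 0 < det. Proof. exact: det_gt0. Qed.
Let others : pred nat := fun m => (m != i) && (m != j).
Local Notation U := (fun t => pprodoo others a (X^~ t)).
Local Notation V := (fun t => pprodoo others b (X^~ t)).
Local Notation JF := (joint_factor (a i) (a j) (b i) (b j)).
Local Notation inner := (inner_integrand X (a i) (a j) (b i) (b j)).
Let gamma m := (a m * (b j - b i) + b m * (a i - a j)) / det.
Let g1 := (b j - b i) / det.
Let g2 := (a i - a j) / det.

(** At [r = r' = 1] the exponent is [gamma m <= m0 < 1]. Moving [r] and [r'] by [eta] adds at most
    [eta K], uniformly in [m] since each [a m] and [b m] is bounded by the sum of its series; [eta]
    is small enough that half of the gap to 1 remains. *)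
Lemma corner_margin (m0 : R) : m0 < 1 -> (forall m, others m -> gamma m <= m0) ->
  exists eta th : R, [/\ 0 < eta < 1, eta * (a i + a j) <= a i - a j,
    eta * (b j + b i) <= b j - b i, 0 < th < 1 &
    forall r r' m, 1 - eta <= r <= 1 + eta -> 1 - eta <= r' <= 1 + eta -> others m ->
      (r * b j - r' * b i) / det * a m + (a i * r' - a j * r) / det * b m <= th].
Proof.
move=> m01 Hm.
have ai0 : 0 < a i by exact: le_lt_trans aij.
have bj0 : 0 < b j by exact: le_lt_trans bij.
have sa0 : 0 < a i + a j by rewrite ltr_wpDr.
have sb0 : 0 < b j + b i by rewrite ltr_wpDr.
have da : 0 < a i - a j by rewrite subr_gt0.
have db : 0 < b j - b i by rewrite subr_gt0.
have aS m : a m <= Sa.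
  by apply: le_trans (sum_a m.+1); rewrite big_nat_recr//= lerDr sumr_ge0.
have bS m : b m <= Sb.
  by apply: le_trans (sum_b m.+1); rewrite big_nat_recr//= lerDr sumr_ge0.
have Sa0 : 0 <= Sa by exact: le_trans (a0 0%N) (aS 0%N).
have Sb0 : 0 <= Sb by exact: le_trans (b0 0%N) (bS 0%N).
pose m1 := Num.max m0 0.
have m11 : m1 < 1 by rewrite gt_max m01 ltr01.
have m10 : 0 <= m1 by rewrite le_max lexx orbT.
have m0m1 : m0 <= m1 by rewrite le_max lexx.
pose K := (b j + b i) / det * Sa + (a i + a j) / det * Sb.
have K0 : 0 <= K by rewrite addr_ge0// mulr_ge0// divr_ge0// ltW.
pose th := (1 + m1) / 2.
pose eta := Num.min (Num.min (1 / 2) ((1 - m1) / 2 / (K + 1)))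
  (Num.min ((a i - a j) / (a i + a j)) ((b j - b i) / (b j + b i))).
have K1 : 0 < K + 1 by rewrite ltr_wpDl.
have eta0 : 0 < eta.
  rewrite !lt_min !divr_gt0//= subr_gt0 m11//.
have e1 : eta <= 1 / 2 by rewrite !ge_min lexx.
have e2 : eta * (K + 1) <= (1 - m1) / 2.
  by rewrite -ler_pdivlMr// !ge_min lexx orbT.
have e3 : eta * (a i + a j) <= a i - a j.
  by rewrite -ler_pdivlMr// !ge_min lexx !orbT.
have e4 : eta * (b j + b i) <= b j - b i.
  by rewrite -ler_pdivlMr// !ge_min lexx !orbT.
exists eta, th; split => //.
- by apply/andP; split => //; lra.
- by apply/andP; rewrite /th; split; lra.
move=> r r' m /andP[r1 r2] /andP[r'1 r'2] /Hm gm.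
have h1 : (r * b j - r' * b i) / det <= g1 + eta * ((b j + b i) / det).
  rewrite /g1 mulrA -mulrDl ler_pM2r ?invr_gt0//.
  have := ler_wpM2r (ltW bj0) r2; have := ler_wpM2r (b0 i) r'1; lra.
have h2 : (a i * r' - a j * r) / det <= g2 + eta * ((a i + a j) / det).
  rewrite /g2 mulrA -mulrDl ler_pM2r ?invr_gt0//.
  have := ler_wpM2l (ltW ai0) r'2; have := ler_wpM2l (a0 j) r1; lra.
apply: (le_trans (lerD (ler_wpM2r (a0 m) h1) (ler_wpM2r (b0 m) h2))).
have -> : (g1 + eta * ((b j + b i) / det)) * a m + (g2 + eta * ((a i + a j) / det)) * b m =
    gamma m + eta * ((b j + b i) / det * a m + (a i + a j) / det * b m).
  by rewrite /gamma /g1 /g2; ring.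
have h3 : (b j + b i) / det * a m + (a i + a j) / det * b m <= K.
  by apply: lerD; apply: ler_wpM2l; rewrite ?divr_ge0// ltW.
have h4 : eta * ((b j + b i) / det * a m + (a i + a j) / det * b m) <= (1 - m1) / 2.
  apply: le_trans e2; rewrite ler_pM2l//; apply: (le_trans h3); lra.
by rewrite /th; lra.
Qed.

Variables (ki kj m0 s0 s1 : R).
Hypotheses (ki0 : 0 < ki) (kj0 : 0 < kj).
Hypotheses (tight_a : a i * ki + a j * kj = 1) (tight_b : b i * ki + b j * kj = 1).
Hypotheses (m01 : m0 < 1) (gamma_le : forall m, others m -> gamma m <= m0).
Hypotheses (s0_gt0 : 0 < s0) (s1_gt0 : 0 < s1).

Let Us t := U t / s0.
Let Vs t := V t / s1.
Let Us0 t : 0 <= Us t.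
Proof. by rewrite divr_ge0 ?(ltW s0_gt0)// pprodoo_ge0. Qed.
Let Vs0 t : 0 <= Vs t.
Proof. by rewrite divr_ge0 ?(ltW s1_gt0)// pprodoo_ge0. Qed.

Let mUs : measurable_fun setT Us.
Proof. by apply: measurable_funM => //; exact: measurable_pprodoo. Qed.
Let mVs : measurable_fun setT Vs.
Proof. by apply: measurable_funM => //; exact: measurable_pprodoo. Qed.

Let mUs_off k : ~~ others k -> measurable_fun [set: off X k] (Us : off X k -> R).
Proof. by move=> hk; apply: measurable_funM => //; exact: measurable_pprodoo_off. Qed.
Let mVs_off k : ~~ others k -> measurable_fun [set: off X k] (Vs : off X k -> R).
Proof. by move=> hk; apply: measurable_funM => //; exact: measurable_pprodoo_off. Qed.
Let others_i : ~~ others i. Proof. by rewrite /others eqxx. Qed.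
Let others_j : ~~ others j. Proof. by rewrite /others eqxx andbF. Qed.

(** Tightness of both constraints gives [(x^ki)^(a_i) (x^kj)^(a_j) = x], and the same for [b];
    dividing [X_i] and [X_j] by their scales therefore removes [x] from both conditions. *)
Lemma joint_event x : 0 < x ->
  prob P [set t | Y0 t > s0 * x /\ Y1 t > s1 * x] =
  prob P [set t | X j t * JF (X i t / x `^ ki) (Us t) (Vs t) > x `^ kj].
Proof.
move=> x0.
have yi0 : 0 < x `^ ki by exact: powR_gt0.
have yj0 : 0 < x `^ kj by exact: powR_gt0.
apply: prob_eq.
- by apply: measurable_gt2; exact: measurable_pprodoo.
- apply: measurable_mul_gt; apply: measurable_joint_factor => //.
  exact: measurable_funM.
apply: filterS2 uba ubb => t ua ub /=.
have Xt0 k : 0 <= X k t by exact: X_ge0.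
have field_id (A B W s D E : R) : s != 0 -> D != 0 -> E != 0 ->
    A / D * (B / E) * (W / s) = A * (B * W) / (s * (D * E)).
  by move=> s_n0 D_n0 E_n0; field; rewrite s_n0 D_n0 E_n0.
have D1 (c : nat -> R) : (forall m, 0 <= c m) -> upbounded c (X^~ t) ->
    pprodoo xpredT c (X^~ t) = X i t `^ c i * (X j t `^ c j * pprodoo others c (X^~ t)).
  move=> c0 uc; rewrite (pprodoo_D1 c0 Xt0 uc (i := i))//; congr (_ * _).
  by rewrite (pprodoo_D1 c0 Xt0 uc (i := j))//= eq_sym.
rewrite (D1 a)// (D1 b)//.
have -> : (x `^ kj < X j t * JF (X i t / x `^ ki) (Us t) (Vs t)) =
    (1 < X j t / x `^ kj * JF (X i t / x `^ ki) (Us t) (Vs t)).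
  by rewrite mulrAC ltr_pdivlMr// mul1r.
have Xi0 : 0 <= X i t / x `^ ki by rewrite divr_ge0// ltW.
have Xj0 : 0 <= X j t / x `^ kj by rewrite divr_ge0// ltW.
have key (e f s W : R) : 0 < s -> e * ki + f * kj = 1 ->
    (s * x < X i t `^ e * (X j t `^ f * W)) =
    (1 < (X i t / x `^ ki) `^ e * (X j t / x `^ kj) `^ f * (W / s)).
  move=> s_gt0 ef.
  have xE : (x `^ ki) `^ e * (x `^ kj) `^ f = x.
    by rewrite -!powRrM -powRDgt0// mulrC (mulrC kj) ef powRr1// ltW.
  rewrite (powRM _ (Xt0 i)) ?invr_ge0 ?(ltW yi0)// (powRM _ (Xt0 j)) ?invr_ge0 ?(ltW yj0)//.
  have inv e' y : 0 < y -> y^-1 `^ e' = (y `^ e')^-1 :> R.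
    by move=> y0; rewrite powRV ?powRN// ltW.
  rewrite !inv//.
  rewrite (_ : _ * _ * (W / s) =
    X i t `^ e * (X j t `^ f * W) / (s * ((x `^ ki) `^ e * (x `^ kj) `^ f))).
    by rewrite xE ltr_pdivlMr ?mulr_gt0// mul1r.
  by apply: field_id; rewrite gt_eqF// powR_gt0.
rewrite (key (a i) (a j))// (key (b i) (b j))//.
have := Vs0 t; have := Us0 t; rewrite /Us /Vs => U_ge0 V_ge0.
by apply: joint_factorP.
Qed.

Section AtScale.
Variables yi yj : R.
Hypotheses (yi0 : 0 < yi) (yj0 : 0 < yj).
Let f (z : R * (R * R)) := (scaled_tail X yj (JF (z.1 / yi) z.2.1 z.2.2))%:E.
Let inner_int t := (\int[mu]_(w in `]0%R, +oo[) (inner yi yj (Us t) (Vs t) w)%:E)%E.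

Let f_ge0 z : (0 <= f z)%E. Proof. by rewrite lee_fin scaled_tail_ge0. Qed.

Let measurable_f d' (T' : measurableType d') (x u v : T' -> R) :
  measurable_fun setT x -> measurable_fun setT u -> measurable_fun setT v ->
  measurable_fun setT (fun t => f (x t, (u t, v t))).
Proof.
move=> mx mu' mv; apply/measurable_EFinP.
apply: (measurableT_comp (measurable_scaled_tail X yj)).
by apply: measurable_joint_factor => //; exact: measurable_funM.
Qed.

Let inner_intE t :
  (\int[P]_s f (X i s, (Us t, Vs t)) = (tl yi * tl yj)%:E * inner_int t)%E.
Proof.
transitivity ((tl yi)%:E * \int[mu]_(w in `]0%R, +oo[)
    ((tl yj)%:E * (inner yi yj (Us t) (Vs t) w)%:E))%E.
  pose h a := scaled_tail X yj (JF a (Us t) (Vs t)).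
  transitivity (\int[P]_s (h (X i s / yi))%:E)%E; first by [].
  rewrite (integral_tail_quantile X_ge0 X_ident X_regvar yi0).
  - congr (_ * _)%E; apply: eq_integral => w _; rewrite -EFinM /inner_integrand; congr EFin.
    by rewrite mulrC divfK// gt_eqF.
  - apply: (measurableT_comp (measurable_scaled_tail X yj)).
    exact: measurable_joint_factor.
  - by move=> z; exact: scaled_tail_ge0.
  - by rewrite /h joint_factor0// /scaled_tail ltxx.
rewrite ge0_integralZl//.
- by rewrite muleA -EFinM.
- by apply/measurable_EFinP; apply: measurable_funTS; exact: measurable_inner_integrand.
- by move=> w _; rewrite lee_fin inner_integrand_ge0.
- by rewrite lee_fin ltW.
Qed.

(** Rewritten as an integral over [P] by [inner_intE], the parameter integral is measurable by
    Tonelli's theorem. *)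
Lemma measurable_inner_int : measurable_fun setT inner_int.
Proof.
have -> : inner_int = fun t => (((tl yi * tl yj)^-1)%:E * \int[P]_s f (X i s, (Us t, Vs t)))%E.
  apply/funext => t; rewrite inner_intE muleA -EFinM mulVf ?mul1e//.
  by rewrite gt_eqF// mulr_gt0.
apply: emeasurable_funM; first exact: measurable_cst.
pose F (z : T * T) := f (X i z.2, (Us z.1, Vs z.1)).
apply: (@measurable_fun_fubini_tonelli_F _ _ _ _ R P F); last by move=> z; exact: f_ge0.
by apply: measurable_f; apply: measurableT_comp.
Qed.

(** [X_j] is integrated out first, given all other variables; then [X_i], given [(U, V)], through
    its quantile function. Each step releases one tail factor. *)
Lemma joint_tail_inner :
  (P [set t | (X j t * JF (X i t / yi) (Us t) (Vs t) > yj)%R] =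
   (tl yi * tl yj)%:E * \int[P]_t inner_int t)%E.
Proof.
rewrite (prob_mul_off X_indep X_ident yj0); first last.
- apply: (@measurable_joint_factor _ _ _ _ _ _ (off X j)) => //; last 2 first.
  + exact: mUs_off.
  + exact: mVs_off.
  + by apply: measurable_funM => //; exact: (measurable_off ij).
- by move=> t; exact: joint_factor_ge0.
transitivity (\int[P]_t f (X i t, (Us t, Vs t)))%E; first by [].
rewrite (integral_off X_indep (f := f) (W := fun t => (Us t, Vs t))) => //; first last.
- apply: (@measurable_f _ (R * (R * R))%type (fun z => z.1) (fun z => z.2.1) (fun z => z.2.2)) => //.
  + exact: measurable_fst.
  + exact: measurableT_comp.
  + exact: measurableT_comp.
- by apply: (@measurable_fun_pair _ _ _ (off X i)); [exact: mUs_off|exact: mVs_off].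
under eq_integral do rewrite inner_intE.
rewrite ge0_integralZl//.
- exact: measurable_inner_int.
- by move=> t _; apply: integral_ge0 => w _; rewrite lee_fin inner_integrand_ge0.
- by rewrite lee_fin mulr_ge0// ltW.
Qed.

End AtScale.

Lemma integrable_corner eta th r r' : 0 < eta < 1 -> eta * (a i + a j) <= a i - a j ->
  eta * (b j + b i) <= b j - b i -> 0 < th < 1 ->
  1 - eta <= r <= 1 + eta -> 1 - eta <= r' <= 1 + eta ->
  (forall m, others m ->
    (r * b j - r' * b i) / det * a m + (a i * r' - a j * r) / det * b m <= th) ->
  P.-integrable setT (fun t => (corner (a i) (a j) (b i) (b j) r r' (Us t) (Vs t))%:E).
Proof.
move=> eta01 eta_a eta_b th01 /andP[h1 h2] /andP[h1' h2'] Hm.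
have [c10 c20] := corner_exponents_ge0 (a0 j) aij (b0 i) bij eta_a eta_b h1 h2 h1' h2'.
rewrite -/det in c10 c20.
have mc : measurable_fun setT (fun t => corner (a i) (a j) (b i) (b j) r r' (Us t) (Vs t)).
  by apply: measurable_funM; exact: (measurableT_comp (measurable_powR _)).
apply/integrableP; split; first exact/measurable_EFinP.
under eq_integral do rewrite /= ger0_norm ?corner_ge0//.
have IUV := integral_pprodoo_lty X_ge0 X_indep X_ident X_regvar a0 b0 sum_a sum_b uba ubb
  c10 c20 th01 Hm.
set c1 := _ / det in c10 IUV; set c2 := _ / det in c20 IUV.
apply: (integral_scaled_lty (g := fun t => U t `^ c1 * V t `^ c2) (K := s0^-1 `^ c1 * s1^-1 `^ c2)) => //.
- by rewrite mulr_ge0 ?powR_ge0.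
- by apply: measurable_funM; apply: (measurableT_comp (measurable_powR _)); exact: measurable_pprodoo.
- by move=> t; exact: corner_ge0.
- by move=> t; rewrite mulr_ge0 ?powR_ge0.
apply: nearW => t; rewrite /corner -/c1 -/c2 /Us /Vs.
rewrite (powRM _ (pprodoo_ge0 others a _)) ?invr_ge0 ?(ltW s0_gt0)//.
rewrite (powRM _ (pprodoo_ge0 others b _)) ?invr_ge0 ?(ltW s1_gt0)//.
by rewrite mulrACA mulrC.
Qed.

Lemma two_large :
  let C := det / ((a i - a j) * (b j - b i)) in
  let Z := infprod others (fun m t => X m t `^ gamma m) in
  ('E_P[Z])%E \is a fin_num /\
  prob P [set t | Y0 t > s0 * x /\ Y1 t > s1 * x] / (tl (x `^ ki) * tl (x `^ kj))
    @[x --> +oo] --> C * fine ('E_P[Z])%E * (s0 `^ (b i - b j) * s1 `^ (a j - a i)) `^ (1 / det).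
Proof.
move=> C Z.
have da : 0 < a i - a j by rewrite subr_gt0.
have db : 0 < b j - b i by rewrite subr_gt0.
have C0 : 0 < C by rewrite divr_gt0// mulr_gt0.
have g10 : 0 <= g1 by rewrite divr_ge0// ltW.
have g20 : 0 <= g2 by rewrite divr_ge0// ltW.
have [eta [th [eta01 eta_a eta_b th01 Hth]]] := corner_margin m01 gamma_le.
have /andP[eta0 eta1] := eta01.
have [B [y0 [B0 y00 HB]]] := inner_bound X_ident X_regvar (a0 j) aij (b0 i) bij eta01 eta_a eta_b.
have icorners : P.-integrable setT
    (fun t => (corners (a i) (a j) (b i) (b j) eta (Us t) (Vs t))%:E).
  have rp : 1 - eta <= 1 + eta <= 1 + eta by rewrite lexx andbT; lra.
  have rm : 1 - eta <= 1 - eta <= 1 + eta by rewrite lexx /=; lra.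
  have ic r r' (hr : 1 - eta <= r <= 1 + eta) (hr' : 1 - eta <= r' <= 1 + eta) :=
    integrable_corner eta01 eta_a eta_b th01 hr hr' (fun m => Hth r r' m hr hr').
  pose c r r' t := (corner (a i) (a j) (b i) (b j) r r' (Us t) (Vs t))%:E.
  apply: (eq_integrable measurableT (fun t =>
    c (1 + eta)%R (1 + eta)%R t + c (1 - eta)%R (1 + eta)%R t +
    (c (1 + eta)%R (1 - eta)%R t + c (1 - eta)%R (1 - eta)%R t))%E).
    by move=> t _; rewrite /c -!EFinD.
  by apply: integrableD => //; apply: integrableD => //; exact: ic.
(* The limit of the inner integrals, as computed by [integral_joint_factor]. *)
pose L t := C * (Us t `^ g1 * Vs t `^ g2).
have mL : measurable_fun setT L.
  apply: measurable_funM => //.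
  by apply: measurable_funM; exact: (measurableT_comp (measurable_powR _)).
pose W t := U t `^ g1 * V t `^ g2.
have mW : measurable_fun setT W.
  by apply: measurable_funM; apply: (measurableT_comp (measurable_powR _)); exact: measurable_pprodoo.
pose K := s0 `^ (- g1) * s1 `^ (- g2).
have LE t : L t = C * K * W t.
  rewrite /L /Us /Vs /W.
  rewrite (powRM _ (pprodoo_ge0 others a _)) ?invr_ge0 ?(ltW s0_gt0)//.
  rewrite (powRM _ (pprodoo_ge0 others b _)) ?invr_ge0 ?(ltW s1_gt0)//.
  have regroup (c p q r s : R) : c * (p * r * (q * s)) = c * (r * s) * (p * q).
    by ring.
  by rewrite (powRV _ (ltW s0_gt0)) (powRV _ (ltW s1_gt0)) regroup.
have K0 : 0 < K by rewrite mulr_gt0// powR_gt0.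
have Z_W : {ae P, forall t, Z t = W t}.
  apply: filterS2 uba ubb => t ua ub.
  have Xt0 k : 0 <= X k t by exact: X_ge0.
  rewrite /W -(pprodoo_comb others a0 b0 Xt0 g10 g20 ua ub).
  rewrite /Z /infprod /pprodoo /pprod; congr (limn _); apply/funext => n.
  by apply: eq_bigr => m _; congr (_ `^ _); rewrite /gamma /g1 /g2; ring.
have mZ : measurable_fun setT Z.
  by apply: measurable_infprod => m _; exact: (measurableT_comp (measurable_powR _)).
have EZ : ('E_P[Z] = \int[P]_t (W t)%:E)%E.
  rewrite unlock; apply: ae_eq_integral => //.
  - exact/measurable_EFinP.
  - exact/measurable_EFinP.
  - by apply: filterS Z_W => t -> _.
have W0 t : 0 <= W t by rewrite mulr_ge0 ?powR_ge0.
have IL : (\int[P]_t (L t)%:E = (C * K)%:E * 'E_P[Z])%E.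
  transitivity (\int[P]_t ((C * K)%:E * (W t)%:E))%E.
    by apply: eq_integral => t _; rewrite LE EFinM.
  rewrite EZ ge0_integralZl//.
  - exact/measurable_EFinP.
  - by move=> t _; rewrite lee_fin.
  - by rewrite lee_fin mulr_ge0// ltW.
have main (u : nat -> R) : u n @[n --> \oo] --> +oo ->
    P.-integrable setT (EFin \o L) /\
    prob P [set t | Y0 t > s0 * u n /\ Y1 t > s1 * u n] / (tl (u n `^ ki) * tl (u n `^ kj))
      @[n --> \oo] --> fine (\int[P]_t (L t)%:E)%E.
  move=> uoo.
  have yoo k : 0 < k -> u n `^ k @[n --> \oo] --> +oo.
    by move=> k0; exact: (cvg_comp u _ uoo (cvg_powR_pinfty k0)).
  pose ok n := [&& 0 < u n, y0 <= u n `^ ki & y0 <= u n `^ kj].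
  have okn : \forall n \near \oo, ok n.
    have h0 : \forall n \near \oo, 0 < u n by move/cvgryPgt: uoo; exact.
    have h1 : \forall n \near \oo, y0 <= u n `^ ki by have /cvgryPge := yoo _ ki0; exact.
    have h2 : \forall n \near \oo, y0 <= u n `^ kj by have /cvgryPge := yoo _ kj0; exact.
    by apply: filterS3 h0 h1 h2 => n p q r; rewrite /ok p q.
  pose I n t := (\int[mu]_(w in `]0%R, +oo[)
    (inner (u n `^ ki) (u n `^ kj) (Us t) (Vs t) w)%:E)%E.
  pose f n t := if ok n then I n t else 0%E.
  have I0 n t : (0 <= I n t)%E.
    by apply: integral_ge0 => w _; rewrite lee_fin inner_integrand_ge0.
  have [|||||iL _ cL] := @dominated_convergence _ T R P setT measurableT f (EFin \o L)
    (fun t => B%:E * (corners (a i) (a j) (b i) (b j) eta (Us t) (Vs t))%:E)%E.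
  - move=> n; rewrite /f; have [/and3P[u0 _ _]|_] := boolP (ok n); last exact: measurable_cst.
    by apply: measurable_inner_int; exact: powR_gt0.
  - exact/measurable_EFinP.
  - apply: nearW => t _.
    have := inner_cvg X_ident X_regvar (a0 j) aij (b0 i) bij eta01 eta_a eta_b (Us0 t) (Vs0 t)
      (yoo _ ki0) (yoo _ kj0).
    rewrite (integral_joint_factor (a0 j) aij (b0 i) bij (Us0 t) (Vs0 t)).
    apply: cvg_trans; apply: near_eq_cvg.
    by apply: filterS okn => n ho; rewrite /f ho.
  - exact: integrableZl.
  - apply: nearW => t n _; rewrite -EFinM /f; case: ifPn => [/and3P[_ hi hj]|_].
      by rewrite gee0_abs//; exact: HB.
    by rewrite abse0 lee_fin mulr_ge0// /corners !addr_ge0 ?corner_ge0.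
  split => //.
  have fL : (\int[P]_t (L t)%:E)%E \is a fin_num by exact: integrable_fin_num iL.
  have : (\int[P]_t f n t @[n --> \oo] --> (fine (\int[P]_t (L t)%:E))%:E)%E.
    by rewrite fineK.
  move=> /fine_cvgP[ffin]; apply: cvg_trans; apply: near_eq_cvg.
  apply: filterS2 ffin okn => n fn ho; have /and3P[u0 _ _] := ho.
  rewrite /= joint_event// /prob joint_tail_inner ?powR_gt0//.
  move: fn; rewrite /f ho => fn.
  by rewrite fineM//= mulrAC divff ?mul1r// gt_eqF// mulr_gt0.
have fL : (\int[P]_t (L t)%:E)%E \is a fin_num.
  have [iL _] := main (fun n => n%:R) ltac:(by apply/cvgryPge => A; exact: nbhs_infty_ger).
  exact: integrable_fin_num iL.
have CK : 0 < C * K by rewrite mulr_gt0.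
have fZ : ('E_P[Z])%E \is a fin_num.
  have -> : ('E_P[Z] = ((C * K)^-1)%:E * \int[P]_t (L t)%:E)%E.
    by rewrite IL muleA -EFinM mulVf ?mul1e// gt_eqF.
  by rewrite fin_numM.
split => //.
have -> : C * fine ('E_P[Z])%E * (s0 `^ (b i - b j) * s1 `^ (a j - a i)) `^ (1 / det) =
    fine (\int[P]_t (L t)%:E)%E.
  rewrite IL fineM//= mulrAC; congr (_ * _ * _).
  rewrite powRM ?powR_ge0// -!powRrM /K /g1 /g2 div1r -!mulNr !opprB.
  by [].
by apply/cvg_pinftyP => u uoo; have [_] := main u uoo.
Qed.

End TwoLargeFactorsLimit.

(** * Consequences of uniqueness *)

(** Only finitely many terms reach [e / 2]. In this way the strict inequalities that uniqueness
    gives index by index become the uniform margins required by the moment bounds. *)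
Lemma cvg0_bounded_lt {R : realType} (A : pred nat) (u : nat -> R) (e : R) : 0 < e ->
  u n @[n --> \oo] --> 0 -> (forall n, A n -> u n < e) ->
  exists m : R, m < e /\ forall n, A n -> u n <= m.
Proof.
move=> e0 u0 Hu.
have h : \forall n \near \oo, u n < e / 2 by apply: (cvgr_lt _ u0); rewrite divr_gt0.
have [N _ HN] := h.
have [M [Me HM]] : exists M : R, M < e /\ forall n, (n < N)%N -> A n -> u n <= M.
  elim: (N) => [|k [M [Me HM]]]; first by exists 0.
  have [Ak|Ak] := boolP (A k).
    exists (Num.max M (u k)); split; first by rewrite gt_max Me Hu.
    move=> n; rewrite ltnS leq_eqVlt => /predU1P[-> _|nk An].
      by rewrite le_max lexx orbT.
    by rewrite le_max HM.
  exists M; split => // n; rewrite ltnS leq_eqVlt => /predU1P[-> h1|nk An].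
    by rewrite h1 in Ak.
  exact: HM.
exists (Num.max M (e / 2)); split; first by rewrite gt_max Me /=; lra.
move=> n An; rewrite le_max; have [nN|Nn] := ltnP n N; first by rewrite HM.
by rewrite (ltW (HN _ _)) ?orbT.
Qed.

Section UniqueSolution.
Context {R : realType}.
Variables a b kappa : nat -> R.
Hypotheses (a0 : forall m, 0 <= a m) (b0 : forall m, 0 <= b m).
Hypotheses (acv : a @ \oo --> (0 : R)) (bcv : b @ \oo --> (0 : R)).
Hypotheses (a_neq0 : exists i, a i <> 0) (b_neq0 : exists i, b i <> 0).
Hypothesis uniq_k : unique_optimal a b kappa.

Lemma unique_support : exists i j p q, i != j /\ kappa = kappa3 i j i p q 0.
Proof.
have [lam [m [i [j [p [q [[l01 m0 Hm ij] [p0 q0 pq h1 h2]]]]]]]] :=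
  lp_duality a0 b0 acv bcv a_neq0 b_neq0.
exists i, j, p, q; split => //.
have [_ u] := uniq_k; apply/esym/u.
exact: (optimal_kappa2 a0 b0 l01 m0 Hm).
Qed.

Lemma card_unique_support : ([set i | (0 < kappa i)%R] #<= `I_2)%card.
Proof.
have [i [j [p [q [ij kE]]]]] := unique_support.
apply: (card_le_trans (subset_card_le (_ : _ `<=` (fun n => if n == 0%N then i else j) @` `I_2))).
  move=> m /=; rewrite kE /kappa3 mul0r addr0.
  have [->|mi] := eqVneq m i; first by exists 0%N.
  have [->|mj] := eqVneq m j; first by exists 1%N.
  by rewrite !mulr0 addr0 ltxx.
exact: card_image_le.
Qed.

(** The form in which uniqueness yields strict inequalities: a feasible competitor on at most three
    indices that costs no more than [kappa] is [kappa]. *)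
Lemma exchange i j k p q r : 0 <= p -> 0 <= q -> 0 <= r ->
  1 <= p * a i + q * a j + r * a k -> 1 <= p * b i + q * b j + r * b k ->
  ((p + q + r)%:E <= objective kappa)%E -> kappa3 i j k p q r = kappa.
Proof.
move=> p0 q0 r0 h1 h2 h3; have [[_ ok] u] := uniq_k; apply: u; split.
  exact: feasible_kappa3.
by move=> k' fk'; rewrite objective_kappa3; exact: le_trans h3 (ok _ fk').
Qed.

Section TwoPositive.
Variables i j : nat.
Hypotheses (ij : i != j) (ki : 0 < kappa i) (kj : 0 < kappa j).

Lemma kappa_two : kappa = kappa3 i j i (kappa i) (kappa j) 0.
Proof.
have [i' [j' [p [q [ij' kE]]]]] := unique_support.
have val m : kappa m = p * (m == i')%:R + q * (m == j')%:R.
  by rewrite kE /kappa3 mul0r addr0.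
have supp m : 0 < kappa m -> (m == i') || (m == j').
  by rewrite val; case: eqP => // _; case: eqP => // _; rewrite !mulr0 addr0 ltxx.
apply/funext => m; rewrite /kappa3 mul0r addr0.
have [->|mi] := eqVneq m i.
  by rewrite (negbTE ij) mulr1 mulr0 addr0.
have [->|mj] := eqVneq m j; first by rewrite mulr1 mulr0 add0r.
rewrite !mulr0 addr0 val.
have := supp _ ki; have := supp _ kj; move: mi mj ij.
move=> mi mj ij1 /orP[/eqP ej|/eqP ej] /orP[/eqP ei|/eqP ei]; subst.
- by rewrite eqxx in ij1.
- by rewrite (negbTE mi) (negbTE mj) !mulr0 addr0.
- by rewrite (negbTE mi) (negbTE mj) !mulr0 addr0.
- by rewrite eqxx in ij1.
Qed.

Lemma kappa_twoE m : m != i -> m != j -> kappa m = 0.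
Proof. by move=> mi mj; rewrite kappa_two /kappa3 (negbTE mi) (negbTE mj) !mulr0 !addr0. Qed.

Lemma objective_two : objective kappa = (kappa i + kappa j)%:E.
Proof. by rewrite [in LHS]kappa_two objective_kappa3 addr0. Qed.

Lemma constraints_two :
  1 <= kappa i * a i + kappa j * a j /\ 1 <= kappa i * b i + kappa j * b j.
Proof.
have [[[_ h1 h2] _] _] := uniq_k; split.
  move: h1; rewrite (eq_eseriesr (g := fun m => (a m * kappa3 i j i (kappa i) (kappa j) 0 m)%:E)).
    by rewrite nneseries_kappa3 mul0r addr0 lee_fin.
  by move=> m _; rewrite -kappa_two.
move: h2; rewrite (eq_eseriesr (g := fun m => (b m * kappa3 i j i (kappa i) (kappa j) 0 m)%:E)).
  by rewrite nneseries_kappa3 mul0r addr0 lee_fin.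
by move=> m _; rewrite -kappa_two.
Qed.

Lemma no_shift p q : p != kappa i -> 0 <= p -> 0 <= q -> p + q <= kappa i + kappa j ->
  1 <= p * a i + q * a j -> 1 <= p * b i + q * b j -> False.
Proof.
move=> pk p0 q0 pq h1 h2.
have := @exchange i j i p q 0 p0 q0 (lexx 0); rewrite !mul0r !addr0 objective_two lee_fin.
move=> /(_ h1 h2 pq) /(congr1 (fun f => f i)).
by rewrite /kappa3 mul0r addr0 eqxx (negbTE ij) mulr1 mulr0 addr0 => /eqP; apply/negP.
Qed.

(** If one index were at least as good as the other in both constraints, shifting all the mass to it
    would give another optimum. *)
Lemma crossing : (a j < a i /\ b i < b j) \/ (a i < a j /\ b j < b i).
Proof.
have [h1 h2] := constraints_two.
have A : ~ (a j <= a i /\ b j <= b i).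
  move=> [ha hb]; apply: (@no_shift (kappa i + kappa j) 0) => //.
  - by rewrite gt_eqF// ltrDl.
  - by rewrite addr_ge0// ltW.
  - by rewrite addr0.
  - by rewrite mul0r addr0 mulrDl; apply: (le_trans h1); rewrite lerD2l ler_wpM2l// ltW.
  - by rewrite mul0r addr0 mulrDl; apply: (le_trans h2); rewrite lerD2l ler_wpM2l// ltW.
have B : ~ (a i <= a j /\ b i <= b j).
  move=> [ha hb]; apply: (@no_shift 0 (kappa i + kappa j)) => //.
  - by rewrite lt_eqF.
  - by rewrite addr_ge0// ltW.
  - by rewrite add0r.
  - by rewrite mul0r add0r mulrDl; apply: (le_trans h1); rewrite lerD2r ler_wpM2l// ltW.
  - by rewrite mul0r add0r mulrDl; apply: (le_trans h2); rewrite lerD2r ler_wpM2l// ltW.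
have [ha|ha] := ltP (a j) (a i).
  left; split => //; rewrite ltNge; apply/negP => hb; apply: A.
  by split => //; exact: ltW.
right; have hb : b j < b i by rewrite ltNge; apply/negP => hb; apply: B.
split => //; rewrite lt_neqAle ha andbT; apply/eqP => e.
by apply: A; rewrite e lexx; split => //; exact: ltW.
Qed.

Hypotheses (aij : a j < a i) (bij : b i < b j).

(** Slack in one constraint would pay for moving a little mass to the index that favours the other
    constraint, at unchanged cost. *)
Lemma tight_two : a i * kappa i + a j * kappa j = 1 /\ b i * kappa i + b j * kappa j = 1.
Proof.
have [h1 h2] := constraints_two; rewrite !(mulrC (a _)) !(mulrC (b _)).
have da : 0 < a i - a j by rewrite subr_gt0.
have db : 0 < b j - b i by rewrite subr_gt0.
split; apply/eqP; rewrite eq_le; apply/andP; split => //; rewrite leNgt; apply/negP => slack.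
  set s := kappa i * a i + kappa j * a j - 1.
  have s0 : 0 < s by rewrite subr_gt0.
  pose t := Num.min (kappa i) (s / (a i - a j)).
  have t0 : 0 < t by rewrite lt_min ki divr_gt0.
  have t1 : t <= kappa i by rewrite ge_min lexx.
  have t2 : t * (a i - a j) <= s by rewrite -ler_pdivlMr// ge_min lexx orbT.
  apply: (@no_shift (kappa i - t) (kappa j + t)).
  - by rewrite lt_eqF// ltrBlDr ltrDl.
  - by rewrite subr_ge0.
  - by rewrite addr_ge0// ltW.
  - by lra.
  - rewrite (_ : _ + _ = kappa i * a i + kappa j * a j - t * (a i - a j)); last by ring.
    by move: t2; rewrite /s; lra.
  - rewrite (_ : _ + _ = kappa i * b i + kappa j * b j + t * (b j - b i)); last by ring.
    by apply: (le_trans h2); rewrite lerDl mulr_ge0// ltW.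
set s := kappa i * b i + kappa j * b j - 1.
have s0 : 0 < s by rewrite subr_gt0.
pose t := Num.min (kappa j) (s / (b j - b i)).
have t0 : 0 < t by rewrite lt_min kj divr_gt0.
have t1 : t <= kappa j by rewrite ge_min lexx.
have t2 : t * (b j - b i) <= s by rewrite -ler_pdivlMr// ge_min lexx orbT.
apply: (@no_shift (kappa i + t) (kappa j - t)).
- by rewrite gt_eqF// ltrDl.
- by rewrite addr_ge0// ltW.
- by rewrite subr_ge0.
- by lra.
- rewrite (_ : _ + _ = kappa i * a i + kappa j * a j + t * (a i - a j)); last by ring.
  by apply: (le_trans h1); rewrite lerDl mulr_ge0// ltW.
- rewrite (_ : _ + _ = kappa i * b i + kappa j * b j - t * (b j - b i)); last by ring.
  by move: t2; rewrite /s; lra.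
Qed.

(* Otherwise moving mass from [i] and [j] to [k] along the tight constraints would not increase
   the objective. *)
Lemma gamma_lt1 k : k != i -> k != j ->
  (a k * (b j - b i) + b k * (a i - a j)) / (a i * b j - a j * b i) < 1.
Proof.
move=> nki nkj; rewrite ltNge; apply/negP => g1.
have [ta tb] := tight_two.
have det0 := det_gt0 (a0 j) aij (b0 i) bij.
set det := a i * b j - a j * b i in g1 det0.
(* The coordinates of [(a k, b k)] in the basis of the vectors of [i] and [j]; the quotient in the
   statement is [x + y], so a unit of mass at [k] replaces at least one unit in total at [i] and
   [j]. *)
pose x := (a k * b j - b k * a j) / det; pose y := (a i * b k - a k * b i) / det.
have dn : det != 0 by rewrite gt_eqF.
have xy : 1 <= x + y.
  by apply: (le_trans g1); rewrite /x /y -mulrDl ler_pM2r ?invr_gt0//; lra.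
have xa : x * a i + y * a j = a k.
  by rewrite /x /y /det; field; exact: dn.
have xb : x * b i + y * b j = b k.
  by rewrite /x /y /det; field; exact: dn.
clearbody x y.
have mn0 : 0 < Num.min (kappa i) (kappa j) by rewrite lt_min ki.
have N0 : 0 < `|x| + `|y| + 1 by rewrite ltr_wpDl// addr_ge0.
pose t := Num.min (kappa i) (kappa j) / (`|x| + `|y| + 1).
have t0 : 0 < t by rewrite divr_gt0.
have tN : t * (`|x| + `|y| + 1) = Num.min (kappa i) (kappa j) by rewrite divfK// gt_eqF.
have mi : Num.min (kappa i) (kappa j) <= kappa i by rewrite ge_min lexx.
have mj : Num.min (kappa i) (kappa j) <= kappa j by rewrite ge_min lexx orbT.
have tx : t * x <= kappa i.
  apply: le_trans mi; rewrite -tN ler_pM2l// (le_trans (ler_norm x))//.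
  by rewrite -addrA lerDl addr_ge0.
have ty : t * y <= kappa j.
  apply: le_trans mj; rewrite -tN ler_pM2l// (le_trans (ler_norm y))//.
  by rewrite addrAC lerDr addr_ge0.
have := @exchange i j k (kappa i - t * x) (kappa j - t * y) t.
rewrite !subr_ge0 objective_two lee_fin => /(_ tx ty (ltW t0)) h.
have {h} : kappa3 i j k (kappa i - t * x) (kappa j - t * y) t = kappa.
  apply: h.
  - rewrite (_ : _ + _ = a i * kappa i + a j * kappa j - t * (x * a i + y * a j - a k)).
      by rewrite ta xa subrr mulr0 subr0.
    by ring.
  - rewrite (_ : _ + _ = b i * kappa i + b j * kappa j - t * (x * b i + y * b j - b k)).
      by rewrite tb xb subrr mulr0 subr0.
    by ring.
  - rewrite [leLHS](_ : _ = kappa i + kappa j - t * (x + y - 1)); last by ring.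
    by rewrite lerBlDr lerDl mulr_ge0 ?subr_ge0// ltW.
move=> /(congr1 (fun f => f k)).
rewrite (kappa_twoE nki nkj) /kappa3 (negbTE nki) (negbTE nkj) eqxx !mulr0 !add0r mulr1.
by move=> e; rewrite e ltxx in t0.
Qed.

End TwoPositive.

Section OnePositive.
Variable i : nat.
Hypotheses (ki : 0 < kappa i) (k0 : forall j, j <> i -> kappa j = 0).

Lemma kappa_one : kappa = kappa3 i i i (kappa i) 0 0.
Proof.
apply/funext => m; rewrite /kappa3 !mul0r !addr0.
by have [->|/eqP mi] := eqVneq m i; rewrite ?mulr1// mulr0 k0.
Qed.

Lemma objective_one : objective kappa = (kappa i)%:E.
Proof. by rewrite [in LHS]kappa_one objective_kappa3 !addr0. Qed.

Lemma constraints_one : 1 <= kappa i * a i /\ 1 <= kappa i * b i.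
Proof.
have [[[_ h1 h2] _] _] := uniq_k; split.
  move: h1; rewrite (eq_eseriesr (g := fun m => (a m * kappa3 i i i (kappa i) 0 0 m)%:E)).
    by rewrite nneseries_kappa3 !mul0r !addr0 lee_fin.
  by move=> m _; rewrite -kappa_one.
move: h2; rewrite (eq_eseriesr (g := fun m => (b m * kappa3 i i i (kappa i) 0 0 m)%:E)).
  by rewrite nneseries_kappa3 !mul0r !addr0 lee_fin.
by move=> m _; rewrite -kappa_one.
Qed.

(** With [e] the smaller of the two coefficients, [1 / e] is the least mass at [i] that meets both
    constraints. *)
Lemma kappa_oneE e : 0 < e -> e <= a i -> e <= b i -> e = a i \/ e = b i -> kappa i = 1 / e.
Proof.
move=> e0 ea eb eab; have [h1 h2] := constraints_one.
have h : 1 / e <= kappa i by rewrite ler_pdivrMr//; case: eab => ->.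
apply/eqP; rewrite eq_le h andbT leNgt; apply/negP => lt_k.
have : kappa3 i i i (1 / e) 0 0 = kappa.
  apply: exchange => //; rewrite ?mul0r ?addr0.
  - by rewrite divr_ge0// ltW.
  - by rewrite mulrAC mul1r ler_pdivlMr// mul1r.
  - by rewrite mulrAC mul1r ler_pdivlMr// mul1r.
  - by rewrite objective_one lee_fin.
move=> /(congr1 (fun f => f i)); rewrite /kappa3 eqxx !mul0r !addr0 mulr1 => e1.
by rewrite e1 ltxx in lt_k.
Qed.

Lemma coordinates_gt0 : 0 < a i /\ 0 < b i.
Proof.
have [h1 h2] := constraints_one.
by split; rewrite -(pmulr_rgt0 _ ki); exact: lt_le_trans ltr01 _.
Qed.

(** The first constraint has slack here, so some mass could move to an index [j] with [b j >= b i]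
    without violating it. The second constraint would not suffer, against uniqueness. *)
Lemma other_b_lt j : b i < a i -> j <> i -> b j < b i.
Proof.
move=> ba ji; have [_ bi0] := coordinates_gt0.
have kE : kappa i = 1 / b i by apply: kappa_oneE => //; [exact: ltW|right].
rewrite ltNge; apply/negP => bij.
have kb : kappa i * b i = 1 by rewrite kE divfK// gt_eqF.
have ka : 1 < kappa i * a i by rewrite -kb ltr_pM2l.
have ai0 : 0 < a i by exact: lt_trans ba.
pose t := Num.min (kappa i) (kappa i - 1 / a i).
have t0 : 0 < t by rewrite lt_min ki subr_gt0 ltr_pdivrMr.
have t1 : t <= kappa i by rewrite ge_min lexx.
have t2 : t <= kappa i - 1 / a i by rewrite ge_min lexx orbT.
have : kappa3 i j i (kappa i - t) t 0 = kappa.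
  apply: exchange => //; rewrite ?mul0r ?addr0.
  - by rewrite subr_ge0.
  - exact: ltW.
  - apply: (@le_trans _ _ ((kappa i - t) * a i)); last by rewrite lerDl mulr_ge0// ltW.
    by rewrite -ler_pdivrMr// lerBrDl -lerBrDr.
  - rewrite mulrBl kb -addrA lerDl addrC -mulrBr mulr_ge0 ?subr_ge0// ltW//.
  - by rewrite subrK objective_one.
move=> /(congr1 (fun f => f j)); rewrite /= (k0 ji) /kappa3 eqxx !mul0r addr0 mulr1.
by have /eqP/negbTE -> := ji; rewrite mulr0 add0r => e; rewrite e ltxx in t0.
Qed.

(** Minimax for the sequences with index [i] erased. If its value reached [e], the primal solution
    it provides would cost at most [1 / e = kappa i], hence be [kappa], although it uses only
    indices other than [i]. *)
Lemma separating_multiplier e : a i = e -> b i = e ->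
  exists lam m : R, [/\ 0 <= lam <= 1, m < e &
    forall j, j != i -> lam * a j + (1 - lam) * b j <= m].
Proof.
move=> ai bi; have [ai0 _] := coordinates_gt0.
have e0 : 0 < e by rewrite -ai.
pose z (c : nat -> R) j := if j == i then 0 else c j.
have z0 c : (forall m, 0 <= c m) -> forall m, 0 <= z c m.
  by move=> c0 m; rewrite /z; case: ifP.
have zle c : (forall m, 0 <= c m) -> forall m, z c m <= c m.
  by move=> c0 m; rewrite /z; case: ifP.
have zcv (c : nat -> R) : c @ \oo --> (0 : R) -> z c @ \oo --> (0 : R).
  apply: cvg_trans; apply: near_eq_cvg; near=> n.
  have : (i < n)%N by near: n; exact: nbhs_infty_gt.
  by rewrite ltn_neqAle eq_sym /z => /andP[/negbTE ->].
have [lam [m [l01 m0 Hm H]]] := minimax (z0 a a0) (z0 b b0) (zcv a acv) (zcv b bcv).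
exists lam, m; split => //; last first.
  by move=> j ji; have := Hm j; rewrite /z (negbTE ji).
rewrite ltNge; apply/negP => em.
have m_gt0 : 0 < m by exact: lt_le_trans em.
have [i' [j' [p [q [p0 q0 pq h1 h2]]]]] := H m_gt0.
have kE : kappa i = 1 / e by apply: kappa_oneE => //; rewrite ?ai ?bi//; left.
have : kappa3 i' j' i' p q 0 = kappa.
  apply: exchange => //; rewrite ?mul0r ?addr0.
  - by apply: (le_trans h1); apply: lerD; apply: ler_wpM2l => //; exact: zle.
  - by apply: (le_trans h2); apply: lerD; apply: ler_wpM2l => //; exact: zle.
  - by rewrite pq objective_one lee_fin kE div1r lef_pV2.
(* [kappa] vanishes off [i] and the erased sequences vanish at [i], so every term on the right of
   [h1] is 0. *)
move=> kk.
have pz c (x := p) : p * z c i' = 0.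
  rewrite /z; case: eqP => [_|/= i'i]; first by rewrite mulr0.
  have := k0 i'i; rewrite -kk /kappa3 eqxx mul0r addr0 mulr1 => /eqP.
  by rewrite paddr_eq0// ?mulr_ge0// => /andP[/eqP -> _]; rewrite mul0r.
have qz c : q * z c j' = 0.
  rewrite /z; case: eqP => [_|/= j'i]; first by rewrite mulr0.
  have := k0 j'i; rewrite -kk /kappa3 eqxx mul0r addr0 mulr1 => /eqP.
  by rewrite paddr_eq0// ?mulr_ge0// => /andP[_ /eqP ->]; rewrite mul0r.
by move: h1; rewrite pz qz addr0 ler10.
Unshelve. all: by end_near. Qed.

End OnePositive.

End UniqueSolution.

Theorem theorem4p2 (R : realType) (d : measure_display) (T : measurableType d)
    (P : probability T R) (X : nat -> {RV P >-> R}) (alpha beta : nat -> R)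
    (X_ge0 : forall i t, 0 <= X i t)
    (X_indep : mutually_independent X)
    (X_ident : identically_distributed X)
    (X_regvar : forall i, regularly_varying_m1 (X i))
    (alpha_ge0 : forall i, 0 <= alpha i)
    (beta_ge0 : forall i, 0 <= beta i)
    (alpha_neq0 : exists i, alpha i <> 0)
    (beta_neq0 : exists i, beta i <> 0)
    (alpha_summable : (\sum_(0 <= i <oo) (alpha i)%:E < +oo)%E)
    (beta_summable : (\sum_(0 <= i <oo) (beta i)%:E < +oo)%E) :
  {ae P, forall t, cvgn (fun n => \prod_(0 <= i < n) X i t `^ alpha i)} /\
  {ae P, forall t, cvgn (fun n => \prod_(0 <= i < n) X i t `^ beta i)} /\
  let Y0 := infprod xpredT (fun i t => X i t `^ alpha i) in
  let Y1 := infprod xpredT (fun i t => X i t `^ beta i) in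
  0 < prob P [set t | Y0 t > 0] ->
  0 < prob P [set t | Y1 t > 0] ->
  (exists kappa, optimal alpha beta kappa) /\
  forall kappa : nat -> R, optimal alpha beta kappa ->
  let S := fine (objective kappa) in
  [/\
      forall eps : R, 0 < eps ->
        ((fun x : R => prob P [set t | Y0 t > x /\ Y1 t > x])
           =o_ (pinfty_nbhs R) (fun x : R => x `^ (eps - S))) /\
        ((fun x : R => x `^ (- eps - S))
           =o_ (pinfty_nbhs R)
             (fun x : R => prob P [set t | Y0 t > x /\ Y1 t > x])),
      unique_optimal alpha beta kappa -> ([set i | (0 < kappa i)%R] #<= `I_2)%card,
      unique_optimal alpha beta kappa ->
      forall i j : nat, i <> j -> 0 < kappa i -> 0 < kappa j ->
      let det := alpha i * beta j - alpha j * beta i in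
      let gamma := fun m : nat =>
        (alpha m * (beta j - beta i) + beta m * (alpha i - alpha j)) / det in
      let C := `|det| / ((alpha i - alpha j) * (beta j - beta i)) in
      let Z := infprod (fun m => (m != i) && (m != j))
                       (fun m t => X m t `^ gamma m) in
      let D := (C%:E * 'E_P[Z])%E in
      D \is a fin_num /\
      forall s0 s1 : R, 0 < s0 -> 0 < s1 ->
        prob P [set t | Y0 t > s0 * x /\ Y1 t > s1 * x] /
          (prob P [set t | X i t > x `^ kappa i] *
           prob P [set t | X j t > x `^ kappa j])
        @[x --> +oo] -->
        fine D * (s0 `^ (beta i - beta j) * s1 `^ (alpha j - alpha i))
                   `^ (1 / det) &
      unique_optimal alpha beta kappa ->
      forall i : nat, 0 < kappa i -> (forall j, j <> i -> kappa j = 0) ->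
      forall s0 s1 : R, 0 < s0 -> 0 < s1 ->
      let ratio := fun x : R =>
        prob P [set t | Y0 t > s0 * x /\ Y1 t > s1 * x] /
        prob P [set t | X i t > x `^ kappa i] in
      [/\ alpha i = beta i ->
            let Z := fun t : T =>
              Num.min (s0^-1 * infprod (fun j => j != i)
                                 (fun j t => X j t `^ alpha j) t)
                      (s1^-1 * infprod (fun j => j != i)
                                 (fun j t => X j t `^ beta j) t)
                `^ (1 / beta i) in
            let E := 'E_P[Z]%E in
            E \is a fin_num /\ ratio x @[x --> +oo] --> fine E,
          alpha i > beta i ->
            let Z := infprod (fun j => j != i)
              (fun j t => X j t `^ (beta j / beta i) *
                          \1_[set t' | X j t' `^ alpha j > 0] t) in
            let E := 'E_P[Z]%E in
            E \is a fin_num /\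
            ratio x @[x --> +oo] --> fine E * s1 `^ (- (1 / beta i)) &
          alpha i < beta i ->
            let Z := infprod (fun j => j != i)
              (fun j t => X j t `^ (alpha j / alpha i) *
                          \1_[set t' | X j t' `^ beta j > 0] t) in
            let E := 'E_P[Z]%E in
            E \is a fin_num /\
            ratio x @[x --> +oo] --> fine E * s0 `^ (- (1 / alpha i))]].
Proof.
have [Sa HSa] := nneseries_bounded alpha_ge0 alpha_summable.
have [Sb HSb] := nneseries_bounded beta_ge0 beta_summable.
have acv := summable_cvg0 alpha_ge0 HSa.
have bcv := summable_cvg0 beta_ge0 HSb.
have uba := ae_upbounded X_ge0 X_indep X_ident X_regvar alpha_ge0 alpha_summable.
have ubb := ae_upbounded X_ge0 X_indep X_ident X_regvar beta_ge0 beta_summable.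
split; first by apply: filterS uba => t; apply: is_cvg_pprod.
split; first by apply: filterS ubb => t; apply: is_cvg_pprod.
move=> Y0 Y1 Y0pos Y1pos.
have dna := ae_dnprodoo_gt0 X_ge0 X_indep alpha_ge0 uba Y0pos.
have dnb := ae_dnprodoo_gt0 X_ge0 X_indep beta_ge0 ubb Y1pos.
have pos := joint_positivity X_ge0 X_indep X_ident X_regvar alpha_ge0 beta_ge0 uba ubb dna dnb.
have [lam [m [i0 [j0 [p [q [[l01 m0 Hm ij0] [p0 q0 pq h1 h2]]]]]]]] :=
  lp_duality alpha_ge0 beta_ge0 acv bcv alpha_neq0 beta_neq0.
split.
  exists (kappa3 i0 j0 i0 p q 0).
  exact: (optimal_kappa2 alpha_ge0 beta_ge0 l01 m0 Hm).
move=> kappa opt S.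
have SE : S = m^-1.
  by rewrite /S (objective_optimal alpha_ge0 beta_ge0 l01 m0 Hm p0 q0 pq h1 h2 opt).
have tlE k x : prob P [set t | X k t > x] = tail X x := tailE X_ident k x.
split.
- move=> eps eps0; rewrite SE.
  exact: (joint_tail_littleo X_ge0 X_indep X_ident X_regvar alpha_ge0 beta_ge0 HSa HSb uba ubb
    l01 m0 Hm ij0 p0 q0 pq h1 h2 pos eps0).
- exact: card_unique_support.
- move=> uniq i j /eqP ij ki kj det gamma C Z D.
  (* Stated for an arbitrary ordered pair, since [crossing] leaves open which of [i] and [j] favours
     the first constraint. *)
  have two k l s s' : k != l -> 0 < kappa k -> 0 < kappa l ->
      alpha l < alpha k -> beta k < beta l -> 0 < s -> 0 < s' ->
      let det' := alpha k * beta l - alpha l * beta k in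
      let Z' := infprod (fun n => (n != k) && (n != l)) (fun n t => X n t `^
        ((alpha n * (beta l - beta k) + beta n * (alpha k - alpha l)) / det')) in
      ('E_P[Z'])%E \is a fin_num /\
      prob P [set t | Y0 t > s * x /\ Y1 t > s' * x] / (tail X (x `^ kappa k) * tail X (x `^ kappa l))
        @[x --> +oo] --> det' / ((alpha k - alpha l) * (beta l - beta k)) * fine ('E_P[Z'])%E *
        (s `^ (beta k - beta l) * s' `^ (alpha l - alpha k)) `^ (1 / det').
    move=> kl kk kl0 akl bkl s0 s0' det' Z'.
    have [ta tb] := tight_two alpha_ge0 beta_ge0 acv bcv alpha_neq0 beta_neq0 uniq kl kk kl0 akl bkl.
    pose g n := (alpha n * (beta l - beta k) + beta n * (alpha k - alpha l)) / det'.
    have g_lt n : (n != k) && (n != l) -> g n < 1.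
      by move=> /andP[nk nl];
        exact: (gamma_lt1 alpha_ge0 beta_ge0 acv bcv alpha_neq0 beta_neq0 uniq kl kk kl0 akl bkl nk nl).
    have gcv : g n @[n --> \oo] --> 0.
      rewrite [X in _ --> X](_ : _ = (0 * (beta l - beta k) + 0 * (alpha k - alpha l)) / det'); last first.
        by rewrite !mul0r addr0 mul0r.
      by apply: cvgM; [apply: cvgD; apply: cvgM => //|]; exact: cvg_cst.
    have [m1 [m1_lt g_le]] := cvg0_bounded_lt ltr01 gcv g_lt.
    exact: (two_large X_ge0 X_indep X_ident X_regvar alpha_ge0 beta_ge0 HSa HSb uba ubb kl akl bkl
      kk kl0 ta tb m1_lt g_le s0 s0').
  have result : ('E_P[Z])%E \is a fin_num /\ forall s0 s1 : R, 0 < s0 -> 0 < s1 ->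
      prob P [set t | Y0 t > s0 * x /\ Y1 t > s1 * x] /
        (tail X (x `^ kappa i) * tail X (x `^ kappa j)) @[x --> +oo] -->
      C * fine ('E_P[Z])%E *
        (s0 `^ (beta i - beta j) * s1 `^ (alpha j - alpha i)) `^ (1 / det).
    have [[aij bij]|[aij bij]] := crossing alpha_ge0 beta_ge0 acv bcv alpha_neq0 beta_neq0 uniq ij ki kj.
      have det0 : 0 < det := det_gt0 (alpha_ge0 j) aij (beta_ge0 i) bij.
      have CE : C = det / ((alpha i - alpha j) * (beta j - beta i)) by rewrite /C gtr0_norm.
      (* The expectation does not involve the scales, so its finiteness can be read off at scale
         1. *)
      rewrite CE; split; first by have [] := two i j 1 1 ij ki kj aij bij ltr01 ltr01.
      by move=> s0 s1 s0_gt0 s1_gt0; have [] := two i j s0 s1 ij ki kj aij bij s0_gt0 s1_gt0.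
    have ji : j != i by rewrite eq_sym.
    (* Exchanging [i] and [j] changes the sign of the determinant. The constant and the exponents
       [gamma] are invariant, and in the scale factor the base is inverted while its exponent
       changes sign. *)
    pose det' := alpha j * beta i - alpha i * beta j.
    have det0 : 0 < det' := det_gt0 (alpha_ge0 i) aij (beta_ge0 j) bij.
    have detE : det = - det' by rewrite /det /det' opprB.
    have CE : C = det' / ((alpha j - alpha i) * (beta i - beta j)).
      by rewrite /C detE normrN gtr0_norm// -(mulrNN (alpha i - alpha j)) !opprB.
    pose Z' := infprod (fun n => (n != j) && (n != i)) (fun n t => X n t `^
        ((alpha n * (beta i - beta j) + beta n * (alpha j - alpha i)) / det')).
    have ZE : Z = Z'.
      rewrite /Z /Z'; congr infprod; first by apply/funext => n; rewrite andbC.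
      apply/funext => n; apply/funext => t; congr (_ `^ _).
      by rewrite /gamma detE invrN mulrN -mulNr opprD -!mulrN !opprB.
    rewrite CE ZE; split; first by have [] := two j i 1 1 ji kj ki aij bij ltr01 ltr01.
    move=> s0 s1 s0_gt0 s1_gt0; have [_] := two j i s0 s1 ji kj ki aij bij s0_gt0 s1_gt0.
    rewrite -/det' -/Z' detE => lim.
    have -> : s0 `^ (beta i - beta j) * s1 `^ (alpha j - alpha i) =
        (s0 `^ (beta j - beta i) * s1 `^ (alpha i - alpha j))^-1.
      by rewrite -[beta i - beta j]opprB -[alpha j - alpha i]opprB !powRN invfM.
    rewrite powRV ?mulr_ge0 ?powR_ge0// invrN mulrN opprK.
    by under eq_cvg do rewrite [tail X _ * _]mulrC.
  have [fZ lim] := result; split; first by rewrite fin_numM.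
  move=> s0 s1 s0_gt0 s1_gt0; under eq_cvg do rewrite !tlE.
  by rewrite /D fineM//=; exact: lim.
- move=> uniq i ki k0 s0 s1 s0_gt0 s1_gt0 ratio.
  have [ai0 bi0] := coordinates_gt0 uniq ki k0.
  have ratioE e : kappa i = 1 / e -> ratio =
      fun x => prob P [set t | Y0 t > s0 * x /\ Y1 t > s1 * x] / tail X (x `^ (1 / e)).
    by move=> <-; apply/funext => x; rewrite /ratio tlE.
  split.
  + move=> ab Z E.
    have kE : kappa i = 1 / beta i.
      by apply: (kappa_oneE uniq k0) => //; [rewrite ab|right].
    have [lam' [m' [l01' m'e Hm']]] :=
      separating_multiplier alpha_ge0 beta_ge0 acv bcv uniq ki k0 ab erefl.
    rewrite (ratioE _ kE).
    exact: (one_large_eq X_ge0 X_indep X_ident X_regvar alpha_ge0 beta_ge0 HSa HSb uba ubb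
      s0_gt0 s1_gt0 ab erefl bi0 l01' m'e Hm').
  + move=> ab Z E.
    have kE : kappa i = 1 / beta i.
      by apply: (kappa_oneE uniq k0) => //; [exact: ltW|right].
    have b_lt j : j != i -> beta j < beta i.
      by move=> /eqP; exact: (other_b_lt alpha_ge0 uniq ki k0 ab).
    have [m1 [m1_lt b_le]] := cvg0_bounded_lt bi0 bcv b_lt.
    rewrite (ratioE _ kE).
    exact: (one_large_gt X_ge0 X_indep X_ident X_regvar alpha_ge0 beta_ge0 HSa HSb uba ubb
      s0_gt0 s1_gt0 erefl bi0 ab m1_lt b_le dna).
  + move=> ab Z E.
    (* This case is the preceding one with [alpha] and [beta] exchanged, a symmetry of the
       program. *)
    have uniq' : unique_optimal beta alpha kappa.
      have swap c : optimal beta alpha c <-> optimal alpha beta c.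
        by split=> -[[c0 c1 c2] co]; split=> // c' [c0' c1' c2']; exact: co.
      have [opt' unq] := uniq; split; first exact/swap.
      by move=> k' /swap; exact: unq.
    have kE : kappa i = 1 / alpha i.
      by apply: (kappa_oneE uniq k0) => //; [exact: ltW|left].
    have a_lt j : j != i -> alpha j < alpha i.
      by move=> /eqP; exact: (other_b_lt beta_ge0 uniq' ki k0 ab).
    have [m1 [m1_lt a_le]] := cvg0_bounded_lt ai0 acv a_lt.
    rewrite (ratioE _ kE).
    have := one_large_gt X_ge0 X_indep X_ident X_regvar beta_ge0 alpha_ge0 HSb HSa ubb uba
      s1_gt0 s0_gt0 erefl ai0 ab m1_lt a_le dnb.
    move=> [fE lim]; split => //; move: lim; apply: cvg_trans; apply: near_eq_cvg.
    apply: nearW => x; congr (prob P _ / _).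
    by apply/seteqP; split => t /= [].
Qed.
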